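(* Define $r^*(2)=2$, $r^*(d)=3$ for $3\le d\le 7$, and $r^*(d)=\lceil (d-1)/2\rceil$ for $d\ge 8$. Let $d\ge 2$ be an integer, and let $r,R\in\mathbb{N}$ with $R\ge r\ge r^*(d)$. There exists $\kappa=\kappa_{d,R}>0$, depending on $d$ and $R$ alone, such that with probability tending to $1$ as $n\to\infty$, all but at most $n^{1-\kappa}$ of the vertices of $G_n=G_n(\mathbb{L}^d,r)$ are in components that are $R$-locally $\mathbb{L}^d$ and isomorphic to a quotient of $\mathbb{L}^d$ by a pure-translation subgroup of $\mathrm{Aut}(\mathbb{L}^d)$.
   Context: Graphs are simple and undirected, and need not be connected. An unlabelled graph is an isomorphism class of graphs. $\mathbb{L}^d$ is the graph with vertex-set $\mathbb{Z}^d$ and edge-set $\{\{x,x+e_i\}: x\in\mathbb{Z}^d, 1\le i\le d\}$, where $e_i$ is the $i$th standard unit vector. For a graph $G$, a vertex $v$ and $r\in\mathbb{N}$, $\mathrm{Link}_r(v,G)$ denotes the subgraph of $G$ induced by the set of vertices at graph distance at most $r$ from $v$. If $F$ is a vertex-transitive graph and $u\in V(F)$, a graph $G$ is $r$-locally $F$ if for every $v\in V(G)$ there is a graph isomorphism $\phi:\mathrm{Link}_r(u,F)\to\mathrm{Link}_r(v,G)$ with $\phi(u)=v$ (independent of the choice of $u$). $G_n(F,r)$ denotes a graph chosen uniformly at random from the set of all unlabelled $n$-vertex graphs that are $r$-locally $F$; for $F=\mathbb{L}^d$ this set is nonempty for all sufficiently large $n$. A subgroup $\Gamma\le\mathrm{Aut}(\mathbb{L}^d)$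 is a pure-translation subgroup if every element of $\Gamma$ is a translation $x\mapsto x+v$ with $v\in\mathbb{Z}^d$. The quotient $F/\Gamma$ of a graph $F$ by $\Gamma\le\mathrm{Aut}(F)$ is the multigraph whose vertices are the $\Gamma$-orbits on $V(F)$ and whose edges are the $\Gamma$-orbits on $E(F)$, the orbit of $\{x,y\}$ having as endpoints the orbits of $x$ and of $y$. *)

(* Defs.v *)
From HB Require Import structures.
From mathcomp Require Import all_boot all_order all_algebra.
From mathcomp Require Import all_classical all_reals all_analysis.

Set Implicit Arguments.
Unset Strict Implicit.
Unset Printing Implicit Defensive.

Import Order.TTheory GRing.Theory Num.Theory.
Import numFieldNormedType.Exports.

Record sgraph := SGraph {
  vert :> Type;
  adj : rel vert;
  adj_sym : symmetric adj;
  adj_irr : irreflexive adj }.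

Arguments adj : clear implicits.

Definition is_iso (G H : sgraph) (f : G -> H) : Prop :=
  bijective f /\ forall x y, adj H (f x) (f y) = adj G x y.

Definition isomorphic (G H : sgraph) : Prop := exists f : G -> H, is_iso f.

(* A walk of length [k] from [x] is [x] followed by a sequence of size [k]. *)
Definition dist_le (G : sgraph) (k : nat) (x y : G) : Prop :=
  exists p : seq G, [/\ path (adj G) x p, last x p = y & size p <= k].

Section Induced.
Variables (G : sgraph) (A : set G).

Definition induced_adj : rel (set_type A) :=
  fun x y => adj G (sval x) (sval y).

Lemma induced_adj_sym : symmetric induced_adj.
Proof. by move=> x y; rewrite /induced_adj adj_sym. Qed.

Lemma induced_adj_irr : irreflexive induced_adj.
Proof. by move=> x; rewrite /induced_adj adj_irr. Qed.

Definition induced : sgraph := SGraph induced_adj_sym induced_adj_irr.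

End Induced.

Section Locality.

Definition linkset (G : sgraph) (r : nat) (v : G) : set G :=
  [set w | dist_le r v w]%classic.

Definition Link (G : sgraph) (r : nat) (v : G) : sgraph :=
  induced (linkset r v).

Lemma linkset_center (G : sgraph) (r : nat) (v : G) : v \in linkset r v.
Proof. by rewrite inE; exists [::]. Qed.

Definition link_center (G : sgraph) (r : nat) (v : G) : Link r v :=
  exist _ v (linkset_center r v).

(* [G] is [r]-locally [F]; the choice of the base point [u] is irrelevant as
   soon as [F] is vertex-transitive. *)
Definition locally_at (F : sgraph) (u : F) (r : nat) (G : sgraph) : Prop :=
  forall v : G, exists phi : Link r u -> Link r v,
    is_iso phi /\ phi (link_center r u) = link_center r v.

End Locality.

Section Lattice.
Local Open Scope ring_scope.
Variable d : nat.

Definition lattice_adj : rel 'rV[int]_d := fun x y =>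
  [exists i : 'I_d, (y == x + delta_mx 0 i) || (x == y + delta_mx 0 i)].

Lemma lattice_adj_sym : symmetric lattice_adj.
Proof. by move=> x y; apply: eq_existsb => i; rewrite orbC. Qed.

Lemma lattice_adj_irr : irreflexive lattice_adj.
Proof.
move=> x; apply/negbTE/existsPn => i; rewrite orbb.
apply/eqP => /(congr1 (fun z => z - x)).
rewrite subrr addrAC subrr add0r => /matrixP /(_ 0 i).
by rewrite !mxE !eqxx.
Qed.

Definition lattice : sgraph := SGraph lattice_adj_sym lattice_adj_irr.

Definition origin : lattice := (0 : 'rV[int]_d).

End Lattice.

(* Loops are the edges with a single endpoint. *)
Record multigraph := MultiGraph {
  mvert : Type;
  medge : Type;
  mends : medge -> set mvert;
  mends_pair : forall e, exists x y, mends e = [set x; y]%classic }.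

Definition misomorphic (M N : multigraph) : Prop :=
  exists (f : mvert M -> mvert N) (g : medge M -> medge N),
    [/\ bijective f, bijective g &
        forall e x, mends e x <-> mends (g e) (f x)].

Definition edges (G : sgraph) : set (set G) :=
  [set e | exists x y, adj G x y /\ e = [set x; y]]%classic.

Arguments edges : clear implicits.

Section MultiOfSimple.
Variable G : sgraph.

Definition smends (e : set_type (edges G)) : set G := sval e.

Lemma smends_pair e : exists x y, smends e = [set x; y]%classic.
Proof.
by case: e => e /= /set_mem [x [y [_ ->]]]; exists x, y.
Qed.

Definition to_multigraph : multigraph := MultiGraph smends_pair.

End MultiOfSimple.

(* A subgroup of Aut(F) is encoded as a set of maps F -> F. *)
Record autgroup (F : sgraph) := AutGroup {
  auts :> set (F -> F);
  auts_iso : forall g, auts g -> is_iso g;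
  auts_id : auts id;
  auts_comp : forall g h, auts g -> auts h -> auts (g \o h);
  auts_inv : forall g, auts g ->
    exists h, [/\ auts h, cancel g h & cancel h g] }.

Section Quotient.
Local Open Scope classical_set_scope.
Variables (F : sgraph) (Gam : autgroup F).

Definition vorbit (x : F) : set F := [set g x | g in auts Gam].
Definition eorbit (e : set F) : set (set F) := [set g @` e | g in auts Gam].

Lemma vorbit_aut g x : auts Gam g -> vorbit (g x) = vorbit x.
Proof.
move=> Gg; apply/seteqP; split => _ [h Gh <-].
  by exists (h \o g) => //; apply: auts_comp.
have [k [Gk gk _]] := auts_inv Gg.
by exists (h \o k); [apply: auts_comp | rewrite /= gk].
Qed.

Definition qvert : Type := set_type (range vorbit).
Definition qedge : Type := set_type (eorbit @` edges F).

Definition qends (O : qedge) : set qvert :=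
  [set v | exists e x, [/\ sval O e, e x & sval v = vorbit x]].

Lemma qends_pair O : exists x y, qends O = [set x; y].
Proof.
case: O => O OP; have [e0 [x [y [_ e0E]]] OE] := set_mem OP.
have vP z : vorbit z \in range vorbit by apply/mem_set; exists z.
pose q z : qvert := exist (fun O => O \in range vorbit) _ (vP z).
exists (q x), (q y).
have sval_eq (a b : qvert) : sval a = sval b -> a = b.
  by move=> ab; apply: val_inj.
have Oe0 : O e0.
  by rewrite -OE; exists id; [exact: auts_id | rewrite image_id].
apply/seteqP; split => v.
  case=> e [w [/=]]; rewrite -OE => -[g Gg <-] [z]; rewrite e0E.
  by move=> + <-; rewrite vorbit_aut// => -[->|->] vE;
    [left|right]; apply: sval_eq.
by case=> ->; exists e0; [exists x|exists y]; split=> //; rewrite e0E;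
  [left|right].
Qed.

Definition quotient : multigraph := MultiGraph qends_pair.

End Quotient.

Definition pure_translation (d : nat) (Gam : autgroup (lattice d)) : Prop :=
  forall g, auts Gam g ->
    exists v : 'rV[int]_d, forall x : 'rV[int]_d, g x = (x + v)%R.

(* Labelled graphs on {0, ..., n-1}, given by their edge sets. *)
Definition lgraph (n : nat) : Type :=
  {E : {set {set 'I_n}} | [forall e in E, #|e| == 2]}.

HB.instance Definition _ n := Finite.on (lgraph n).

Section Labelled.
Variables (n : nat) (G : lgraph n).

Definition ladj : rel 'I_n := fun x y => [set x; y]%SET \in sval G.

Lemma ladj_sym : symmetric ladj.
Proof. by move=> x y; rewrite /ladj finset.setUC. Qed.

Lemma ladj_irr : irreflexive ladj.
Proof.
move=> x; apply/negbTE/negP => /(forall_inP (svalP G)).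
by rewrite finset.setUid cards1.
Qed.

Definition graph_of : sgraph := SGraph ladj_sym ladj_irr.

Definition component (v : 'I_n) : sgraph :=
  @induced graph_of [set w | connect ladj v w]%classic.

End Labelled.

Definition liso (n : nat) : rel (lgraph n) :=
  fun G H => `[< isomorphic (graph_of G) (graph_of H) >].

(* Each block is a full isomorphism class of labelled graphs. *)
Definition unlabelled (n : nat) : {set {set lgraph n}} :=
  equivalence_partition (@liso n) [set: lgraph n]%SET.

Definition unlabelled_with (n : nat) (P : lgraph n -> Prop) :
    {set {set lgraph n}} :=
  [set C in unlabelled n | [forall G in C, `[< P G >]]]%SET.

Definition locally_lattice (d r : nat) (G : sgraph) : Prop :=
  locally_at (origin d) r G.

(* The probability that G_n(L^d, r) satisfies the isomorphism-invariant
   property [P]; the value is 0 if there is no graph to choose from. *)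
Definition prob_Gn (K : realType) (d r n : nat) (P : lgraph n -> Prop) : K :=
  let Q G := locally_lattice d r (graph_of G) in
  (#|unlabelled_with (fun G => Q G /\ P G)|%:R / #|unlabelled_with Q|%:R)%R.

Definition good_vertex (d R n : nat) (G : lgraph n) (v : 'I_n) : Prop :=
  locally_lattice d R (component G v) /\
  exists Gam : autgroup (lattice d), pure_translation Gam /\
    misomorphic (to_multigraph (component G v)) (quotient Gam).

Definition bad_vertices (d R n : nat) (G : lgraph n) : {set 'I_n} :=
  [set v | ~~ `[< good_vertex d R G v >]]%SET.

Definition rstar (d : nat) : nat :=
  if d == 2 then 2 else if d <= 7 then 3 else uphalf d.-1.

(* Main.v *)
Require Import Defs.
From HB Require Import structures.
From mathcomp Require Import all_boot all_order all_algebra all_fingroup.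
From mathcomp Require Import zify ring lra.
From mathcomp Require Import all_classical all_reals all_analysis.
Set Implicit Arguments.
Unset Strict Implicit.
Unset Printing Implicit Defensive.
Import Order.TTheory GRing.Theory Num.Theory.

(** Every component of an r-locally L^d graph is covered by Z^d: frames (a vertex with its
    neighbours labelled by the 2d directions, compatibly with a chart) can be moved along the
    directions, these moves commute, and the orbit of a frame is a covering p. Two points of a
    fibre of p differ by an affine map z |-> z A + v of Z^d preserving p, with A a signed
    permutation matrix. If all these maps are translations and no nonzero translation among them
    has l1-norm at most 2R+1, the component is R-locally L^d and is the quotient by that group.

    Otherwise the lattice L of periods of p is invariant under an integer matrix N with
    N^2 = hN, N <> 0 and N <> h: the sum of the powers of some A <> 1, which is nonzero because
    otherwise z |-> z A + v would have a rational fixed point, hence (by rounding, as d <= 2r+1)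
    an integral one; or the matrix e_j^T w of a short period w. Up to bounded index such an L
    splits into a part in the image of N and a part in the image of h - N, both of lower rank, so
    there are only O(m^(d-1) log^(2d-2) m) bad components on at most m vertices. On the other
    hand circulant graphs give at least a constant times s^d good components with between s and
    2s vertices.

    So graphs whose bad components cover m >= n^(1-kappa) vertices are rare: discarding the bad
    components loses little information, and the freed vertices can be used for circulants in
    far more ways. With d = k+1, Q = (d+1)(2d+3), kappa = 1/Q and u = n^(1/Q), it suffices to take
    circulants of size about u^(2d+4) and to call a bad component small if it has at most
    u^(2d+5) vertices. *)

(** * Directions and signed permutations of the lattice *)

Section Directions.
Local Open Scope ring_scope.
Variable d : nat.
Local Notation Zd := 'rV[int]_d.

Local Notation dir := ('I_d * bool)%type.

Definition opp (e : dir) : dir := (e.1, ~~ e.2).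

Definition dv (e : dir) : Zd := (-1) ^+ e.2 *: delta_mx 0 e.1.

Lemma dvE e i : dv e 0 i = (-1) ^+ e.2 * (i == e.1)%:R.
Proof. by rewrite !mxE eqxx. Qed.

Lemma dv_opp e : dv (opp e) = - dv e.
Proof. by rewrite /dv /=; case: e.2; rewrite ?expr1 ?expr0 ?scaleN1r ?scale1r ?opprK. Qed.

Lemma oppK : involutive opp.
Proof. by case=> i b; rewrite /opp /= negbK. Qed.

Lemma opp_neq e : opp e != e.
Proof. by case: e => i [] ; rewrite /opp xpair_eqE eqxx. Qed.

Lemma dv_inj : injective dv.
Proof.
move=> [i b] [j c] /matrixP H; have := H 0 i; have := H 0 j.
rewrite !dvE /= !eqxx.
have [->|ij] := eqVneq i j; last by case: b c {H} => -[].
by rewrite ?eqxx; case: b c {H} => -[].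
Qed.

Lemma dv_square e f e' f' : dv e + dv f = dv e' + dv f' -> e != e' ->
  (f = e' /\ f' = e) \/ (f = opp e /\ f' = opp e').
Proof.
move: e f e' f' => [i a] [j b] [k c] [l g] /matrixP H; rewrite xpair_eqE => ne.
have := H 0 l; have := H 0 k; have := H 0 j; have := H 0 i => {H}.
rewrite ![(dv _ + dv _) _ _]mxE !dvE /= !eqxx /opp /=.
have [?|ij] := eqVneq i j; have [?|ik] := eqVneq i k; have [?|il] := eqVneq i l;
have [?|jk] := eqVneq j k; have [?|jl] := eqVneq j l; have [?|kl] := eqVneq k l; subst;
  rewrite ?eqxx ?(negbTE ij) ?(negbTE ik) ?(negbTE il) ?(negbTE jk) ?(negbTE jl) ?(negbTE kl)
  1?eq_sym ?(negbTE ij) ?(negbTE ik) ?(negbTE il) ?(negbTE jk) ?(negbTE jl) ?(negbTE kl) in ne *;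
  try (by rewrite eqxx in ij); try (by rewrite eqxx in ik); try (by rewrite eqxx in il);
  try (by rewrite eqxx in jk); try (by rewrite eqxx in jl); try (by rewrite eqxx in kl);
  case: a b c g ne => -[] -[] -[] //=; rewrite ?eqxx //=; auto.
all: by case: eqP => // ?; subst; rewrite ?eqxx in ij ik il jk jl kl.
Qed.

Lemma latP (x y : Zd) : reflect (exists e, y = x + dv e) (lattice_adj x y).
Proof.
apply: (iffP existsP) => [[i /orP[/eqP->|/eqP->]]|[[i []] ->]].
- by exists (i, false); rewrite /dv expr0 scale1r.
- by exists (i, true); rewrite /dv expr1 scaleN1r addrK.
- by exists i; rewrite /dv expr1 scaleN1r subrK eqxx orbT.
- by exists i; rewrite /dv expr0 scale1r eqxx.
Qed.

Definition nrm (x : Zd) : nat := (\sum_(i < d) `|x ord0 i|)%N.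

Lemma nrm0 : nrm 0 = 0%N.
Proof. by rewrite /nrm big1 // => i _; rewrite mxE. Qed.

Lemma nrm_eq0 x : nrm x = 0%N -> x = 0.
Proof.
move=> /eqP; rewrite sum_nat_eq0 => /forallP H; apply/matrixP => i j.
by rewrite mxE ord1; have /implyP/(_ isT) := H j; rewrite absz_eq0 => /eqP.
Qed.

Lemma nrmN x : nrm (- x) = nrm x.
Proof. by apply: eq_bigr => i _; rewrite mxE abszN. Qed.

Lemma nrmD x y : (nrm (x + y) <= nrm x + nrm y)%N.
Proof. by rewrite -big_split; apply: leq_sum => i _; rewrite mxE /=; move: (x _ _) (y _ _) => a b; lia. Qed.

Lemma nrm_dv e : nrm (dv e) = 1%N.
Proof.
rewrite /nrm (bigD1 e.1) //= big1 => [|i ne]; rewrite dvE ?eqxx ?(negbTE ne).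
  by case: e.2.
by rewrite mulr0.
Qed.

Lemma nrm_dvD x e : (nrm (x + dv e) <= (nrm x).+1)%N.
Proof. by rewrite (leq_trans (nrmD _ _)) // nrm_dv addn1. Qed.

Lemma nrm_dec x k : nrm x = k.+1 -> exists e, nrm (x - dv e) = k.
Proof.
move=> xk; have [i xi] : exists i, x 0 i != 0.
  apply/existsP; apply: contra_eqT xk => /existsPn H.
  by rewrite (_ : x = 0) ?nrm0 //; apply/matrixP => j i; rewrite ord1 mxE; have := H i; lia.
exists (i, x 0 i < 0); move: xk.
have E y : nrm y = (`|y ord0 i| + \sum_(j < d | j != i) `|y ord0 j|)%N by rewrite /nrm (bigD1 i).
have S e j : (x - dv e) ord0 j = x 0 j - dv e 0 j by rewrite !mxE.
rewrite !E [X in _ -> (_ + X = _)%N](eq_bigr (fun j => `|x ord0 j|)%N) => [|j ne].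
  rewrite S dvE /= eqxx mulr1.
  by move: (x _ _) xi (\sum_(_ < _ | _) _)%N => z z0 t; case: (ltP z 0) => /= ?; rewrite ?expr0 ?expr1; lia.
by rewrite S dvE /= (negbTE ne) mulr0 subr0.
Qed.

Lemma nrm_indS (P : Zd -> Prop) : P 0 ->
  (forall x e, nrm (x + dv e) = (nrm x).+1 -> P x -> P (x + dv e)) ->
  forall x, P x.
Proof.
move=> P0 PS x; move: {2}(nrm x) (erefl (nrm x)) => k.
elim: k x => [|k IH] x xk; first by rewrite (nrm_eq0 xk).
have [e ek] := nrm_dec xk; rewrite -(subrK (dv e) x).
by apply: PS; rewrite ?subrK ?ek //; apply: IH.
Qed.

Lemma nrm_split x a b : (nrm x <= a + b)%N ->
  exists z, (nrm z <= a)%N /\ (nrm (x - z) <= b)%N.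
Proof.
elim: a x => [|a IH] x; first by exists 0; rewrite subr0 nrm0.
case xk : (nrm x) => [|k] le; first by exists 0; rewrite subr0 nrm0 xk.
have [e ek] := nrm_dec xk; have [|z [za zb]] := IH (x - dv e); first by rewrite ek; lia.
exists (z + dv e); split; first by rewrite (leq_trans (nrm_dvD _ _)).
by rewrite opprD addrA addrAC.
Qed.

Definition signed (s : {perm dir}) := forall e, s (opp e) = opp (s e).

Definition amx (s : {perm dir}) : 'M[int]_d :=
  \matrix_(i < d, j < d) dv (s (i, false)) 0 j.

Lemma dv_amx s e : signed s -> dv e *m amx s = dv (s e).
Proof.
move=> ss; have E i : dv (i, false) *m amx s = dv (s (i, false)).
  rewrite /dv expr0 scale1r -rowE; apply/rowP => j.
  by rewrite mxE mxE.
case: e => i [] //; have -> : (i, true) = opp (i, false) by [].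
by rewrite ss !dv_opp mulNmx E.
Qed.

Lemma amx_eq (A B : 'M[int]_d) : (forall e, dv e *m A = dv e *m B) -> A = B.
Proof.
move=> H; apply/row_matrixP => i; have := H (i, false).
by rewrite /dv expr0 scale1r -!rowE.
Qed.

Lemma signedM s t : signed s -> signed t -> signed (s * t)%g.
Proof. by move=> ss st e; rewrite !permM ss st. Qed.

Lemma signedV s : signed s -> signed s^-1%g.
Proof. by move=> ss e; apply: (@perm_inj _ s); rewrite ss !permKV. Qed.

Lemma signed1 : signed 1%g.
Proof. by move=> e; rewrite !perm1. Qed.

Lemma signedX s k : signed s -> signed (s ^+ k)%g.
Proof.
by move=> ss; elim: k => [|k IH]; rewrite ?expg0 ?expgS; [exact: signed1|exact: signedM].
Qed.

Lemma amxM s t : signed s -> signed t -> amx (s * t)%g = amx s *m amx t.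
Proof.
move=> ss st; apply: amx_eq => e.
by rewrite mulmxA !dv_amx ?permM //; apply: signedM.
Qed.

Lemma amx1 : amx 1%g = 1%:M.
Proof. by apply: amx_eq => e; rewrite mulmx1 dv_amx ?perm1 //; apply: signed1. Qed.

Lemma amx_inj s t : signed s -> signed t -> amx s = amx t -> s = t.
Proof.
by move=> ss st E; apply/permP => e; apply: dv_inj; rewrite -!dv_amx // E.
Qed.

Lemma amxK s (x : Zd) : signed s -> x *m amx s *m amx s^-1 = x.
Proof. by move=> ss; rewrite -mulmxA -amxM ?mulgV ?amx1 ?mulmx1 //; apply: signedV. Qed.

Lemma amxVK s (x : Zd) : signed s -> x *m amx s^-1 *m amx s = x.
Proof. by move=> ss; rewrite -mulmxA -amxM ?mulVg ?amx1 ?mulmx1 //; apply: signedV. Qed.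

Lemma nrm_amx s x : signed s -> (nrm (x *m amx s) <= nrm x)%N.
Proof.
move=> ss; elim/nrm_indS: x => [|x e -> IH]; first by rewrite mul0mx.
by rewrite mulmxDl dv_amx // (leq_trans (nrm_dvD _ _)).
Qed.

End Directions.

(** * Charts *)

Lemma inj_surj_bij (A B : Type) (f : A -> B) :
  injective f -> (forall y, exists x, f x = y) -> bijective f.
Proof.
by move=> inj /choice[g gK]; exists g => // x; apply: inj; rewrite gK.
Qed.

Section Charts.
Local Open Scope ring_scope.
Variables (d : nat) (G : sgraph).
Local Notation Zd := 'rV[int]_d.
Local Notation dir := ('I_d * bool)%type.

Definition nbr (phi : Zd -> G) (x : Zd) : Prop :=
  [/\ forall e, adj G (phi x) (phi (x + dv e)),
      injective (fun e => phi (x + dv e)) &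
      forall b, adj G (phi x) b -> exists e, b = phi (x + dv e)].

(* An isomorphism from the [rho]-ball of the lattice onto the [rho]-ball around [phi 0]; the
   values outside the ball are irrelevant, except that [phi (x + dv e)] is still in the ball
   when [nrm x < rho]. *)
Definition chart (rho : nat) (phi : Zd -> G) : Prop :=
  [/\ forall x y, (nrm x <= rho)%N -> (nrm y <= rho)%N -> phi x = phi y -> x = y,
      forall x y, (nrm x <= rho)%N -> (nrm y <= rho)%N ->
        adj G (phi x) (phi y) = lattice_adj x y &
      forall x b, (nrm x < rho)%N -> adj G (phi x) b -> exists e, b = phi (x + dv e)].

Lemma nrm_inner (x : Zd) e k : (nrm x < k)%N -> (nrm (x + dv e) <= k)%N.
Proof. by move=> xk; rewrite (leq_trans (nrm_dvD _ _)). Qed.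

Lemma lattice_adj_dv (x : Zd) e : lattice_adj x (x + dv e).
Proof. by apply/latP; exists e. Qed.

Lemma chart_nbr rho phi x : chart rho phi -> (nrm x < rho)%N -> nbr phi x.
Proof.
move=> [inj hom sur] xr; split=> [e|e f|b]; last exact: sur.
  by rewrite hom ?lattice_adj_dv ?nrm_inner // ltnW.
by move=> /inj -/(_ (nrm_inner _ xr) (nrm_inner _ xr))/addrI/dv_inj.
Qed.

Lemma chart_sqr rho phi x f : chart rho phi -> (nrm x < rho)%N ->
  (nrm (x + dv f) < rho)%N ->
  forall e, adj G (phi (x + dv e)) (phi (x + dv f + dv e)).
Proof.
move=> [inj hom sur] xr xfr e.
by rewrite hom ?nrm_inner // addrAC lattice_adj_dv.
Qed.

Lemma chart_le rho rho' phi : (rho' <= rho)%N -> chart rho phi -> chart rho' phi.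
Proof.
move=> le [inj hom sur]; split=> [x y xr yr|x y xr yr|x b xr].
- by apply: inj; apply: leq_trans le.
- by apply: hom; apply: leq_trans le.
- by apply: sur; apply: leq_trans le.
Qed.

Lemma chart_amx rho phi s : signed s -> chart rho phi ->
  chart rho (fun x => phi (x *m amx s)).
Proof.
move=> ss [inj hom sur]; have le x k : (nrm x <= k)%N -> (nrm (x *m amx s) <= k)%N.
  by apply: leq_trans; apply: nrm_amx.
split=> [x y xr yr /inj|x y xr yr|x b xr].
- by move=> /(_ (le _ _ xr) (le _ _ yr)) E; rewrite -(amxK x ss) E amxK.
- rewrite hom ?le //; apply/latP/latP => -[e E].
    by exists (s^-1%g e); rewrite -(amxK y ss) E mulmxDl amxK // dv_amx //; apply: signedV.
  by exists (s e); rewrite E mulmxDl dv_amx.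
- move=> /sur-/(_ (leq_ltn_trans (nrm_amx _ ss) xr))[e ->].
  by exists (s^-1%g e); rewrite mulmxDl dv_amx // permKV.
Qed.

Lemma dist_le_step (H : sgraph) k (a b c : H) :
  dist_le k a b -> adj H b c -> dist_le k.+1 a c.
Proof.
move=> [p [pp <- sp]] bc; exists (rcons p c).
by rewrite rcons_path pp bc last_rcons size_rcons.
Qed.

Lemma dist_le_walk (H : sgraph) (phi : Zd -> H) k :
  (forall x e, (nrm x < k)%N -> adj H (phi x) (phi (x + dv e))) ->
  forall x, (nrm x <= k)%N -> dist_le (nrm x) (phi 0) (phi x).
Proof.
move=> A; elim/nrm_indS => [_|x e -> IH xk]; first by exists [::]; rewrite nrm0.
by apply: dist_le_step (IH (ltnW xk)) (A _ _ xk).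
Qed.

Lemma dist_leW (H : sgraph) k l (a b : H) : (k <= l)%N -> dist_le k a b -> dist_le l a b.
Proof. by move=> kl [p [pp pl ps]]; exists p; split=> //; apply: leq_trans kl. Qed.

Lemma nbr_walk (p : Zd -> G) x k b : (forall y, nbr p y) -> dist_le k (p x) b ->
  exists y, (nrm (y - x)%R <= k)%N /\ b = p y.
Proof.
move=> np [q [+ <- qk]]; elim: q x k qk => [|a q IH] x [|k] //= qk.
  1,2: by exists x; rewrite subrr nrm0.
move=> /andP[xa]; have [_ _ S] := np x; have [e ->] := S a xa.
move=> /(IH _ k qk)[y [yk ->]]; exists y; split=> //.
have -> : y - x = y - (x + dv e) + dv e by rewrite opprD addrA subrK.
by rewrite (leq_trans (nrm_dvD _ _)).
Qed.

Lemma lattice_dist (x : Zd) k : dist_le (G := lattice d) k (0 : Zd) x <-> (nrm x <= k)%N.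
Proof.
split=> [[p [pp <- ps]]|xk]; last first.
  apply: dist_leW xk _; apply: (@dist_le_walk (lattice d) id (nrm x)) => // y e _.
  exact: lattice_adj_dv.
apply: leq_trans ps; rewrite -[last _ p]subr0.
elim: p (0 : Zd) pp => [|y p IH] x0 /=; first by rewrite subrr nrm0.
move=> /andP[/latP[e ->]] /IH le.
rewrite (_ : last _ _ - x0 = (last (x0 + dv e) p - (x0 + dv e)) + dv e); last first.
  by rewrite opprD addrA subrK.
by rewrite (leq_trans (nrm_dvD _ _)).
Qed.

Lemma locally_chart r v : locally_lattice d r G ->
  exists phi, chart r phi /\ phi 0 = v.
Proof.
move=> /(_ v)[psi [[[psi' psiK psi'K] hom] ctr]].
have mem x : (nrm x <= r)%N -> x \in linkset r (origin d).
  by move=> xr; rewrite inE; apply/lattice_dist.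
pose phi x := if pselect (nrm x <= r)%N is left h
  then sval (psi (exist _ x (mem x h))) else v.
have phiE x h : phi x = sval (psi (exist _ x (mem x h))).
  by rewrite /phi; case: pselect => // h'; congr (sval (psi _)); apply: val_inj.
have homE x y : (nrm x <= r)%N -> (nrm y <= r)%N ->
    adj G (phi x) (phi y) = lattice_adj x y.
  by move=> xr yr; rewrite !phiE; apply: hom.
have phi0 : phi 0 = v.
  have h : (nrm (0 : Zd) <= r)%N by rewrite nrm0.
  rewrite (phiE _ h) (_ : exist _ _ _ = link_center r (origin d)) ?ctr //.
  exact: val_inj.
exists phi; split=> //; split=> // [x y xr yr|x b xr xb].
  by rewrite !phiE => /val_inj/(can_inj psiK)[].
have bm : b \in linkset r v.
  rewrite inE; apply: (dist_leW xr); apply: (@dist_le_step G _ v (phi x)) => //.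
  rewrite -phi0; apply: (@dist_le_walk G phi (nrm x)) => // y e yx.
  by rewrite homE ?lattice_adj_dv //; have := nrm_dvD y e; lia.
have := psi'K (exist _ b bm); case: (psi' _) => y ym.
have yr : (nrm y <= r)%N by move: ym; rewrite inE => /lattice_dist.
move=> E; have {}E : phi y = b.
  by rewrite (phiE _ yr) (_ : exist _ _ _ = exist _ y ym) ?E //; apply: val_inj.
by move: xb; rewrite -E homE ?(ltnW xr) // => /latP[e ->]; exists e.
Qed.

Lemma chart_walk rho phi (q : seq G) x : chart rho phi ->
  path (adj G) (phi x) q -> (nrm x + size q <= rho)%N ->
  exists y, (nrm y <= rho)%N /\ last (phi x) q = phi y.
Proof.
move=> [inj hom sur]; elim: q x => [|b q IH] x /=.
  by rewrite addn0; exists x.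
move=> /andP[xb bq] le; have xr : (nrm x < rho)%N by lia.
have [e bE] := sur x b xr xb; rewrite bE in bq *; apply: IH bq _.
by have := nrm_dvD x e; lia.
Qed.

Lemma chart_link rho phi : chart rho phi ->
  exists psi : Link rho (origin d) -> Link rho (phi 0),
    is_iso psi /\ psi (link_center rho (origin d)) = link_center rho (phi 0).
Proof.
move=> ch; have [inj hom sur] := ch.
have inN (x : Zd) : x \in linkset rho (origin d) -> (nrm x <= rho)%N.
  by rewrite inE => /lattice_dist.
have mem x : x \in linkset rho (origin d) -> phi x \in linkset rho (phi 0).
  move=> /inN xr; rewrite inE; apply: (dist_leW xr).
  apply: (@dist_le_walk G phi (nrm x)) => // y e yx.
  by rewrite hom ?lattice_adj_dv //; [|apply: nrm_inner]; apply: leq_trans xr; rewrite // ltnW.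
exists (fun w => exist _ (phi (sval w)) (mem _ (svalP w))); split; last exact: val_inj.
split; last first.
  by move=> [x xm] [y ym]; rewrite /= /induced_adj /= hom //; apply: inN.
apply: inj_surj_bij => [[x xm] [y ym] /(congr1 sval)/= E|[b bm]].
  by apply: val_inj; apply: inj => //; apply: inN.
have := bm; rewrite inE => -[q [pq lq sq]].
have [|y [yr yE]] := chart_walk ch pq; first by rewrite nrm0.
have ym : y \in linkset rho (origin d) by rewrite inE; apply/lattice_dist.
by exists (exist _ y ym); apply: val_inj; rewrite /= -yE.
Qed.

Definition sq_uniq : Prop := forall v a b c c',
  adj G v a -> adj G v b -> a <> b -> adj G a c -> adj G b c ->
  adj G a c' -> adj G b c' -> c <> v -> c' <> v -> c = c'.

Lemma chart_sq_uniq : (forall v, exists phi, chart 2 phi /\ phi 0 = v) -> sq_uniq.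
Proof.
move=> H v a b c c' va vb ab ac bc ac' bc' cv c'v.
have [phi [ch phi0]] := H v; have [inj hom sur] := ch.
have n2 e f : (nrm (dv e + dv f : Zd) <= 2)%N by rewrite nrm_inner // nrm_dv.
have [e ea] : exists e, a = phi (dv e).
  by have [||e] := sur 0 a; rewrite ?nrm0 ?phi0 // add0r => ->; exists e.
have [f fb] : exists e, b = phi (dv e).
  by have [||e0] := sur 0 b; rewrite ?nrm0 ?phi0 // add0r => ->; exists e0.
have ef : e != f by apply/eqP => ef; apply: ab; rewrite ea fb ef.
suff key z : adj G a z -> adj G b z -> z <> v -> z = phi (dv e + dv f).
  by rewrite (key c) // (key c').
rewrite ea fb => /sur[|g ->]; rewrite ?nrm_dv // => /sur[|h]; rewrite ?nrm_dv //.
move=> /inj -/(_ (n2 _ _) (n2 _ _)) E; case: (dv_square E ef) => [[-> _]//|[-> _]].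
by rewrite dv_opp subrr phi0.
Qed.

End Charts.

Section Agree.
Local Open Scope ring_scope.
Variables (d : nat) (G : sgraph).
Local Notation Zd := 'rV[int]_d.
Local Notation dir := ('I_d * bool)%type.

Definition agree (phi : Zd -> G) x (phi' : Zd -> G) x' :=
  phi x = phi' x' /\ forall e, phi (x + dv e) = phi' (x' + dv e).

(* A common neighbour of two neighbours of a vertex is determined by them, so the images of
   the neighbours of [x] determine those of the neighbours of [x + dv f], one direction ([f]
   itself) being found by elimination. *)
Lemma agree_step (phi phi' : Zd -> G) x x' f : sq_uniq G ->
  nbr phi x -> nbr phi (x + dv f) -> nbr phi' (x' + dv f) ->
  (forall e, adj G (phi (x + dv e)) (phi (x + dv f + dv e))) ->
  (forall e, adj G (phi' (x' + dv e)) (phi' (x' + dv f + dv e))) ->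
  agree phi x phi' x' -> agree phi (x + dv f) phi' (x' + dv f).
Proof.
move=> sq [A1 I1 _] [A2 I2 _] [A3 I3 S3] Q1 Q2 [E0 E]; split=> [|e]; first exact: E.
have back (y : Zd) : y + dv f + dv (opp f) = y by rewrite dv_opp addrK.
have far e0 : e0 != opp f -> e0 != f -> phi (x + dv f + dv e0) = phi' (x' + dv f + dv e0).
  move=> nop nf; apply: (sq (phi x) (phi (x + dv f)) (phi (x + dv e0))) => //.
  - by move/I1 => ef; rewrite ef eqxx in nf.
  - by rewrite E.
  - by rewrite E.
  - by rewrite -{2}(back x) => /I2 ee; rewrite ee eqxx in nop.
  - by rewrite E0 -{2}(back x') => /I3 ee; rewrite ee eqxx in nop.
have [->|nop] := eqVneq e (opp f); first by rewrite !back.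
have [->|nf] := eqVneq e f; last exact: far.
have /S3[g gE] : adj G (phi' (x' + dv f)) (phi (x + dv f + dv f)) by rewrite -E.
have [gf|gf] := eqVneq g f; first by rewrite gE gf.
have [gp|gp] := eqVneq g (opp f).
  move: gE; rewrite gp back -E0 -{2}(back x) => /I2 ff.
  by have := opp_neq f; rewrite -ff eqxx.
by move: gE; rewrite -far // => /I2 ff; rewrite ff eqxx in gf.
Qed.

End Agree.

(** * The covering by the lattice *)

Section Frames.
Local Open Scope ring_scope.
Variables (d r : nat) (G : sgraph).
Local Notation Zd := 'rV[int]_d.
Local Notation dir := ('I_d * bool)%type.
Hypothesis r2 : (2 <= r)%N.
Hypothesis r3 : (3 <= r)%N \/ d = 2%N.
Hypothesis locG : forall v, exists phi : Zd -> G, chart r phi /\ phi 0 = v.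

Lemma local_sq_uniq : sq_uniq G.
Proof.
apply: (@chart_sq_uniq d) => v; have [phi [ch p0]] := locG v.
by exists phi; split=> //; apply: chart_le ch.
Qed.

Definition antipodal (v b c : G) := forall z, adj G b z -> adj G c z -> z = v.

Lemma dv_antipode (e f g h : dir) : dv e + dv g = dv f + dv h -> e != f ->
  f = opp e -> g = opp e.
Proof. by move=> E ef fe; case: (dv_square E ef) => -[-> _]. Qed.

Lemma chart_antipodal (phi : Zd -> G) e : chart r phi ->
  antipodal (phi 0) (phi (dv e)) (phi (dv (opp e))).
Proof.
move=> [inj hom sur] z /sur[|f ->]; first by rewrite nrm_dv.
move=> /sur[|g]; first by rewrite nrm_dv.
have n2 (a b : dir) : (nrm (dv a + dv b : Zd) <= r)%N.
  by rewrite (leq_trans _ r2) // nrm_inner // nrm_dv.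
move/inj => /(_ (n2 _ _) (n2 _ _)) /dv_antipode-> //; last by rewrite eq_sym opp_neq.
by rewrite dv_opp subrr.
Qed.

Lemma antipodal_chart (phi : Zd -> G) e f : chart r phi -> e != f ->
  antipodal (phi 0) (phi (dv e)) (phi (dv f)) -> f = opp e.
Proof.
move=> [inj hom sur] ef anti; apply/eqP/negP => /negP fe.
have n1 (a : dir) : (nrm (dv a : Zd) <= r)%N by rewrite nrm_dv ltnW.
have n2 (a b : dir) : (nrm (dv a + dv b : Zd) <= r)%N.
  by rewrite (leq_trans _ r2) // nrm_inner // nrm_dv.
have /inj : phi (dv e + dv f) = phi 0.
  apply: anti; rewrite hom //; first exact: lattice_adj_dv.
  by rewrite addrC lattice_adj_dv.
rewrite nrm0 => /(_ (n2 _ _) isT) E.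
have /dv_inj ff : dv f = dv (opp e) by rewrite dv_opp -[dv f](addKr (dv e)) E addr0.
by rewrite ff eqxx in fe.
Qed.

Lemma signed_dim2 (s : {perm dir}) f : d = 2%N -> s (opp f) = opp (s f) -> signed s.
Proof.
move=> d2 sf e; have ord2 (a b c : 'I_d) : a != c -> b != c -> a = b.
  move=> ac bc; apply: val_inj; move: ac bc; rewrite -!val_eqE /=.
  have lt2 (i : 'I_d) : (val i < 2)%N by have := ltn_ord i; rewrite [X in (_ < X)%N -> _]d2.
  move: (lt2 a) (lt2 b) (lt2 c) => /=.
  by case: (nat_of_ord a) (nat_of_ord b) (nat_of_ord c) => [|[]] // [|[]] // [|[]].
have same (a b : dir) : a.1 = b.1 -> a <> b -> a = opp b.
  by case: a b => [i []] [j []] //= -> // ne; rewrite /opp.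
have [ef|ef] := eqVneq e.1 f.1.
  have [->|nef] := eqVneq e f; first exact: sf.
  by rewrite (same e f ef (elimN eqP nef)) oppK sf oppK.
have out (a : dir) : a.1 != f.1 -> (s a).1 != (s f).1.
  move=> af; apply: contra af => /eqP E; apply/eqP.
  have [/perm_inj->//|/eqP ne] := eqVneq (s a) (s f).
  by have := same _ _ E ne; rewrite -sf => /perm_inj ->.
apply: same; first by apply: ord2 (out _ _) (out _ _).
by move/perm_inj => ee; have := opp_neq e; rewrite ee eqxx.
Qed.

Lemma frame_step (phi : Zd -> G) f : chart r phi ->
  exists psi : Zd -> G, [/\ chart r psi, psi 0 = phi (dv f) &
    forall e, psi (dv e) = phi (dv f + dv e)].
Proof.
move=> ch; have [psi0 [ch0 p0]] := locG (phi (dv f)).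
have nf : (nrm (dv f : Zd) < r)%N by rewrite nrm_dv.
have [A I S] := chart_nbr ch nf; have [inj hom sur] := ch.
have r0 : (nrm (0 : Zd) < r)%N by rewrite nrm0; lia.
have [A0 I0 S0] := chart_nbr ch0 r0.
have /choice[pi0 pi0E] e : exists e', phi (dv f + dv e) = psi0 (dv e').
  by have [|e'] := S0 (phi (dv f + dv e)); rewrite ?p0 ?add0r // => ->; exists e'.
have pi_inj : injective pi0 by move=> a b E; apply: I; rewrite /= !pi0E E.
pose s := perm pi_inj.
have n2 (a b : dir) : (nrm (dv a + dv b : Zd) <= r)%N.
  by rewrite (leq_trans _ r2) // nrm_inner // nrm_dv.
have antiS e : antipodal (phi (dv f)) (phi (dv f + dv e)) (phi (dv f + dv (opp e))) ->
    s (opp e) = opp (s e).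
  rewrite !pi0E -p0 !permE => /antipodal_chart -> //.
  by apply/eqP => /pi_inj E; have := opp_neq e; rewrite -E eqxx.
have ss : signed s.
  case: r3 => [r3'|d2].
    move=> e; apply: antiS => z.
    have n3 (a : dir) : (nrm (dv f + dv a : Zd) < r)%N.
      by apply: leq_trans r3'; rewrite ltnS nrm_inner // nrm_dv.
    move=> /sur-/(_ (n3 _))[g ->] /sur-/(_ (n3 _))[h].
    move=> /inj -/(_ (nrm_inner _ (n3 _)) (nrm_inner _ (n3 _))).
    rewrite -!addrA => /addrI/dv_antipode->; rewrite ?dv_opp ?subrr ?addr0 //.
    by rewrite eq_sym opp_neq.
  apply: (signed_dim2 (f := f)) => //; apply: antiS => z zf.
  rewrite dv_opp subrr => /sur-/(_ r0)[g zg]; move: zf; rewrite zg add0r hom //; last first.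
    by rewrite nrm_dv; lia.
  case/latP => h E; congr phi; have [->//|gf] := eqVneq f g.
  have : dv f + dv f = dv g + dv (opp h) by rewrite dv_opp E addrK.
  case/dv_square => // -[fE]; last by have := opp_neq f; rewrite -fE eqxx.
  by rewrite fE eqxx in gf.
exists (fun x => psi0 (x *m amx s)); split; first exact: chart_amx.
  by rewrite mul0mx.
by move=> e; rewrite dv_amx // permE -pi0E.
Qed.

Definition frame (s : G * (dir -> G)) := exists phi : Zd -> G,
  [/\ chart r phi, phi 0 = s.1 & forall e, phi (dv e) = s.2 e].

Definition fstate := {s | frame s}.

Lemma fstate_eq (s t : fstate) : sval s = sval t -> s = t.
Proof.
by case: s t => [s fs] [t ft] /= E; subst; congr exist; apply: Prop_irrelevance.
Qed.

Definition fchart (s : fstate) : Zd -> G := sval (cid (svalP s)).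

Lemma fchartP (s : fstate) : [/\ chart r (fchart s), fchart s 0 = (sval s).1 &
  forall e, fchart s (dv e) = (sval s).2 e].
Proof. by rewrite /fchart; case: cid. Qed.

Lemma nxt_subproof f (s : fstate) :
  frame (fchart s (dv f), fun e => fchart s (dv f + dv e)).
Proof. by have [ch _ _] := fchartP s; apply: frame_step. Qed.

Definition nxt f (s : fstate) : fstate := exist _ _ (nxt_subproof f s).

Lemma nxtE f (s : fstate) (theta : Zd -> G) y :
  theta y = (sval s).1 -> (forall e, theta (y + dv e) = (sval s).2 e) ->
  nbr theta (y + dv f) ->
  (forall e, adj G (theta (y + dv e)) (theta (y + dv f + dv e))) ->
  theta (y + dv f) = (sval (nxt f s)).1 /\
  forall e, theta (y + dv f + dv e) = (sval (nxt f s)).2 e.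
Proof.
move=> E0 E N Q; have [ch c0 ce] := fchartP s.
have r0 : (nrm (0 : Zd) < r)%N by rewrite nrm0; lia.
have rf : (nrm (dv f : Zd) < r)%N by rewrite nrm_dv.
have [] := @agree_step d G (fchart s) theta 0 y f local_sq_uniq.
- exact: chart_nbr ch _.
- by rewrite add0r; apply: chart_nbr ch _.
- exact: N.
- by apply: chart_sqr ch _ _; rewrite ?add0r.
- exact: Q.
- by split=> [|e]; rewrite ?c0 ?E0 // add0r ce E.
- by rewrite add0r => <- H; split=> // e; rewrite -H.
Qed.

Lemma nxtK f s : nxt (opp f) (nxt f s) = s.
Proof.
have [ch c0 ce] := fchartP s.
have back : dv f + dv (opp f) = 0 :> Zd by rewrite dv_opp subrr.
have r0 : (nrm (0 : Zd) < r)%N by rewrite nrm0; lia.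
have rf : (nrm (dv f : Zd) < r)%N by rewrite nrm_dv.
have [] := @nxtE (opp f) (nxt f s) (fchart s) (dv f); rewrite ?back //.
- exact: chart_nbr ch _.
- by move=> e; have := @chart_sqr _ _ _ _ _ (opp f) ch rf; rewrite back; apply.
rewrite c0 => E1 E2; apply: fstate_eq.
rewrite [LHS]surjective_pairing [RHS]surjective_pairing -E1; congr pair.
by apply/funext => e; rewrite -E2 add0r ce.
Qed.

Lemma nxt_antipode (s t : fstate) e : (sval s).1 = (sval t).1 ->
  (sval s).2 e = (sval t).2 e -> (sval s).2 (opp e) = (sval t).2 (opp e).
Proof.
move=> E0 E; have [ch c0 ce] := fchartP s; have [ch' c0' ce'] := fchartP t.
have r0 : (nrm (0 : Zd) < r)%N by rewrite nrm0; lia.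
have [A I _] := chart_nbr ch r0; have [_ _ S] := chart_nbr ch' r0.
have [] := S (fchart s (0 + dv (opp e))); first by rewrite c0' -E0 -c0.
move=> k; rewrite !add0r => kE; rewrite -!ce -!ce' kE.
have : antipodal (fchart t 0) (fchart t (dv e)) (fchart t (dv k)).
  by rewrite -kE c0' ce' -E0 -E -c0 -ce; apply: chart_antipodal.
move/(antipodal_chart ch') => -> //; apply/eqP => ek.
have := I e (opp e); rewrite /= !add0r kE ce E -ce' ek => /(_ erefl) ee.
by have := opp_neq k; rewrite -ee eqxx.
Qed.

Lemma nxt_square f g s : f != g -> f != opp g ->
  fchart (nxt g s) (dv f + dv (opp g)) = fchart (nxt f s) (dv g + dv (opp g)).
Proof.
move=> fg fog; have [ch c0 ce] := fchartP s.
have [ch1 c01 ce1] := fchartP (nxt f s); have [ch2 c02 ce2] := fchartP (nxt g s).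
have r0 : (nrm (0 : Zd) < r)%N by rewrite nrm0; lia.
have r1 (e : dir) : (nrm (dv e : Zd) < r)%N by rewrite nrm_dv.
have [A0 I0 _] := chart_nbr ch r0; have [A2 I2 _] := chart_nbr ch2 r0.
have [Ag Ig _] := chart_nbr ch (r1 g); have [Af If _] := chart_nbr ch (r1 f).
have [A2f I2f _] := chart_nbr ch2 (r1 f).
have A2og := chart_sqr ch2 r0 (_ : (nrm (0 + dv f : Zd) < r)%N).
have back : dv g + dv (opp g) = 0 :> Zd by rewrite dv_opp subrr.
rewrite back; apply: (local_sq_uniq (v := fchart (nxt g s) 0)
  (a := fchart (nxt g s) (dv f)) (b := fchart (nxt g s) (dv (opp g)))).
- by have := A2 f; rewrite add0r.
- by have := A2 (opp g); rewrite add0r.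
- by have := I2 f (opp g); rewrite /= !add0r => H /H E; rewrite E eqxx in fog.
- exact: A2f.
- by have := A2og _ (opp g); rewrite !add0r; apply.
- rewrite ce2 c01 adj_sym /=.
  by have := chart_sqr ch r0 (_ : (nrm (0 + dv g : Zd) < r)%N) f; rewrite !add0r; apply.
- by rewrite ce2 c01 /= back; have := A0 f; rewrite add0r.
- have := I2f (opp g) (opp f); rewrite /= [dv (opp f)]dv_opp subrr => H /H E.
  by move: fg; rewrite -(oppK f) -E oppK eqxx.
- rewrite c01 c02 /=; have := I0 f g; rewrite /= !add0r => H /H E.
  by rewrite E eqxx in fg.
Qed.

Lemma nxtC f g s : nxt g (nxt f s) = nxt f (nxt g s).
Proof.
have [->//|fg] := eqVneq f g.
have [->|fog] := eqVneq f (opp g); first by rewrite nxtK -{1}(oppK g) nxtK.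
have [ch c0 ce] := fchartP s.
suff [E1 E2] : (sval (nxt g (nxt f s))).1 = (sval (nxt f (nxt g s))).1 /\
    forall e, (sval (nxt g (nxt f s))).2 e = (sval (nxt f (nxt g s))).2 e.
  apply: fstate_eq; rewrite [LHS]surjective_pairing [RHS]surjective_pairing E1.
  by congr pair; apply/funext.
case: r3 => [r3'|d2].
  have n2 (a b : dir) : (nrm (dv a + dv b : Zd) < r)%N.
    by apply: leq_trans r3'; rewrite ltnS nrm_inner // nrm_dv.
  have r1 (e : dir) : (nrm (dv e : Zd) < r)%N by rewrite nrm_dv.
  have H (a b : dir) := @nxtE b (nxt a s) (fchart s) (dv a) erefl (fun=> erefl)
    (chart_nbr ch (n2 a b)) (chart_sqr ch (r1 a) (n2 a b)).
  have [<- Efg] := H f g; have [<- Egf] := H g f.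
  by split=> [|e]; rewrite 1?addrC // -Efg -Egf [dv g + _]addrC.
have gf : g != f by rewrite eq_sym.
have gof : g != opp f by apply: contra fog => /eqP->; rewrite oppK.
have [ch1 c01 ce1] := fchartP (nxt f s); have [ch2 c02 ce2] := fchartP (nxt g s).
have E0 : (sval (nxt g (nxt f s))).1 = (sval (nxt f (nxt g s))).1.
  by rewrite /= ce1 ce2 /= addrC.
have Eog : (sval (nxt g (nxt f s))).2 (opp g) = (sval (nxt f (nxt g s))).2 (opp g).
  by rewrite /= nxt_square.
have Eof : (sval (nxt g (nxt f s))).2 (opp f) = (sval (nxt f (nxt g s))).2 (opp f).
  by rewrite /= -nxt_square.
split=> // e.
have : [|| e == f, e == opp f, e == g | e == opp g].
  clear - d2 fg fog; move: fg fog.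
  case: f g e => [i a] [j b] [k c]; rewrite /opp !xpair_eqE /= -!val_eqE /=.
  have lt2 (l : 'I_d) : (val l < 2)%N by have := ltn_ord l; rewrite [X in (_ < X)%N -> _]d2.
  move: (lt2 i) (lt2 j) (lt2 k) => /=.
  by case: (nat_of_ord i) (nat_of_ord j) (nat_of_ord k) a b c => [|[]] // [|[]] // [|[]] // [] [] [].
case/or4P => /eqP-> //.
- by have := nxt_antipode E0 Eof; rewrite oppK.
- by have := nxt_antipode E0 Eog; rewrite oppK.
Qed.

Definition iterz i (z : int) (s : fstate) : fstate :=
  match z with
  | Posz n => iter n (nxt (i, false)) s
  | Negz n => iter n.+1 (nxt (i, true)) s
  end.

Lemma iterzS i b z s : iterz i (z + (-1) ^+ (b : bool)) s = nxt (i, b) (iterz i z s).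
Proof.
case: b z => -[[|n]|n]; rewrite ?expr1 ?expr0.
- by [].
- by rewrite (_ : n.+1%:Z + -1 = n) ?iterS ?(nxtK (i, false)) //=; lia.
- by rewrite (_ : Negz n + -1 = Negz n.+1) //; lia.
- by [].
- by rewrite (_ : n.+1%:Z + 1 = n.+2) //; lia.
- case: n => [|n]; first by rewrite /= (nxtK (i, true)).
  by rewrite (_ : Negz n.+1 + 1 = Negz n) /= ?(nxtK (i, true)) //; lia.
Qed.

Lemma iterzC e i z s : nxt e (iterz i z s) = iterz i z (nxt e s).
Proof.
by case: z => n /=; elim: n => [|n IH] //=; rewrite nxtC ?IH //; congr nxt;
  rewrite -IH.
Qed.

Definition act (js : seq 'I_d) (x : Zd) (s : fstate) :=
  foldr (fun i => iterz i (x 0 i)) s js.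

Lemma act_step js x i b s : uniq js ->
  act js (x + dv (i, b)) s = if i \in js then nxt (i, b) (act js x s) else act js x s.
Proof.
elim: js => [|j js IH] //= /andP[j_js /IH ->]; rewrite inE [(x + _) 0 j]mxE dvE /=.
have [->|ij] := eqVneq i j; first by rewrite /= (negbTE j_js) mulr1 iterzS.
rewrite mulr0 addr0 /=.
by case: (i \in js) => //; rewrite iterzC.
Qed.

(* [p] is onto a component, but need not be injective. *)
Definition cover (p : Zd -> G) := forall x, exists phi : Zd -> G,
  [/\ chart r phi, phi 0 = p x & forall e, phi (dv e) = p (x + dv e)].

Lemma cover_exists (phi : Zd -> G) : chart r phi -> exists p,
  [/\ cover p, p 0 = phi 0 & forall e, p (dv e) = phi (dv e)].
Proof.
move=> ch; have fr : frame (phi 0, fun e => phi (dv e)) by exists phi.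
pose s0 : fstate := exist _ _ fr; pose A x := act (enum 'I_d) x s0.
have A0 : A 0 = s0.
  by rewrite /A /act; elim: (enum _) => //= i js ->; rewrite mxE.
have AS x e : A (x + dv e) = nxt e (A x).
  by case: e => i b; rewrite /A act_step ?enum_uniq // mem_enum.
have [_ c0 ce] := fchartP s0.
exists (fun x => (sval (A x)).1); rewrite A0; split=> // [x|e].
  have [chx cx cex] := fchartP (A x); exists (fchart (A x)); split=> // e.
  by rewrite AS.
by rewrite -[dv e]add0r AS A0 /= add0r ce.
Qed.

End Frames.

Section Covers.
Local Open Scope ring_scope.
Variables (d r : nat) (G : sgraph).
Local Notation Zd := 'rV[int]_d.
Local Notation dir := ('I_d * bool)%type.
Hypothesis r2 : (2 <= r)%N.
Hypothesis sqG : sq_uniq G.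
Implicit Types p : Zd -> G.

Lemma cover_nbr p x : cover r p -> nbr p x.
Proof.
move=> /(_ x)[phi [ch p0 pe]].
have r0 : (nrm (0 : Zd) < r)%N by rewrite nrm0; lia.
have [A I S] := chart_nbr ch r0; split=> [e|e f|b].
- by have := A e; rewrite p0 add0r pe.
- by rewrite -!pe => E; apply: I; rewrite !add0r.
- by rewrite -p0 => /S[e ->]; exists e; rewrite add0r pe.
Qed.

Lemma cover_sqr p x f e : cover r p -> adj G (p (x + dv e)) (p (x + dv f + dv e)).
Proof. by move=> /(@cover_nbr _ (x + dv e))[A _ _]; rewrite addrAC. Qed.

Lemma nbr_agree p p' x x' : (forall z, nbr p z) -> (forall z, nbr p' z) ->
  agree p x p' x' -> forall y, agree p (x + y) p' (x' + y).
Proof.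
move=> np np' ag; elim/nrm_indS => [|y e _ IH]; first by rewrite !addr0.
rewrite !addrA; apply: agree_step => //.
  by move=> f; have [A _ _] := np (x + y + dv f); rewrite [x + y + dv e + _]addrAC.
by move=> f; have [A _ _] := np' (x' + y + dv f); rewrite [x' + y + dv e + _]addrAC.
Qed.

Lemma cover_uniq p p' x x' y : cover r p -> cover r p' -> agree p x p' x' ->
  p (x + y) = p' (x' + y).
Proof.
move=> cp cp' ag; have [|z|] := nbr_agree (p := p) (p' := p') _ _ ag y => //.
  by move=> z; apply: cover_nbr.
exact: cover_nbr.
Qed.

Lemma cover_ball p phi x y : cover r p -> chart r phi -> agree phi 0 p x ->
  (nrm y <= r)%N -> p (x + y) = phi y.
Proof.
move=> cp ch ag; have H z : (nrm z < r)%N -> agree phi z p (x + z).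
  elim/nrm_indS: z => [|z e -> IH] zr; first by rewrite addr0.
  have zr' : (nrm z < r)%N by lia.
  rewrite addrA; apply: agree_step (IH zr') => //.
  - exact: chart_nbr ch _.
  - by apply: chart_nbr ch _; apply: leq_ltn_trans zr; apply: nrm_dvD.
  - exact: cover_nbr.
  - by apply: chart_sqr ch _ _ => //; apply: leq_ltn_trans zr; apply: nrm_dvD.
  - by move=> f; apply: cover_sqr.
case yk : (nrm y) => [|k] yr.
  by case: ag => a0 _; rewrite (nrm_eq0 yk) addr0.
have [e ek] := nrm_dec yk; have [|_ E] := H (y - dv e); first by rewrite ek.
by have := E e; rewrite -(addrA x) !subrK.
Qed.

Lemma cover_inj p x y : cover r p -> p x = p y -> (nrm (y - x) <= r.*2.+1)%N -> x = y.
Proof.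
move=> cp pxy le; have [|z [zr wr]] := @nrm_split _ (y - x) r r.+1.
  by rewrite addnS addnn.
set w := y - x in le wr; have [phi [ch p0 pe]] := cp (x + z).
have ag : agree phi 0 p (x + z) by split=> // e; rewrite add0r.
have [inj hom sur] := ch; have zr' : (nrm (- z) <= r)%N by rewrite nrmN.
have E : p (x + z + (w - z)) = p (x + z + (- z)).
  by rewrite addrK addrACA subrr addr0 /w addrC subrK.
suff /eqP : w - z = - z by rewrite -subr_eq0 opprK subrK subr_eq0 => /eqP.
case: (leqP (nrm (w - z)) r) => [wr'|wr'].
  by apply: inj => //; rewrite -!(cover_ball cp ch ag).
have {}wr : nrm (w - z) = r.+1 by apply/eqP; rewrite eqn_leq wr.
have [e [t [ek wE]]] : exists e t, nrm t = r /\ w - z = t + dv e.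
  by have [e ek] := nrm_dec wr; exists e, (w - z - dv e); rewrite subrK.
have tr : (nrm t <= r)%N by rewrite ek.
have [A I _] := cover_nbr (x + z + t) cp.
have /latP[f zf] : lattice_adj t (- z).
  rewrite -hom // -!(cover_ball cp ch ag) // -E wE addrA; exact: A.
rewrite wE zf; congr (_ + dv _); apply: I.
by rewrite -[_ + dv f]addrA -[_ + dv e]addrA -zf -wE E.
Qed.

Lemma cover_shift p y : cover r p -> cover r (fun z => p (y + z)).
Proof.
move=> cp x; have [phi [ch p0 pe]] := cp (y + x).
by exists phi; split=> // e; rewrite addrA.
Qed.

Lemma cover_amx p s : signed s -> cover r p -> cover r (fun z => p (z *m amx s)).
Proof.
move=> ss cp x; have [phi [ch p0 pe]] := cp (x *m amx s).
exists (fun z => phi (z *m amx s)); split; first exact: chart_amx.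
  by rewrite mul0mx.
by move=> e; rewrite dv_amx // pe mulmxDl dv_amx.
Qed.

Lemma cover_antipodal p x e : cover r p ->
  antipodal (p x) (p (x + dv e)) (p (x + dv (opp e))).
Proof.
move=> /(_ x)[phi [ch p0 pe]]; rewrite -p0 -!pe.
exact: (@chart_antipodal _ _ _ r2 phi e ch).
Qed.

Lemma antipodal_cover p x e f : cover r p -> e != f ->
  antipodal (p x) (p (x + dv e)) (p (x + dv f)) -> f = opp e.
Proof.
move=> /(_ x)[phi [ch p0 pe]] ef; rewrite -p0 -!pe.
exact: (antipodal_chart r2 ch ef).
Qed.

Lemma cover_rel p p' x y : cover r p -> cover r p' -> p x = p' y ->
  exists s : {perm dir}, signed s /\ forall z, p' (y + z *m amx s) = p (x + z).
Proof.
move=> cp cp' E; have [A I S] := cover_nbr x cp; have [A' I' S'] := cover_nbr y cp'.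
have /choice[s0 s0E] e : exists e', p (x + dv e) = p' (y + dv e').
  by apply: S'; rewrite -E.
have s_inj : injective s0 by move=> a b ab; apply: I; rewrite /= !s0E ab.
exists (perm s_inj); have ss : signed (perm s_inj).
  move=> e; rewrite !permE; apply: (antipodal_cover (p := p') (x := y)) => //.
    by apply/eqP => /s_inj ee; have := opp_neq e; rewrite -ee eqxx.
  by rewrite -!s0E -E; apply: cover_antipodal.
split=> // z; symmetry.
have := @cover_uniq p (fun z => p' (y + z *m amx (perm s_inj))) x 0 z.
rewrite add0r; apply=> //; first exact: cover_amx ss (cover_shift y cp').
split=> [|e]; first by rewrite mul0mx addr0.
by rewrite add0r dv_amx // permE s0E.
Qed.

End Covers.

Section Torsion.
Local Open Scope ring_scope.
Variable d : nat.
Local Notation Zd := 'rV[int]_d.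
Local Notation dir := ('I_d * bool)%type.

(* [#[s]] times the projection onto the vectors fixed by [amx s]. *)
Definition Nmx (s : {perm dir}) : 'M[int]_d := \sum_(i < #[s]%g) amx (s ^+ i)%g.

Lemma Nmx_amx s : signed s -> amx s *m Nmx s = Nmx s.
Proof.
move=> ss; have E i : amx s *m amx (s ^+ i)%g = amx (s ^+ i.+1)%g.
  by rewrite expgS amxM //; apply: signedX.
rewrite /Nmx mulmx_sumr; under eq_bigr do rewrite E.
have := order_gt0 s; have := expg_order s; case: #[s]%g => // q sq _.
by rewrite big_ord_recr big_ord_recl /= sq expg0 addrC.
Qed.

Lemma Nmx_sqr s : signed s -> Nmx s *m Nmx s = (#[s]%g)%:R *: Nmx s.
Proof.
move=> ss; have E i : amx (s ^+ i)%g *m Nmx s = Nmx s.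
  elim: i => [|i IH]; first by rewrite expg0 amx1 mul1mx.
  by rewrite expgSr amxM // ?Nmx_amx // -?mulmxA ?Nmx_amx //; apply: signedX.
rewrite {1}/Nmx mulmx_suml; under eq_bigr do rewrite E.
by rewrite sumr_const card_ord scaler_nat.
Qed.

Lemma scalez_inj m n (a : int) (A B : 'M[int]_(m, n)) : a != 0 -> a *: A = a *: B -> A = B.
Proof.
move=> a0 /matrixP E; apply/matrixP => i j; have := E i j.
by rewrite !mxE => /(mulfI a0).
Qed.

Lemma Nmx_scalar s : signed s -> Nmx s = (#[s]%g)%:R%:M -> s = 1%g.
Proof.
move=> ss E; have := Nmx_amx ss; rewrite E mul_mx_scalar -scalemx1.
have q0 : (#[s]%g)%:R != 0 :> int by rewrite pnatr_eq0 -lt0n order_gt0.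
by move/(scalez_inj q0) => A1; apply: amx_inj; rewrite ?amx1 //; apply: signed1.
Qed.

Lemma nrmZ (q : nat) (x : Zd) : nrm (q%:Z *: x) = (q * nrm x)%N.
Proof. by rewrite /nrm big_distrr; apply: eq_bigr => i _; rewrite mxE abszM. Qed.

Lemma round_int (q : nat) (c : int) : (0 < q)%N ->
  (2 * absz (q%:Z * ((2 * c + q%:Z) %/ (2 * q%:Z))%Z - c)%R <= q)%N.
Proof.
move=> q0; have q0' : (0 < 2 * q%:Z)%R by lia.
have := divz_eq (2 * c + q%:Z) (2 * q%:Z).
have := modz_ge0 (2 * c + q%:Z) (lt0r_neq0 q0').
have := ltz_pmod (2 * c + q%:Z) q0'.
set a := modz _ _; set b := divz _ _ => h1 h2 E.
have : 2 * (q%:Z * b - c) = q%:Z - a by rewrite -[a](addKr (b * (2 * q%:Z))) -E; ring.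
by move: h1 h2; move: (q%:Z * b - c) => t; lia.
Qed.

Lemma round_row (q : nat) (u : Zd) : (0 < q)%N ->
  exists y : Zd, (2 * nrm (q%:Z *: y - u)%R <= d * q)%N.
Proof.
move=> q0; exists (\row_i ((2 * u ord0 i + q%:Z) %/ (2 * q%:Z))%Z).
have -> : (d * q = \sum_(i < d) q)%N by rewrite sum_nat_const card_ord.
rewrite /nrm big_distrr /=; apply: leq_sum => i _; rewrite !mxE.
exact: round_int.
Qed.

(* When [Nmx s = 0], the map [z |-> z *m amx s + v] has the rational fixed point [u / q]; the
   integer point [y] nearest to it is moved by at most [d <= 2r+1], hence is fixed, since [p] is
   injective at that scale. *)
Lemma cover_torsion_free (r : nat) (G : sgraph) (p : Zd -> G) (s : {perm dir}) v :
  (2 <= r)%N -> sq_uniq G -> (d <= r.*2.+1)%N -> cover r p -> signed s ->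
  (forall z, p (z *m amx s + v) = p z) -> Nmx s = 0 -> s = 1%g.
Proof.
move=> r2 sq dr cp ss deck N0; set q := #[s]%g; have q0 : (0 < q)%N by apply: order_gt0.
pose w i := \sum_(j < i) v *m amx (s ^+ j)%g.
have wS i : w i.+1 = w i *m amx s + v.
  rewrite /w big_ord_recl expg0 amx1 mulmx1 addrC mulmx_suml; congr (_ + _).
  by apply: eq_bigr => j _; rewrite -mulmxA -amxM ?expgSr //; apply: signedX.
pose u := \sum_(i < q) w i.
have uE : u *m amx s + q%:Z *: v = u.
  have : \sum_(i < q) w i.+1 = u *m amx s + q%:Z *: v.
    under eq_bigr do rewrite wS.
    rewrite big_split /= -mulmx_suml sumr_const card_ord.
    by rewrite -scaler_nat natz.
  move=> <-; have : w q = 0 by rewrite /w -mulmx_sumr -/(Nmx s) N0 mulmx0.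
  rewrite /u; case: (q) => [|n] wn; first by rewrite !big_ord0.
  by rewrite big_ord_recr /= wn addr0 big_ord_recl {2}/w big_ord0 add0r.
have [y yle] := round_row u q0; set eps := _ - u in yle.
have gy : y = y *m amx s + v.
  apply: (cover_inj r2 sq cp); first by rewrite deck.
  apply: leq_trans dr; rewrite -(leq_pmul2l q0) -nrmZ (_ : _ *: _ = eps *m amx s - eps).
    rewrite (leq_trans (nrmD _ _)) // nrmN mulnC (leq_trans _ yle) //.
    by rewrite mul2n -addnn leq_add2r nrm_amx.
  have qy : q%:Z *: y = u + eps by rewrite addrC subrK.
  rewrite scalerBr scalerDr scalemxAl qy.
  by rewrite mulmxDl [_ *m _ + _ *m _ + _]addrAC uE opprD addrACA subrr add0r.
apply/permP => e; rewrite perm1; have [_ I _] := cover_nbr r2 y cp.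
apply: I; rewrite /= -(deck (y + dv e)) mulmxDl dv_amx // addrAC -gy //.
Qed.

End Torsion.

(** * Quotients by translations *)

Section Good.
Local Open Scope ring_scope.
Variables (d R : nat).
Local Notation Zd := 'rV[int]_d.

(* A covering whose fibres are the cosets of a translation group with no short vector. *)
Definition tcover (G : sgraph) (p : Zd -> G) : Prop :=
  [/\ forall x, nbr p x,
      forall x y z, p x = p y -> p (x + z) = p (y + z) &
      forall l, p l = p 0 -> (nrm l <= R.*2.+1)%N -> l = 0].

Definition good_at (G : sgraph) (v : G) := exists p : Zd -> G, p 0 = v /\ tcover p.

Section Quot.
Variables (G : sgraph) (p : Zd -> G).
Hypothesis tp : tcover p.

Lemma tcover_sub x y : p x = p y <-> p (x - y) = p 0.
Proof.
case: tp => _ T _; split=> [/(T _ _ (- y))|/(T _ _ y)]; first by rewrite subrr.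
by rewrite subrK add0r.
Qed.

Lemma tcover_chart rho : (rho <= R)%N -> chart rho p.
Proof.
move=> rhoR; have [N T S] := tp.
have sub2 x y : (nrm x <= rho)%N -> (nrm y <= rho)%N -> (nrm (x - y) <= R.*2)%N.
  move=> xr yr; rewrite (leq_trans (nrmD _ _)) // nrmN -addnn.
  by apply: leq_add; apply: leq_trans rhoR.
split=> [x y xr yr /tcover_sub/S E|x y xr yr|x b _].
- by apply/eqP; rewrite -subr_eq0; apply/eqP/E; apply: leqW; apply: sub2.
- have [A I Sx] := N x; apply/idP/latP => [/Sx[e]|[e ->]]; last exact: A.
  move=> /tcover_sub /S E; exists e; apply/eqP; rewrite -subr_eq0; apply/eqP/E.
  rewrite opprD addrA -dv_opp; rewrite (leq_trans (nrm_dvD _ _)) // ltnS.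
  exact: sub2.
- by have [_ _ Sx] := N x; apply: Sx.
Qed.

Definition trans_auts : set (lattice d -> lattice d) :=
  [set g | exists l : Zd, p l = p 0 /\ forall x : Zd, g x = x + l]%classic.

Lemma tcover_subgroup l m : p l = p 0 -> p m = p 0 -> p (l + m) = p 0.
Proof. by case: tp => _ T _ /(T _ _ m) -> <-; rewrite add0r. Qed.

Lemma tcover_opp l : p l = p 0 -> p (- l) = p 0.
Proof. by case: tp => _ T _ /(T _ _ (- l)); rewrite subrr add0r. Qed.

Lemma trans_iso g : trans_auts g -> is_iso g.
Proof.
case=> l [_ gE]; split; first by exists (fun x : Zd => x - l) => x; rewrite gE ?addrK ?subrK.
move=> x y; apply/latP/latP => -[e E]; exists e.
  by apply: (addIr l); rewrite -gE E gE addrAC.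
by rewrite !gE E addrAC.
Qed.

Lemma trans_id : trans_auts id.
Proof. by exists 0; split=> // x; rewrite addr0. Qed.

Lemma trans_comp g h : trans_auts g -> trans_auts h -> trans_auts (g \o h).
Proof.
move=> [l [pl gE]] [m [pm hE]]; exists (m + l); split; first exact: tcover_subgroup.
by move=> x; rewrite /= gE hE addrA.
Qed.

Lemma trans_inv g : trans_auts g ->
  exists h, [/\ trans_auts h, cancel g h & cancel h g].
Proof.
move=> [l [pl gE]]; exists (fun x : Zd => x - l); split.
- by exists (- l); split=> //; apply: tcover_opp.
- by move=> x; rewrite gE addrK.
- by move=> x; rewrite gE subrK.
Qed.

Definition trans_group : autgroup (lattice d) :=
  AutGroup trans_iso trans_id trans_comp trans_inv.

Lemma trans_group_pure : pure_translation trans_group.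
Proof. by move=> g [l [_ gE]]; exists l. Qed.

Hypothesis surj : forall a, exists x, p x = a.

Lemma trans_vorbit (x y : Zd) : vorbit trans_group x = vorbit trans_group y <-> p x = p y.
Proof.
split=> [E|/tcover_sub xy].
  have : vorbit trans_group y x by rewrite -E; exists id => //; apply: trans_id.
  case=> g [l [pl gE]] <-; rewrite gE; apply/tcover_sub.
  by rewrite addrC addrA addNr add0r.
have g : trans_auts (fun z : Zd => z + (x - y)) by exists (x - y).
by rewrite -(@vorbit_aut (lattice d) trans_group _ y g) addrC subrK.
Qed.

Lemma trans_eorbit g e : trans_auts g ->
  eorbit trans_group (g @` e)%classic = eorbit trans_group e.
Proof.
move=> Gg; apply/seteqP; split => _ [h Gh <-].
  by exists (h \o g); [exact: trans_comp|rewrite image_comp].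
have [k [Gk gk _]] := trans_inv Gg.
exists (h \o k); first exact: trans_comp.
rewrite -image_comp; congr (_ @` _)%classic; rewrite image_comp -[RHS]image_id.
by apply: eq_imagel => x _ /=; rewrite gk.
Qed.

Lemma trans_image g (e : set Zd) : trans_auts g -> (p @` (g @` e) = p @` e)%classic.
Proof.
move=> [l [pl gE]]; rewrite image_comp; apply: eq_imagel => x _ /=.
by rewrite gE; apply/tcover_sub; rewrite addrC addrA addNr add0r.
Qed.

Lemma edges_dv (e : set (lattice d)) : edges (lattice d) e ->
  exists (x : Zd) f, e = [set x; x + dv f]%classic.
Proof. by case=> x [y [/latP[f ->] ->]]; exists x, f. Qed.

Lemma edges_orient (x z : Zd) f : [set x; x + dv f]%classic z ->
  exists g, [set x; x + dv f]%classic = [set z; z + dv g]%classic.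
Proof.
case=> ->; first by exists f.
by exists (opp f); rewrite dv_opp addrK setUC.
Qed.

Lemma trans_edge e e' : edges (lattice d) e -> edges (lattice d) e' ->
  (p @` e = p @` e')%classic -> eorbit trans_group e = eorbit trans_group e'.
Proof.
have [N T _] := tp; move=> /edges_dv[x [f ->]] /edges_dv[y [g ->]] E.
have [z zm pz] : (p @` [set y; y + dv g])%classic (p x) by rewrite -E; exists x => //; left.
have [h hE] := edges_orient zm; rewrite hE in E *.
have [w [->|->] pw] : (p @` [set z; z + dv h])%classic (p (x + dv f)).
- by rewrite -E; exists (x + dv f) => //; right.
- have [A _ _] := N x; have := A f; rewrite -pw pz adj_irr //.
- have fh : f = h.
    by have [_ I _] := N x; apply: I => /=; rewrite -pw; apply: T.
  have gt : trans_auts (fun u : Zd => u + (z - x)).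
    by exists (z - x); split=> //; exact: (proj1 (tcover_sub z x)) pz.
  rewrite -(trans_eorbit _ gt) fh; congr eorbit.
  by rewrite image_setU !image_set1 addrC subrK addrAC [x + _]addrC subrK.
Qed.

Lemma tcover_quotient :
  misomorphic (to_multigraph G) (Defs.quotient trans_group).
Proof.
have [N T _] := tp; have /choice[pre preK] := surj.
have vP z : vorbit trans_group z \in (range (vorbit trans_group))%classic by apply/mem_set; exists z.
pose f a : qvert trans_group := exist _ (vorbit trans_group (pre a)) (vP _).
have lift (eps : set_type (edges G)) : exists O : qedge trans_group,
    exists e, [/\ edges (lattice d) e, sval eps = (p @` e)%classic &
      sval O = eorbit trans_group e].
  case: eps => eps epsP; have [a [b [ab epsE]]] := set_mem epsP.
  have [x xa] := surj a; rewrite -xa in ab epsE.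
  have [_ _ S] := N x; have [h bE] := S b ab; rewrite bE in epsE.
  have ed : edges (lattice d) [set x; x + dv h]%classic.
    by exists x, (x + dv h); split=> //; apply: lattice_adj_dv.
  have OP : eorbit trans_group [set x; x + dv h]%classic
      \in (eorbit trans_group @` (edges (lattice d)))%classic.
    by apply/mem_set; exists [set x; x + dv h]%classic.
  exists (exist (fun O => O \in (eorbit trans_group @` edges (lattice d))%classic) _ OP),
    [set x; x + dv h]%classic; split=> //.
  by rewrite /= epsE image_setU !image_set1.
have /choice[g gE] := lift.
have idO (e : set (lattice d)) : eorbit trans_group e e.
  by exists id; [exact: trans_id|rewrite image_id].
exists f, g; split.
- apply: inj_surj_bij => [a b /(congr1 sval)/trans_vorbit|]; first by rewrite !preK.
  move=> [C OP]; have [x _ xO] := set_mem OP; exists (p x); apply: val_inj => /=.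
  by rewrite -xO; apply/trans_vorbit; rewrite preK.
- apply: inj_surj_bij.
    move=> a b ab; have [e [_ aE OE]] := gE a; have [e' [_ bE OE']] := gE b.
    have : eorbit trans_group e e' by rewrite -OE ab OE'; apply: idO.
    case=> h hG he; apply: val_inj => /=; rewrite aE bE -he.
    by rewrite trans_image.
  move=> [C OP]; have [e ed eO] := set_mem OP.
  have epsP : (p @` e)%classic \in edges G.
    apply/mem_set; have [x [h eE]] := edges_dv ed.
    exists (p x), (p (x + dv h)); split; first by have [A _ _] := N x; apply: A.
    by rewrite eE image_setU !image_set1.
  exists (exist (fun e => e \in edges G) _ epsP); apply: val_inj => /=; rewrite -eO.
  have [e' [ed' /= pe ->]] := gE (exist (fun e => e \in edges G) _ epsP).
  by apply: trans_edge.
- move=> eps a; have [e0 [ed epsE OE]] := gE eps; rewrite /= /smends /qends /= OE epsE.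
  split=> [[x xe xa]|[e [x [[h hG <-] [y ye <-] vE]]]].
    exists e0, x; split=> //; apply/trans_vorbit; by rewrite preK.
  exists y => //; move: vE; rewrite vorbit_aut // => /trans_vorbit.
  by rewrite preK.
Qed.

End Quot.

Lemma tcover_shift (G : sgraph) (p : Zd -> G) y : tcover p -> tcover (fun x => p (y + x)).
Proof.
move=> [N T S]; split=> [x|x x' z|l].
- have [A I Sx] := N (y + x); split=> [e|e f|b /Sx[e ->]]; rewrite ?addrA //.
    exact: I.
  by exists e; rewrite addrA.
- by rewrite !addrA; apply: T.
- move=> /(T _ _ (- y)); rewrite addr0 subrr addrAC subrr add0r.
  exact: S.
Qed.

Lemma tcover_locally (G : sgraph) rho : (rho <= R)%N -> (forall v : G, good_at v) ->
  locally_lattice d rho G.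
Proof. by move=> le good v; have [p [<- tp]] := good v; apply: chart_link; apply: tcover_chart. Qed.

Lemma good_component n (G : lgraph n) (v : 'I_n) :
  good_at (G := graph_of G) v -> good_vertex d R G v.
Proof.
move=> [p [p0 tp]]; have [N T S] := tp.
have vx x : p x \in [set w | connect (ladj G) v w]%classic.
  rewrite inE /=; elim/nrm_indS: x => [|x e _ IH]; first by rewrite p0.
  by apply: connect_trans IH (connect1 _); have [A _ _] := N x; apply: A.
pose pc x : component G v := exist _ (p x) (vx x).
have surj a : exists x, pc x = a.
  case: a => a am; have := am; rewrite inE /= => /connectP[q pq aE].
  have [|y [_ yE]] := nbr_walk (x := 0) (k := size q) (b := a) N.
    by exists q; rewrite p0 aE.
  by exists y; apply: val_inj.
have tpc : tcover pc.
  split=> [x|x y z /(congr1 sval) E|l /(congr1 sval)]; last exact: S.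
    have [A I Sx] := N x; split=> [e|e f /(congr1 sval)|b /Sx[e bE]]; first exact: A.
      exact: I.
    by exists e; apply: val_inj.
  by apply: val_inj; apply: T.
split; last first.
  by exists (trans_group tpc); split; [exact: trans_group_pure|exact: tcover_quotient].
apply: tcover_locally => // a; have [x <-] := surj a.
by exists (fun z => pc (x + z)); rewrite addr0; split=> //; apply: tcover_shift.
Qed.

End Good.

(** * Counting sublattices *)

Section Counting.

Definition count_le (T : Type) (P : T -> Prop) (b : nat) := exists f : T -> nat,
  (forall t, P t -> f t < b) /\ (forall t t', P t -> P t' -> f t = f t' -> t = t').

Lemma count_leW (T : Type) (P Q : T -> Prop) a b : a <= b -> (forall t, Q t -> P t) ->
  count_le P a -> count_le Q b.
Proof.
move=> ab QP [f [fa finj]]; exists f; split=> [t /QP/fa/leq_trans->//|t t' /QP Pt /QP].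
exact: finj.
Qed.

Lemma count_le_inj (T U : Type) (g : T -> U) (P : T -> Prop) (Q : U -> Prop) b :
  (forall t, P t -> Q (g t)) -> (forall t t', P t -> P t' -> g t = g t' -> t = t') ->
  count_le Q b -> count_le P b.
Proof.
move=> PQ ginj [f [fb finj]]; exists (f \o g); split=> [t /PQ/fb//|t t' Pt Pt' /finj E].
by apply: ginj => //; apply: E; apply: PQ.
Qed.

Lemma count_le_fin (I : finType) : count_le (fun _ : I => True) #|I|.
Proof.
exists (fun i => nat_of_ord (enum_rank i)); split=> [i _|i j _ _ /val_inj/enum_rank_inj//].
exact: ltn_ord.
Qed.

Lemma count_le_fib (T U : Type) (g : T -> U) (P : T -> Prop) (Q : U -> Prop) a b :
  (forall t, P t -> Q (g t)) -> count_le Q a ->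
  (forall u, Q u -> count_le (fun t => P t /\ g t = u) b) -> count_le P (a * b).
Proof.
move=> PQ [fU [fUa fUinj]] F.
have /choice[f fE] (u : U) : exists f : T -> nat, Q u ->
    (forall t, P t /\ g t = u -> f t < b) /\
    (forall t t', P t /\ g t = u -> P t' /\ g t' = u -> f t = f t' -> t = t').
  have [Qu|nQ] := pselect (Q u); last by exists (fun=> 0).
  by have [f fP] := F u Qu; exists f.
have fb t : P t -> f (g t) t < b.
  by move=> Pt; have [+ _] := fE _ (PQ _ Pt); apply.
exists (fun t => fU (g t) * b + f (g t) t); split=> [t Pt|t t' Pt Pt' E].
  have := fUa _ (PQ _ Pt); have := fb _ Pt; nia.
have b0 : 0 < b by apply: leq_ltn_trans (fb _ Pt).
have gE : g t = g t'.
  apply: fUinj; try exact: PQ.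
  have := congr1 (divn^~ b) E; rewrite !divnMDl // !divn_small ?fb //.
  by rewrite !addn0.
have [_ inj] := fE _ (PQ _ Pt); apply: inj => //.
by move: E; rewrite -gE; apply: addnI.
Qed.

Lemma count_le_pair (T U : Type) (P : T -> Prop) (Q : U -> Prop) a b :
  count_le P a -> count_le Q b -> count_le (fun x => P x.1 /\ Q x.2) (a * b).
Proof.
move=> cP cQ; apply: (@count_le_fib _ _ fst _ P) => // [t [] //|u Pu].
apply: (@count_le_inj _ _ snd _ Q) => // [t [[]]//|[t1 t2] [u1 u2] /=].
by move=> [_ ->] [_ ->] ->.
Qed.

Lemma count_le_seq (T : eqType) (P : T -> Prop) b n : count_le P b ->
  count_le (fun s : seq T => size s = n /\ forall x, x \in s -> P x) (b ^ n).
Proof.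
move=> cP; elim: n => [|n IH].
  exists (fun=> 0); split=> // s t [/size0nil-> _] [/size0nil-> _] //.
have [[x0 Px0]|nP] := pselect (exists x, P x); last first.
  have F s : ~ (size s = n.+1 /\ forall x, x \in s -> P x).
    by case: s => [|x s] [// _ H]; case: nP; exists x; apply: H; apply: mem_head.
  by exists (fun=> 0); split=> [s /F|s t /F].
rewrite expnS.
apply: (@count_le_inj _ _ (fun s => (head x0 s, behead s)) _ _ _ _ _ (count_le_pair cP IH)).
  move=> [|x s] [] //= [ss] sP; split; first by apply: sP; apply: mem_head.
  by split=> // y ys; apply: sP; rewrite inE ys orbT.
by move=> [|x s] [|y t] [] // sn _ [] // tn _ [-> ->].
Qed.

Lemma count_le_pow2 (e : seq nat) :
  count_le (fun s : seq nat => all (leq 1) s /\ map (trunc_log 2) s = e)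
    (\prod_(i <- e) 2 ^ i).
Proof.
elim: e => [|i e IH].
  by exists (fun=> 0); rewrite big_nil; split=> // -[|? ?] [|? ?] [] // _ ? [].
rewrite big_cons.
have c1 : count_le (fun x => 0 < x /\ trunc_log 2 x = i) (2 ^ i).
  exists (fun x => x - 2 ^ i); split=> [x [x0 <-]|x y [x0 xi] [y0 yi]].
    by have /andP[] := trunc_log_bounds (erefl : 1 < 2) x0; rewrite expnS; lia.
  have /andP[+ _] := trunc_log_bounds (erefl : 1 < 2) x0.
  have /andP[+ _] := trunc_log_bounds (erefl : 1 < 2) y0.
  by rewrite xi yi; lia.
apply: (@count_le_inj _ _ (fun s => (head 0 s, behead s)) _ _ _ _ _ (count_le_pair c1 IH)).
  by move=> [|x s] [] //= /andP[x0 sp] [<- <-].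
by move=> [|x s] [|y t] [] // _ _ [] // _ _ [-> ->].
Qed.

Lemma count_le_prod n X :
  count_le (fun s : seq nat => [/\ size s = n, all (leq 1) s & \prod_(i <- s) i <= X])
    (X * (trunc_log 2 X).+1 ^ n).
Proof.
rewrite mulnC; set l := trunc_log 2 X.
have cl : count_le (fun i => i < l.+1) l.+1 by exists id.
apply: (@count_le_fib _ _ (map (trunc_log 2)) _ (fun e => [/\ size e = n,
   forall x, x \in e -> x < l.+1 & \prod_(i <- e) 2 ^ i <= X])).
- move=> s [sn sp sX]; rewrite size_map; split=> // [x|].
    move=> /mapP[y ys ->]; rewrite ltnS; apply: leq_trunc_log; apply: leq_trans sX.
    move: sp ys; elim: (s) => //= z t IH /andP[z0 t0]; rewrite inE big_cons.
    have t1 : 0 < \prod_(i <- t) i.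
      by rewrite big_seq; apply: prodn_cond_gt0 => i it; apply: (allP t0).
    by case/orP => [/eqP->|/(IH t0)]; [exact: leq_pmulr|move=> H; rewrite (leq_trans H) // leq_pmull].
  apply: leq_trans sX; rewrite big_map !big_seq; apply: leq_prod => i /(allP sp) i0.
  by have /andP[] := trunc_log_bounds (erefl : 1 < 2) i0.
- apply: count_leW (count_le_seq n cl) => // e [en eP _]; split=> //.
- move=> e [_ _ eX]; apply: count_leW eX _ (count_le_pow2 e) => s [[_ sp _] <-] //.
Qed.

End Counting.

Section Hermite.
Local Open Scope ring_scope.

Definition subgrp k (L : set 'rV[int]_k) := L 0 /\ forall x y, L x -> L y -> L (x - y).

Definition cofinite k (L : set 'rV[int]_k) :=
  exists c : nat, (0 < c)%N /\ forall x, L (c%:Z *: x).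

Definition box k (a : seq nat) (y : 'rV[int]_k) :=
  forall i : 'I_k, 0 <= y 0 i < (nth 0%N a i)%:Z.

Lemma subgrpN k (L : set 'rV[int]_k) x : subgrp L -> L x -> L (- x).
Proof. by move=> [L0 LB] Lx; rewrite -sub0r; apply: LB. Qed.

Lemma subgrpD k (L : set 'rV[int]_k) x y : subgrp L -> L x -> L y -> L (x + y).
Proof. by move=> sL Lx Ly; rewrite -[y]opprK; case: (sL) => _; apply=> //; apply: subgrpN. Qed.

Lemma subgrpZ k (L : set 'rV[int]_k) (z : int) x : subgrp L -> L x -> L (z *: x).
Proof.
move=> sL Lx; have H (n : nat) : L (n%:Z *: x).
  elim: n => [|n IH]; first by rewrite scale0r; case: sL.
  by rewrite -[n.+1]addn1 PoszD scalerDl scale1r; apply: subgrpD.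
by case: z => // n; rewrite NegzE scaleNr; apply: subgrpN.
Qed.

(* [L] has a Hermite normal form with diagonal [a]; [y0] is the rest of the first row. *)
Fixpoint hnf k : seq nat -> set 'rV[int]_k -> Prop :=
  match k return seq nat -> set 'rV[int]_k -> Prop with
  | 0%N => fun a L => a = [::] /\ forall x, L x
  | k'.+1 => fun a L => exists a0 a' (L0 : set 'rV[int]_k') y0,
      [/\ a = a0 :: a', (0 < a0)%N, hnf a' L0 /\ subgrp L0, box a' y0 &
       L = [set x : 'rV[int]_(1 + k') | exists z : int,
              lsubmx x = (z * a0%:Z)%:M /\ L0 (rsubmx x - z *: y0)]%classic]
  end.

Lemma hnf_size k a (L : set 'rV[int]_k) : hnf a L -> size a = k /\ all (leq 1) a.
Proof.
elim: k a L => [|k IH] a L; first by case=> ->.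
by case=> a0 [a' [L0 [y0 [-> a00 [/IH[sa pa] _] _ _]]]]; rewrite /= sa a00.
Qed.

Lemma box_row_mx k a0 a (z : int) (y : 'rV[int]_k) :
  box (a0 :: a) (row_mx z%:M y : 'rV_(1 + k)) <-> 0 <= z < a0%:Z /\ box a y.
Proof.
split=> [H|[zP yP] i].
  split=> [|i].
    by have := H (lshift k 0); rewrite row_mxEl mxE.
  by have := H (rshift 1 i); rewrite row_mxEr.
case: (split_ordP i) => j ->; rewrite ?row_mxEl ?row_mxEr; last exact: yP.
by rewrite ord1 mxE.
Qed.

Definition rhead k (x : 'rV[int]_(1 + k)) : int := x 0 (lshift k 0).

Lemma row1E k (x : 'rV[int]_(1 + k)) : x = row_mx (rhead x)%:M (rsubmx x).
Proof.
rewrite -[LHS]hsubmxK; congr row_mx; apply/matrixP => i j.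
by rewrite !ord1 !mxE.
Qed.

Lemma row1_sub k (a b : 'M[int]_1) (x y : 'rV[int]_k) :
  row_mx a x - row_mx b y = row_mx (a - b) (x - y).
Proof. by rewrite opp_row_mx add_row_mx. Qed.

Lemma row1_add k (a b : 'M[int]_1) (x y : 'rV[int]_k) :
  row_mx a x + row_mx b y = row_mx (a + b) (x + y).
Proof. by rewrite add_row_mx. Qed.

Lemma row1_scale k (z : int) (a : 'M[int]_1) (x : 'rV[int]_k) :
  z *: row_mx a x = row_mx (z *: a) (z *: x).
Proof. by rewrite scale_row_mx. Qed.

Lemma row1B k (x y : 'rV[int]_(1 + k)) :
  x - y = row_mx (rhead x - rhead y)%:M (rsubmx x - rsubmx y).
Proof. by rewrite {1}(row1E x) {1}(row1E y) opp_row_mx add_row_mx -raddfB. Qed.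

Lemma scalar1_inj (z t : int) : z%:M = t%:M :> 'M[int]_1 -> z = t.
Proof. by move/matrixP/(_ 0 0); rewrite !mxE. Qed.

Lemma box_diff_eq (z t : int) (a : nat) w : 0 <= z < a%:Z -> 0 <= t < a%:Z ->
  z - t = w * a%:Z -> w = 0.
Proof. by move=> ? ? ?; apply/eqP; case: (ltrgt0P w) => // ?; nia. Qed.

Lemma hnf_rep k a (L : set 'rV[int]_k) : hnf a L -> forall x, exists y, box a y /\ L (x - y).
Proof.
elim: k a L => [|k IH] a L.
  by move=> [-> H] x; exists 0; split=> // -[].
case=> a0 [a' [L0 [y0 [-> a00 [/IH rep _] _ ->]]]] x.
set x0 := @rhead k x.
have [y' [yb yL]] := rep (rsubmx (x : 'rV_(1 + k)) - (x0 %/ a0%:Z)%Z *: y0).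
exists (row_mx (x0 %% a0%:Z)%Z%:M y'); split.
  by apply/box_row_mx; split=> //; rewrite modz_ge0 ?ltz_pmod //; lia.
have xE : (x : 'rV_(1 + k)) - row_mx (x0 %% a0%:Z)%Z%:M y' =
    row_mx ((x0 %/ a0%:Z)%Z * a0%:Z)%:M (rsubmx (x : 'rV_(1 + k)) - y').
  rewrite {1}(@row1E k x) opp_row_mx add_row_mx -raddfB /= -/x0.
  by rewrite {1}(divz_eq x0 a0%:Z) addrK.
by exists (x0 %/ a0%:Z)%Z; rewrite xE row_mxKl row_mxKr addrAC.
Qed.

Lemma hnf_box k a (L : set 'rV[int]_k) : hnf a L -> forall y y',
  box a y -> box a y' -> L (y - y') -> y = y'.
Proof.
elim: k a L => [|k IH] a L; first by move=> _ y y' _ _ _; apply/rowP => -[].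
case=> a0 [a' [L0 [y0 [-> a00 [/IH inj _] _ ->]]]] y y'.
rewrite {1}(@row1E k y) {1}(@row1E k y') => /box_row_mx[z1 b1] /box_row_mx[z2 b2].
case=> w; rewrite (@row1B k y y') row_mxKl row_mxKr => -[].
move=> /scalar1_inj E; have w0 := box_diff_eq z1 z2 E.
rewrite w0 scale0r subr0 => /(inj _ _ b1 b2) Er.
move: E; rewrite w0 mul0r => /eqP; rewrite subr_eq0 => /eqP Eh.
by rewrite (@row1E k y) (@row1E k y') Er Eh.
Qed.

Lemma row1_mul_block k (z a : int) (n y0 : 'rV[int]_k) (B : 'M[int]_k) :
  row_mx z%:M n *m block_mx a%:M y0 0 B = row_mx (z * a)%:M (z *: y0 + n *m B).
Proof.
by rewrite mul_row_block mulmx0 addr0 !mul_scalar_mx scale_scalar_mx.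
Qed.

Lemma hnf_basis k a (L : set 'rV[int]_k) : hnf a L ->
  exists B : 'M[int]_k, forall x, L x <-> exists y, x = y *m B.
Proof.
elim: k a L => [|k IH] a L.
  by move=> [_ H]; exists 0 => x; split=> // _; exists 0; apply/rowP => -[].
case=> a0 [a' [L0 [y0 [_ a00 [/IH[B BE] _] _ ->]]]].
exists (block_mx a0%:Z%:M y0 0 B : 'M[int]_(1 + k)) => x; split.
  case=> z [lx /BE[n nE]]; exists (row_mx z%:M n : 'rV_(1 + k)).
  by rewrite (@row1_mul_block k) -nE -lx addrC subrK hsubmxK.
case=> y ->; exists (@rhead k y).
rewrite {1 3}(@row1E k y) (@row1_mul_block k) row_mxKl row_mxKr; split=> //.
by apply/BE; exists (rsubmx (y : 'rV_(1 + k))); rewrite addrC addKr.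
Qed.

Lemma hnf_exists k (L : set 'rV[int]_k) : subgrp L -> cofinite L -> exists a, hnf a L.
Proof.
elim: k L => [|k IH] L sL [c [c0 cL]].
  by exists [::]; split=> // x; case: sL => + _; congr L; apply/rowP => -[].
have [L_0 LB] := sL.
pose L0 : set 'rV[int]_k := [set y | L (row_mx 0 y : 'rV_(1 + k))]%classic.
have sL0 : subgrp L0.
  split=> [|x y Lx Ly]; first by rewrite /L0 /= row_mx0.
  by have := LB _ _ Lx Ly; rewrite (@row1_sub k) subr0.
have [|a' hL0] := IH L0 sL0.
  exists c; split=> // x; have := cL (row_mx 0 x : 'rV_(1 + k)).
  by rewrite (@row1_scale k) scaler0.
pose P n := (0 < n)%N && `[< exists y, L (row_mx n%:Z%:M y : 'rV_(1 + k)) >].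
have exP : exists n, P n.
  exists c; rewrite /P c0; apply/asboolP; exists 0.
  have := cL (row_mx 1%:M 0 : 'rV_(1 + k)).
  by rewrite (@row1_scale k) scaler0 scale_scalar_mx mulr1.
have [a0 /andP[a00 /asboolP[y Ly]] amin] := ex_minnP exP.
have [y0 [yb yL0]] := hnf_rep hL0 y.
have Ly0 : L (row_mx a0%:Z%:M y0 : 'rV_(1 + k)).
  have := LB _ _ Ly yL0; rewrite (@row1_sub k) subr0.
  by rewrite opprB addrC subrK.
exists (a0 :: a'), a0, a', L0, y0; split=> //; apply/seteqP; split=> x.
  move=> Lx; set x0 := @rhead k x.
  have Lz : L (x - (x0 %/ a0%:Z)%Z *: (row_mx a0%:Z%:M y0 : 'rV_(1 + k))).
    by apply: LB => //; apply: subgrpZ.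
  move: Lz; rewrite {1}(@row1E k x) (@row1_scale k) (@row1_sub k) -/x0.
  rewrite scale_scalar_mx -raddfB /= {1}(divz_eq x0 a0%:Z) addrAC subrr add0r => Lz.
  have r0 : (x0 %% a0%:Z)%Z = 0.
    apply/eqP/negP => /negP rn0.
    have h1 : (x0 %% a0%:Z)%Z < a0%:Z by apply: ltz_pmod; lia.
    have h2 : 0 <= (x0 %% a0%:Z)%Z by apply: modz_ge0; lia.
    suff : (a0 <= absz (x0 %% a0%:Z)%Z)%N by lia.
    apply: amin.
    rewrite /P absz_gt0 rn0; apply/asboolP; rewrite gez0_abs //.
    by exists (rsubmx (x : 'rV_(1 + k)) - (x0 %/ a0%:Z)%Z *: y0).
  exists (x0 %/ a0%:Z)%Z; split.
    rewrite -[RHS]addr0 -(raddf0 (@scalar_mx int 1)) -r0 -raddfD /= -divz_eq.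
    by apply/matrixP => i j; rewrite !ord1 !mxE.
  by move: Lz; rewrite r0 raddf0.
case=> z [lx L0x]; rewrite -[x](@hsubmxK _ 1 1 k) lx.
have := subgrpD sL (subgrpZ z sL Ly0) L0x.
by rewrite (@row1_scale k) (@row1_add k) addr0 scale_scalar_mx [z *: y0 + _]addrC subrK.
Qed.

Fixpoint boxseq k : seq nat -> seq 'rV[int]_k :=
  match k return seq nat -> seq 'rV[int]_k with
  | 0%N => fun _ => [:: 0]
  | k'.+1 => fun a => [seq (row_mx (Posz r)%:M y : 'rV_(1 + k')) |
      r <- iota 0 (head 0%N a), y <- boxseq k' (behead a)]
  end.

Lemma boxseqP k a : size a = k -> [/\ uniq (boxseq k a),
  size (boxseq k a) = (\prod_(i <- a) i)%N & forall y, y \in boxseq k a -> box a y].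
Proof.
elim: k a => [|k IH] [|a0 a] //=; first by split=> //; [rewrite big_nil|move=> y _ []].
case=> /IH[ua sa ba]; split.
- apply: allpairs_uniq; rewrite ?iota_uniq // => -[r y] [r' y'] _ _ /= E.
  have /= := congr1 (@lsubmx _ 1 1 k) E; have /= := congr1 (@rsubmx _ 1 1 k) E.
  by rewrite !row_mxKl !row_mxKr => -> /scalar1_inj[->].
- by rewrite size_allpairs size_iota sa big_cons.
- move=> y /allpairsP[[r y'] /= [+ /ba y'b ->]]; rewrite mem_iota /= => ra.
  by apply/box_row_mx; split=> //; lia.
Qed.

Lemma count_box k a : size a = k ->
  count_le (fun y : 'rV[int]_k => box a y) (\prod_(i <- a) i)%N.
Proof.
elim: k a => [|k IH] [|a0 a] //=.
  by move=> _; exists (fun=> 0%N); rewrite big_nil; split=> // y y' *; apply/rowP => -[].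
case=> /IH cb; rewrite big_cons.
have c0 : count_le (fun z : int => 0 <= z < a0%:Z) a0.
  exists absz; split=> [z|z z']; lia.
apply: (@count_le_inj _ _ (fun y : 'rV_(1 + k) => (@rhead k y, rsubmx y)) _ _ _ _ _
  (count_le_pair c0 cb)).
  by move=> y; rewrite {1}(@row1E k y) => /box_row_mx.
by move=> y y' _ _ [E E']; rewrite (@row1E k y) (@row1E k y') E E'.
Qed.

Lemma count_hnf k a : size a = k -> all (leq 1) a ->
  count_le (fun L : set 'rV[int]_k => hnf a L) ((\prod_(i <- a) i) ^ k.-1)%N.
Proof.
elim: k a => [|k IH] a.
  move=> _ _; exists (fun=> 0%N); split=> [L _|L L' [_ H] [_ H'] _]; first by rewrite expn0.
  by apply/seteqP; split=> x.
case: a => [|a0 a] //= [sa] /andP[a00 pa].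
have a1 : (0 < \prod_(i <- a) i)%N.
  by rewrite big_seq; apply: prodn_cond_gt0 => i ia; apply: (allP pa).
have le : ((\prod_(i <- a) i) ^ k.-1 * (\prod_(i <- a) i) <=
    (\prod_(i <- a0 :: a) i) ^ k)%N.
  rewrite big_cons; case: k sa {IH} => [|k] sa.
    by case: a sa {pa a1} => //; rewrite big_nil.
  by rewrite -expnSr leq_exp2r // leq_pmull.
have c := count_le_pair (IH a sa pa) (count_box sa).
pose S (L : set 'rV[int]_k.+1) (q : set 'rV[int]_k * 'rV[int]_k) :=
  [/\ hnf a q.1, box a q.2 & L = [set x : 'rV[int]_(1 + k) | exists z : int,
              lsubmx x = (z * a0%:Z)%:M /\ q.1 (rsubmx x - z *: q.2)]%classic].
have /choice[g gE] (L : set 'rV[int]_k.+1) : exists q,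
    (exists q', S L q') -> S L q.
  have [[q Sq]|nS] := pselect (exists q', S L q'); first by exists q.
  by exists (setT, 0) => /nS.
have gS (L : set 'rV[int]_k.+1) : hnf (a0 :: a) L -> S L (g L).
  case=> b0 [b' [L0 [y0 [[<- <-] _ [h0 _] yb LE]]]]; apply: gE.
  by exists (L0, y0).
apply: (@count_leW _ _ _ _ _ le) (fun L => id) _.
apply: (@count_le_inj _ _ g _ _ _ _ _ c) => [L /gS[]//|L L'].
by move=> /gS[_ _ E] /gS[_ _ E'] gE'; rewrite E E' gE'.
Qed.

End Hermite.

Section Sublattices.
Local Open Scope ring_scope.

(* The index of [L] is at most [M]. *)
Definition index_le k (L : set 'rV[int]_k) (M : nat) := exists f : 'rV[int]_k -> nat,
  (forall x, (f x < M)%N) /\ forall x y, f x = f y -> L (x - y).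

Lemma pigeonhole_seq (T : eqType) (s : seq T) (f : T -> nat) M : uniq s ->
  (forall x, x \in s -> (f x < M)%N) -> {in s &, injective f} -> (size s <= M)%N.
Proof.
move=> us fM inj; rewrite -(size_map f) -(size_iota 0 M).
apply: uniq_leq_size; first by rewrite map_inj_in_uniq.
by move=> _ /mapP[x xs ->]; rewrite mem_iota /= fM.
Qed.

Lemma index_le_cofinite k (L : set 'rV[int]_k) M : subgrp L -> index_le L M -> cofinite L.
Proof.
move=> sL [f [fM fL]]; exists (M`!)%N; split=> [|x]; first exact: fact_gt0.
have [i [j [ij jM E]]] : exists i j : nat, [/\ (i < j)%N, (j <= M)%N &
    f (i%:Z *: x) = f (j%:Z *: x)].
  apply: contrapT => H.
  suff : (size (iota 0 M.+1) <= M)%N by rewrite size_iota ltnn.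
  apply: (@pigeonhole_seq _ _ (fun i : nat => f (i%:Z *: x))) => // [|i j].
    exact: iota_uniq.
  rewrite !mem_iota /= !ltnS => iM jM E; apply/eqP; case: (ltngtP i j) => // ij; case: H.
    by exists i, j.
  by exists j, i.
have /(subgrpN sL) := fL _ _ E; rewrite opprB -scalerBl => Lx.
have /dvdnP[c cE] : (j - i %| M`!)%N by apply: dvdn_fact; lia.
rewrite cE PoszM -scalerA -subzn ?(ltnW ij) //; exact: subgrpZ.
Qed.

Definition modrow k h (n : 'rV[int]_k) : {ffun 'I_k -> 'I_h.+1} :=
  [ffun i => inord (absz (n ord0 i %% h.+1%:Z)%Z)].

Lemma modrow_eq k h (n m : 'rV[int]_k) : modrow h n = modrow h m ->
  exists t, n = m + h.+1%:Z *: t.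
Proof.
move/ffunP => E; exists (\row_i ((n ord0 i %/ h.+1%:Z)%Z - (m ord0 i %/ h.+1%:Z)%Z)).
apply/rowP => i; rewrite !mxE; have := E i; rewrite !ffunE => /(congr1 val) /=.
have lt z : (absz (z %% h.+1%:Z)%Z < h.+1)%N by have := ltz_pmod z (erefl : 0 < h.+1%:Z);
  have := modz_ge0 z (erefl : h.+1%:Z != 0); lia.
rewrite !inordK // => E'.
have {}E' : (n ord0 i %% h.+1%:Z)%Z = (m ord0 i %% h.+1%:Z)%Z.
  have := modz_ge0 (n 0 i) (erefl : h.+1%:Z != 0).
  by have := modz_ge0 (m 0 i) (erefl : h.+1%:Z != 0); lia.
have := divz_eq (n ord0 i) h.+1%:Z; have := divz_eq (m ord0 i) h.+1%:Z; rewrite E'.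
by move: (divz _ _) (divz _ _) (modz _ _) => a b c -> ->; ring.
Qed.

Lemma lattice_basis k (L : set 'rV[int]_k) : subgrp L -> cofinite L ->
  exists B : 'M[int]_k, forall x, L x <-> exists y, x = y *m B.
Proof. by move=> sL /(hnf_exists sL)[a /hnf_basis]. Qed.

Lemma index_le_scale k (L : set 'rV[int]_k) M h : subgrp L -> index_le L M ->
  index_le [set h.+1%:Z *: l | l in L]%classic (M * h.+1 ^ k).
Proof.
move=> sL iL; have [B LB] := lattice_basis sL (index_le_cofinite sL iL).
have [f [fM fL]] := iL.
have /choice[rep repE] (c : nat) : exists x0, (exists x, f x = c) -> f x0 = c.
  have [[x xc]|nx] := pselect (exists x, f x = c); first by exists x.
  by exists 0 => /nx.
have /choice[crd crdE] x : exists n, x - rep (f x) = n *m B.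
  by apply/LB; apply: fL; rewrite repE //; exists x.
exists (fun x => f x * h.+1 ^ k + enum_rank (modrow h (crd x)))%N.
have rlt x : (enum_rank (modrow h (crd x)) < h.+1 ^ k)%N.
  by apply: leq_trans (ltn_ord _) _; rewrite card_ffun !card_ord.
split=> [x|x y E]; first by have := fM x; have := rlt x; nia.
have h0 : (0 < h.+1 ^ k)%N by rewrite expn_gt0.
have fE : f x = f y.
  by have := congr1 (divn^~ (h.+1 ^ k)%N) E; rewrite !divnMDl // !divn_small // !addn0.
move: E; rewrite fE => /addnI/val_inj/enum_rank_inj/modrow_eq[t tE].
exists (t *m B); first by apply/LB; exists t.
have xE z : z = crd z *m B + rep (f z) by rewrite -crdE subrK.
rewrite (xE x) (xE y) tE fE.
by rewrite mulmxDl scalemxAl opprD addrACA subrr addr0 addrAC subrr add0r.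
Qed.

Lemma smith_gens k (K : 'M[int]_k.+1) (v : 'rV[int]_k.+1) : v != 0 -> v *m K = 0 ->
  exists B : 'M[int]_(k, k.+1), (exists S : 'M[int]_(k, k.+1), B = S *m K) /\
    forall x : 'rV[int]_k.+1, exists y : 'rV[int]_k, x *m K = y *m B.
Proof.
move=> v0 vK; have [L uL [R uR [s _ vE]]] := int_Smith_normal_form v.
set D := \matrix_(_, _) _ in vE.
have DE : D = (D 0 0) *: delta_mx 0 0.
  apply/rowP => j; rewrite !mxE eqxx /=; case: (j =P 0) => [->|]; rewrite ?mulr1 ?mulr0 //.
  by move/eqP; rewrite -val_eqE /= eq_sym => /negbTE ->; rewrite mulr0n.
have D0 : D 0 0 != 0.
  by apply: contra_neq v0 => D0; rewrite vE DE D0 scale0r mulmx0 mul0mx.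
have RK0 : row 0 (R *m K) = 0.
  rewrite rowE; apply: (scalez_inj D0); rewrite scaler0 scalemxAl -DE.
  have -> : D *m (R *m K) = invmx L *m (v *m K) by rewrite vE -mulmxA -mulmxA mulKmx.
  by rewrite vK mulmx0.
exists (row' 0 (R *m K)); split.
  by exists (row' 0 R); apply/matrixP => i j; rewrite !mxE; apply: eq_bigr => l _; rewrite !mxE.
move=> x; set z := x *m invmx R; exists (col' 0 z).
have -> : x *m K = z *m (R *m K) by rewrite /z mulmxA mulmxKV.
rewrite !mulmx_sum_row big_ord_recl RK0 scaler0 add0r; apply: eq_bigr => i _.
by congr (_ *: _); [rewrite !mxE | apply/rowP => j; rewrite !mxE]; congr (_ _ _).
Qed.

Section Invariant.
Variables (k h : nat) (N : 'M[int]_k.+1).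
Let K : 'M[int]_k.+1 := h.+1%:Z%:M - N.
Hypothesis NN : N *m N = h.+1%:Z *: N.
Hypothesis N0 : N != 0.
Hypothesis K0 : K != 0.

Lemma idem_NK : N *m K = 0.
Proof. by rewrite mulmxBr mul_mx_scalar NN subrr. Qed.

Lemma idem_KN : K *m N = 0.
Proof. by rewrite mulmxBl mul_scalar_mx NN subrr. Qed.

Lemma idem_KK : K *m K = h.+1%:Z *: K.
Proof. by rewrite {1}/K mulmxBl mul_scalar_mx idem_NK subr0. Qed.

Lemma mx_row_neq0 (A : 'M[int]_k.+1) : A != 0 -> exists i, row i A != 0.
Proof.
move=> A0; apply/existsP; apply: contraR A0 => /existsPn H; apply/eqP/row_matrixP => i.
by rewrite row0; apply/eqP; have := H i; rewrite negbK.
Qed.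

Lemma idem_gens : exists B : 'M[int]_(k, k.+1), (exists S : 'M[int]_(k, k.+1), B = S *m N) /\
  forall x : 'rV[int]_k.+1, exists y : 'rV[int]_k, x *m N = y *m B.
Proof.
have [i ri] := mx_row_neq0 K0; apply: (smith_gens ri).
by rewrite -row_mul idem_KN row0.
Qed.

Definition pullback (A : 'M[int]_k.+1) (B : 'M[int]_(k, k.+1)) (L : set 'rV[int]_k.+1) :
    set 'rV[int]_k := [set y | exists2 l, L l & y *m B = l *m A]%classic.

Lemma pullback_subgrp A B L : subgrp L -> subgrp (pullback A B L).
Proof.
move=> [L0 LB]; split=> [|x y [l Ll lE] [m Lm mE]]; first by exists 0; rewrite ?mul0mx.
by exists (l - m); [exact: LB|rewrite !mulmxBl lE mE].
Qed.

Lemma pullback_cofinite A B S L : B = S *m A -> cofinite L -> cofinite (pullback A B L).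
Proof.
move=> BE [c [c0 cL]]; exists c; split=> // x; exists (c%:Z *: (x *m S)); first exact: cL.
by rewrite -!scalemxAl -mulmxA BE.
Qed.

Definition invariant (L : set 'rV[int]_k.+1) := forall x, L x -> L (x *m N).

End Invariant.

(* With [K := (h+1) - N], [L] lies between [L N + L K] and its quotient by [h+1]; so [L] is
   determined by [L N], [L K] and a set of residues mod [h+1]. The images of [N] and [K] have rank
   at most [k], which is where the exponent [k] rather than [k.+1] comes from. *)
Lemma count_invariant k h (N : 'M[int]_k.+1) M : (0 < k)%N ->
  N *m N = h.+1%:Z *: N -> N != 0 -> N != h.+1%:Z%:M ->
  count_le (fun L => [/\ subgrp L, index_le L M & invariant N L])
    (2 ^ (h.+1 ^ k.+1) * ((M * h.+1 ^ k.+1) ^ k *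
       (trunc_log 2 (M * h.+1 ^ k.+1)).+1 ^ (k + k)))%N.
Proof.
move=> k0 NN N0 Nh; set X := (M * _)%N; set K := h.+1%:Z%:M - N.
have K0 : K != 0 by rewrite subr_eq0 eq_sym.
have [BN [[SN BNE] genN]] := idem_gens NN K0.
have KK : K *m K = h.+1%:Z *: K := idem_KK NN.
have [BK [[SK BKE] genK]] : exists B : 'M[int]_(k, k.+1), (exists S : 'M[int]_(k, k.+1), B = S *m K) /\
    forall x : 'rV[int]_k.+1, exists y : 'rV[int]_k, x *m K = y *m B.
  by apply: idem_gens KK _; rewrite /K opprB addrC subrK.
have NK := idem_NK NN; have KN := idem_KN NN; rewrite -/K in NK KN.
have BNN : BN *m N = h.+1%:Z *: BN by rewrite BNE -mulmxA NN scalemxAr.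
have BNK : BN *m K = 0 by rewrite BNE -mulmxA NK mulmx0.
have BKK : BK *m K = h.+1%:Z *: BK by rewrite BKE -mulmxA KK scalemxAr.
have BKN : BK *m N = 0 by rewrite BKE -mulmxA KN mulmx0.
have h0 : h.+1%:Z != 0 by [].
pose P L := [/\ subgrp L, index_le L M & @invariant k N L].
have invK L x : P L -> L x -> L (x *m K).
  move=> [sL _ iL] Lx; rewrite mulmxBr mul_mx_scalar.
  by case: (sL) => _; apply; [exact: subgrpZ|exact: iL].
pose g L := (pullback N BN L, pullback K BK L).
pose Q (u : set 'rV[int]_k * set 'rV[int]_k) := exists a b,
  [/\ hnf a u.1, hnf b u.2 & (\prod_(i <- a ++ b) i <= X)%N].
rewrite mulnC; apply: (@count_le_fib _ _ g P Q).
- move=> L PL; have [sL iL LN] := PL; have cL := index_le_cofinite sL iL.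
  have [a ha] := hnf_exists (pullback_subgrp N BN sL) (pullback_cofinite BNE cL).
  have [b hb] := hnf_exists (pullback_subgrp K BK sL) (pullback_cofinite BKE cL).
  exists a, b; split=> //; have [f [fM fL]] := index_le_scale h sL iL.
  have [[sa pa] [sb pb]] := (hnf_size ha, hnf_size hb).
  have [ua za ba] := boxseqP sa; have [ub zb bb] := boxseqP sb.
  rewrite big_cat /= -za -zb -(size_allpairs pair).
  apply: (@pigeonhole_seq _ _ (fun u => f (u.1 *m BN + u.2 *m BK))) => //.
    by apply: allpairs_uniq => // -[? ?] [? ?].
  move=> _ _ /allpairsP[[y z] /= [ya zb' ->]] /allpairsP[[y' z'] /= [ya' zb'' ->]].
  move=> /fL[l Ll]; set w := _ - _ => lw.
  have wE : w = (y - y') *m BN + (z - z') *m BK.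
    by rewrite /w !mulmxBl opprD addrACA.
  congr pair.
    apply: (hnf_box ha); [exact: ba|exact: ba|]; exists l => //.
    apply: (scalez_inj h0); rewrite [RHS]scalemxAl lw wE mulmxDl -!mulmxA BNN BKN mulmx0 addr0.
    by rewrite scalemxAr.
  apply: (hnf_box hb); [exact: bb|exact: bb|]; exists l => //.
  apply: (scalez_inj h0); rewrite [RHS]scalemxAl lw wE mulmxDl -!mulmxA BNK BKK mulmx0 add0r.
  by rewrite scalemxAr.
- pose S (s : seq nat) := [/\ size s = (k + k)%N, all (leq 1) s & (\prod_(i <- s) i <= X)%N].
  have /choice[ab abE] u : exists s, Q u -> S s /\ hnf (take k s) u.1 /\ hnf (drop k s) u.2.
    have [[a [b [ha hb abX]]]|nQ] := pselect (Q u); last by exists [::].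
    have [[sa pa] [sb pb]] := (hnf_size ha, hnf_size hb).
    exists (a ++ b) => _; split; first by split; rewrite ?size_cat ?sa ?sb ?all_cat ?pa.
    by rewrite take_size_cat // drop_size_cat.
  have -> : (X ^ k * (trunc_log 2 X).+1 ^ (k + k) =
      X * (trunc_log 2 X).+1 ^ (k + k) * X ^ k.-1)%N.
    by rewrite -{1}(prednK k0) expnS mulnAC.
  apply: (@count_le_fib _ _ ab Q S) => [u /abE[]//||s [ss sp sX]].
    exact: count_le_prod.
  have c := count_le_pair (@count_hnf k (take k s) _ _) (@count_hnf k (drop k s) _ _).
  apply: (count_leW _ _ (c _ _ _ _)).
  + by rewrite -expnMn -big_cat cat_take_drop; case: (k.-1) => [|k1]; rewrite ?expn0 // leq_exp2r.
  + by move=> u [/abE[_ +] <-].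
  + by rewrite size_takel // ss leq_addr.
  + by apply/allP => i /mem_take; apply: (allP sp).
  + by rewrite size_drop ss addnK.
  + by apply/allP => i /mem_drop; apply: (allP sp).
- move=> u _; pose L' : set 'rV[int]_k.+1 :=
    [set x | exists y z, [/\ u.1 y, u.2 z & x = y *m BN + z *m BK]]%classic.
  pose B' := xget (0 : 'M[int]_k.+1) [set B | forall x, L' x <-> exists y, x = y *m B]%classic.
  pose code (L : set 'rV[int]_k.+1) := [set c : {ffun 'I_k.+1 -> 'I_h.+1} |
     `[< exists n, modrow h n = c /\ exists2 l, L l & n *m B' = h.+1%:Z *: l >]]%SET.
  have L'in L x : P L -> g L = u -> L' x -> L x.
    move=> PL gu [y [z [+ + ->]]]; rewrite -gu => -[l Ll ->] [m Lm ->].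
    by case: (PL) => sL _ iL; apply: subgrpD => //; [exact: iL|exact: invK].
  have inL' L x : P L -> g L = u -> L x -> L' (h.+1%:Z *: x).
    move=> PL gu Lx; have [y yE] := genN x; have [z zE] := genK x.
    exists y, z; rewrite -gu; split; [by exists x|by exists x|].
    by rewrite -yE -zE -mulmxDr addrC subrK mul_mx_scalar.
  have B'E L : P L -> g L = u -> forall x, L' x <-> exists y, x = y *m B'.
    move=> PL gu; have [sL iL _] := PL.
    apply: (@xgetPex _ (0 : 'M[int]_k.+1)
      [set B | forall x, L' x <-> exists y, x = y *m B]%classic).
    apply: lattice_basis.
      rewrite /L' -gu; split=> [|x y].
        by exists 0, 0; rewrite !mul0mx addr0; split=> //; apply: (proj1 (pullback_subgrp _ _ sL)).
      move=> [y1 [z1 [p1 q1 ->]]] [y2 [z2 [p2 q2 ->]]]; exists (y1 - y2), (z1 - z2).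
      split; [exact: (proj2 (pullback_subgrp _ _ sL))|exact: (proj2 (pullback_subgrp _ _ sL))|].
      by rewrite !mulmxBl opprD addrACA.
    have [c [c0 cL]] := index_le_cofinite sL iL.
    exists (h.+1 * c)%N; split=> [|x]; first by rewrite muln_gt0.
    by rewrite PoszM -scalerA; apply: inL' (cL x).
  have main L L2 x : P L -> g L = u -> P L2 -> g L2 = u -> code L = code L2 -> L x -> L2 x.
    move=> PL gu PL2 gu2 cE Lx; have [n nE] := (B'E L PL gu _).1 (inL' L x PL gu Lx).
    have : modrow h n \in code L2.
      by rewrite -cE inE; apply/asboolP; exists n; split=> //; exists x.
    rewrite inE => /asboolP[n2 [n2n [l2 Ll2 n2E]]].
    have [t tE] := modrow_eq (esym n2n).
    have -> : x = l2 + t *m B'.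
      apply: (scalez_inj h0); rewrite nE tE mulmxDl n2E scalerDr; congr (_ + _).
      by rewrite -scalemxAl.
    have [sL2 _ _] := PL2; apply: subgrpD => //; apply: L'in PL2 gu2 _.
    by apply/(B'E L PL gu); exists t.
  apply: (@count_le_inj _ {set {ffun 'I_k.+1 -> 'I_h.+1}} code _ (fun=> True)) => //.
    by move=> L L2 [PL gu] [PL2 gu2] cE; apply/seteqP; split=> x; apply: main.
  have := count_le_fin {set {ffun 'I_k.+1 -> 'I_h.+1}}.
  by rewrite -cardsT -powersetT card_powerset cardsT card_ffun !card_ord.
Qed.


End Sublattices.

Section SublatticeFamily.
Local Open Scope ring_scope.
Variables (k W : nat).
Hypothesis k0 : (0 < k)%N.
Local Notation d := k.+1.
Local Notation dir := ('I_d * bool)%type.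

Lemma count_le_or (T : Type) (P Q : T -> Prop) a b : count_le P a -> count_le Q b ->
  count_le (fun t => P t \/ Q t) (a + b)%N.
Proof.
move=> [f [fa fi]] [g [gb gi]].
exists (fun t => if `[< P t >] then f t else a + g t)%N; split=> [t PQ|t t' PQ PQ'].
  case: asboolP => [/fa|nP]; first by lia.
  by case: PQ => // /gb; lia.
case: asboolP PQ => [Pt _|nP [//|Qt]]; case: asboolP PQ' => [Pt' _|nP' [//|Qt']].
- exact: fi.
- by have := fa _ Pt; lia.
- by have := fa _ Pt'; lia.
- by move/addnI; apply: gi.
Qed.

Lemma count_le_family (I : finType) (T : Type) (P : I -> nat -> T -> Prop) (B : nat -> nat) :
  (forall i, exists C, forall m, count_le (P i m) (C * B m)) ->
  exists C, forall m, count_le (fun t => exists i, P i m t) (C * B m).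
Proof.
move=> H; suff [C CP] : exists C, forall m,
    count_le (fun t => exists2 i, i \in enum I & P i m t) (C * B m).
  exists C => m; apply: count_leW (CP m) => // t [i Pi].
  by exists i; rewrite ?mem_enum.
elim: (enum I) => [|i s [C IH]].
  by exists 0%N => m; exists (fun=> 0%N); split=> [t [] //|t t' [] //].
have [D DP] := H i; exists (D + C)%N => m; rewrite mulnDl.
apply: count_leW (count_le_or (DP m) (IH m)) => // t [j].
by rewrite inE => /orP[/eqP->|js] Pj; [left|right; exists j].
Qed.

(* [inl s] stands for a nontrivial element of the point group, and [inr (j, w)] for a short
   period, whose coordinates in [-W, W] are stored with an offset [W]. *)
Definition inv_index : Type := ({perm dir} + ('I_d * {ffun 'I_d -> 'I_(W.*2.+1)}))%type.
HB.instance Definition _ := Finite.on inv_index.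

Definition inv_row (w : {ffun 'I_d -> 'I_(W.*2.+1)}) : 'rV[int]_d :=
  \row_j ((w j)%:Z - W%:Z).

Definition inv_mx (i : inv_index) : 'M[int]_d :=
  match i with
  | inl s => Nmx s
  | inr (j, w) => delta_mx j 0 *m inv_row w
  end.

Definition growth (m : nat) : nat := (m ^ k * (trunc_log 2 m).+1 ^ (k + k))%N.

Lemma trunc_log_mul c m :
  ((trunc_log 2 (c * m)).+1 <= (trunc_log 2 c).+2 * (trunc_log 2 m).+1)%N.
Proof.
have [->|c0] := posnP c; first by rewrite mul0n trunc_log0 muln_gt0.
have [->|m0] := posnP m; first by rewrite muln0 trunc_log0 muln_gt0.
suff : (trunc_log 2 (c * m) < (trunc_log 2 c).+1 + (trunc_log 2 m).+1)%N by nia.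
rewrite -(ltn_exp2l _ _ (erefl : (1 < 2)%N)) expnD.
apply: leq_ltn_trans (trunc_logP (erefl : (1 < 2)%N) _) _; first by rewrite muln_gt0 c0.
by apply: ltn_mul; apply: trunc_log_ltn.
Qed.

Definition idem_mx (N : 'M[int]_d) := exists h, [/\ N *m N = h.+1%:Z *: N, N != 0 &
  N != h.+1%:Z%:M].

Lemma count_sublattices D : exists C, forall m,
  count_le (fun L : set 'rV[int]_d => exists i : inv_index,
    [/\ idem_mx (inv_mx i), subgrp L, index_le L (m * D) & invariant (inv_mx i) L])
  (C * growth m)%N.
Proof.
apply: count_le_family => i.
have [[h [NN N0 Nh]]|nid] := pselect (idem_mx (inv_mx i)); last first.
  by exists 0%N => m; exists (fun=> 0%N); split=> [L []|L L' []].
set c := (D * h.+1 ^ d)%N.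
exists (2 ^ (h.+1 ^ d) * (c ^ k * (trunc_log 2 c).+2 ^ (k + k)))%N => m.
have := @count_invariant k h (inv_mx i) (m * D) k0 NN N0 Nh.
rewrite -mulnA -/c; apply: count_leW => [|L []//].
rewrite -mulnA leq_mul2l; apply/orP; right; rewrite /growth mulnACA -!expnMn.
rewrite (mulnC m c) leq_mul2l leq_exp2r ?addn_gt0 ?k0 //.
by rewrite trunc_log_mul orbT.
Qed.

End SublatticeFamily.

(** * Graphs covered by the lattice as crystals *)

Section Crystal.
Local Open Scope ring_scope.
Variables (k r R : nat) (G : sgraph).
Local Notation d := k.+1.
Local Notation Zd := 'rV[int]_d.
Local Notation dir := ('I_d * bool)%type.
Hypothesis k0 : (0 < k)%N.
Hypothesis r2 : (2 <= r)%N.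
Hypothesis dr : (d <= r.*2.+1)%N.
Hypothesis sqG : sq_uniq G.

Definition deck (p : Zd -> G) (s : {perm dir}) (v : Zd) :=
  signed s /\ forall z, p (z *m amx s + v) = p z.

Definition periods (p : Zd -> G) : set Zd := [set l | forall x, p (x + l) = p x]%classic.

Section OneCover.
Variable p : Zd -> G.
Hypothesis cp : cover r p.

Lemma deck1 l : deck p 1%g l <-> periods p l.
Proof.
split=> [[_ H] x|H]; first by rewrite -[RHS]H amx1 mulmx1.
by split=> [|z]; [exact: signed1|rewrite amx1 mulmx1 H].
Qed.

Lemma periods_subgrp : subgrp (periods p).
Proof.
split=> [x|l m pl pm x]; first by rewrite addr0.
have pm' y : p (y - m) = p y by rewrite -[LHS]pm subrK.
by rewrite addrA pm' pl.
Qed.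

Lemma deck_mul s v t w : deck p s v -> deck p t w -> deck p (s * t)%g (v *m amx t + w).
Proof.
move=> [ss sv] [st tw]; split=> [|z]; first exact: signedM.
by rewrite amxM // mulmxA addrA -mulmxDl tw sv.
Qed.

Lemma deck_uniq s v w : deck p s v -> deck p s w -> periods p (v - w).
Proof.
move=> [ss sv] [_ sw] x; have [y yE] : exists y, x = y *m amx s + w.
  by exists ((x - w) *m amx s^-1); rewrite amxVK // subrK.
by rewrite yE -addrA [w + _]addrC subrK sv sw.
Qed.

Lemma deck_shift s v l : periods p l -> deck p s v -> deck p s (v + l).
Proof. by move=> pl [ss sv]; split=> // z; rewrite addrA pl. Qed.

Lemma cover_fiber x y : p x = p y <-> exists s v, deck p s v /\ y = x *m amx s + v.
Proof.
split=> [E|[s [v [[_ sv] ->]]]]; last by rewrite sv.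
have [s [ss sE]] := cover_rel r2 sqG cp cp E; exists s, (y - x *m amx s).
split; last by rewrite addrC subrK.
split=> // z; have := sE (z - x); rewrite mulmxBl addrCA [x + _]addrC subrK => <-.
by rewrite [_ + (y - _)]addrCA.
Qed.

Lemma periods_amx s v l : deck p s v -> periods p l -> periods p (l *m amx s).
Proof.
move=> [ss sv] pl x; have [y yE] : exists y, x = y *m amx s + v.
  by exists ((x - v) *m amx s^-1); rewrite amxVK // subrK.
by rewrite yE addrAC -mulmxDl !sv pl.
Qed.

Lemma periods_Nmx s v : deck p s v -> invariant (Nmx s) (periods p).
Proof.
move=> sv l pl; have H i : periods p (l *m amx (s ^+ i)%g).
  elim: i => [|i IH]; first by rewrite expg0 amx1 mulmx1.
  rewrite expgSr amxM ?mulmxA; [exact: periods_amx sv IH|exact: signedX sv.1|exact: sv.1].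
rewrite /Nmx mulmx_sumr; elim/big_ind: _ => [|a b|i _]; last exact: H.
  by case: periods_subgrp.
exact: subgrpD periods_subgrp.
Qed.

Lemma periods_index n (code : G -> nat) : (forall v, (code v < n)%N) -> injective code ->
  index_le (periods p) (n * #|{ffun dir -> dir}|).
Proof.
clear k0 dr; move=> cn ci; have /choice[rep repE] (v : G) : exists x0, (exists x, p x = v) -> p x0 = v.
  have [[x xc]|nx] := pselect (exists x, p x = v); first by exists x.
  by exists 0 => /nx.
have /choice[pi piE] x : exists f : {ffun dir -> dir}, forall e,
    p (x + dv e) = p (rep (p x) + dv (f e)).
  have [A _ _] := cover_nbr r2 x cp; have [_ _ S] := cover_nbr r2 (rep (p x)) cp.
  have /choice[f fE] e : exists e', p (x + dv e) = p (rep (p x) + dv e').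
    by apply: S; rewrite repE //; exists x.
  by exists (finfun f) => e; rewrite ffunE.
exists (fun x => code (p x) * #|{ffun dir -> dir}| + enum_rank (pi x))%N.
have lt x : (enum_rank (pi x) < #|{ffun dir -> dir}|)%N by apply: ltn_ord.
split=> [x|x y E]; first by have := cn (p x); have := lt x; nia.
have h0 : (0 < #|{ffun dir -> dir}|)%N by apply: leq_ltn_trans (lt 0).
have pE : p x = p y.
  apply: ci; have := congr1 (divn^~ #|{ffun dir -> dir}|) E.
  by rewrite !divnMDl // !divn_small // !addn0.
move: E; rewrite pE => /addnI/val_inj/enum_rank_inj E z.
have ag : agree p x p y by split=> // e; rewrite (piE x) (piE y) E pE.
have := cover_uniq r2 sqG (z - y) cp cp ag; rewrite [y + _]addrC subrK => <-.
by congr p; rewrite addrCA.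
Qed.

Lemma not_good_invariant : (forall a, ~ good_at d R (p a)) ->
  exists i : inv_index k R.*2.+1,
    idem_mx (inv_mx i) /\ invariant (inv_mx i) (periods p).
Proof.
move=> ng; have [[s [v [sv s1]]]|triv] := pselect (exists s v, deck p s v /\ s <> 1%g).
  exists (inl s); split; last exact: periods_Nmx sv.
  have q0 := order_gt0 s; exists (#[s]%g).-1; rewrite prednK // -natz; split.
  - exact: Nmx_sqr sv.1.
  - by apply/eqP => N0; apply: s1; apply: cover_torsion_free r2 sqG dr cp sv.1 sv.2 N0.
  - by apply/eqP => /(Nmx_scalar sv.1).
have triv' s v : deck p s v -> s = 1%g.
  by move=> sv; apply: contrapT => s1; apply: triv; exists s, v.
have T x y : p x = p y -> periods p (y - x).
  move=> /cover_fiber[s [v [sv ->]]]; have s1 := triv' _ _ sv; rewrite s1 in sv *.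
  by rewrite amx1 mulmx1 addrAC subrr add0r; apply/deck1.
have [l [pl lR l0]] : exists l, [/\ periods p l, (nrm l <= R.*2.+1)%N & l != 0].
  apply: contrapT => nl; apply: (ng 0); exists p; split=> //; split.
  - by move=> x; exact: (cover_nbr r2 x cp).
  - move=> x y z /T /(_ (x + z)) <-; by rewrite addrC addrA subrK.
  - move=> l /esym/T pl lR; apply: contrapT => /eqP l0; apply: nl; exists l; split=> //.
    by rewrite -[l]subr0.
have [j lj] : exists j, l 0 j != 0.
  apply/existsP; apply: contra_neqT l0 => /existsPn H; apply/rowP => j.
  by rewrite mxE; apply/eqP; have := H j; rewrite negbK.
have {l pl lR l0 lj} [l [pl lR lj]] :
    exists l : Zd, [/\ periods p l, (nrm l <= R.*2.+1)%N & 0 < l 0 j].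
  case: (ltrgt0P (l 0 j)) lj => // lj _; first by exists l.
  exists (- l); rewrite nrmN mxE oppr_gt0; split=> //.
  exact: subgrpN periods_subgrp pl.
have bnd i : (absz (l 0 i)%R <= R.*2.+1)%N.
  by apply: leq_trans lR; rewrite /nrm (bigD1 i) //= leq_addr.
pose w : {ffun 'I_d -> 'I_((R.*2.+1).*2.+1)} :=
  [ffun i => inord (absz (l 0 i + R.*2.+1%:Z)%R)].
have wl : inv_row w = l.
  apply/rowP => i; rewrite mxE ffunE inordK; first by have := bnd i; lia.
  by have := bnd i; rewrite -!addnn; lia.
exists (inr (j, w)); rewrite /= wl; have act x : x *m (delta_mx j 0 *m l) = x 0 j *: l.
  rewrite mulmxA (_ : x *m delta_mx j 0 = (x 0 j)%:M) ?mul_scalar_mx //.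
  by rewrite -colE; apply/matrixP => a b; rewrite !ord1 !mxE.
split; last by move=> x _; rewrite act; apply: subgrpZ periods_subgrp pl.
have [h hE] : exists h : nat, l 0 j = h.+1%:Z by exists (absz (l 0 j)).-1; lia.
exists h; rewrite -hE; split.
- by rewrite -mulmxA act scalemxAr.
- apply/eqP => N0; have := act (delta_mx 0 j); rewrite N0 mulmx0 mxE !eqxx scale1r => l0.
  by rewrite -l0 mxE ltxx in lj.
- apply/eqP => Nh; have [i ij] : exists i : 'I_d, i != j.
    exists (if j == ord0 then lift ord0 (Ordinal k0) else ord0).
    by case: (eqVneq j ord0) => [->|]; rewrite 1?eq_sym.
  have := act (delta_mx 0 i); rewrite Nh [(delta_mx _ _) _ j]mxE (eq_sym j) (negbTE ij) andbF scale0r.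
  move/rowP/(_ i); rewrite mul_mx_scalar !mxE !eqxx mulr1 => l0.
  by rewrite l0 ltxx in lj.
Qed.

End OneCover.

Definition point_group (p : Zd -> G) : {set {perm dir}} :=
  [set s | `[< exists v, deck p s v >]]%SET.

(* Averaging over the point group makes [v] a coboundary up to [periods]: [#|P| v_s] is congruent
   to [u - u A_s], and moving the origin reduces [u] modulo [#|P|]. *)
Lemma crystal_normal_form (p : Zd -> G) : cover r p -> exists p' u0 v, let P := point_group p' in
  [/\ cover r p', box (nseq d #|P|) u0, (0 < #|P|)%N,
      forall s, s \in P -> deck p' s (v s) &
      forall s, s \in P -> periods p' (#|P|%:Z *: v s - (u0 - u0 *m amx s))].
Proof.
clear k0 dr; move=> cp; set P := point_group p.
have PP s : reflect (exists v, deck p s v) (s \in P) by rewrite inE; apply: asboolP.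
have gP : group_set P.
  apply/group_setP; split=> [|s t /PP[v sv] /PP[w tw]].
    apply/PP; exists 0; apply/deck1; by case: (periods_subgrp p).
  by apply/PP; exists (v *m amx t + w); apply: deck_mul.
have P0 : (0 < #|P|)%N by rewrite (cardG_gt0 (Group gP)).
have /choice[v vE] (s : {perm dir}) : exists v, s \in P -> deck p s v.
  have [/PP[v sv]|nP] := boolP (s \in P); first by exists v.
  by exists 0.
pose q := #|P|; pose u := \sum_(s in P) v s.
have sp : subgrp (periods p) := periods_subgrp p.
have uE t : t \in P -> periods p (u - (u *m amx t + q%:Z *: v t)).
  move=> tP; have uE1 : u = \sum_(s in P) v (s * t)%g.
    rewrite /u (reindex_inj (mulIg t)); apply: eq_bigl => s.
    exact: (groupMr (G := Group gP) s tP).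
  have sumE : u *m amx t + q%:Z *: v t = \sum_(s in P) (v s *m amx t + v t).
    by rewrite big_split /= -mulmx_suml sumr_const -scaler_nat natz.
  rewrite {1}uE1 sumE -sumrB; elim/big_ind: _ => [|a b|s sP]; first by case: sp.
    exact: subgrpD sp.
  apply: (@deck_uniq p (s * t)%g); last exact: deck_mul (vE _ sP) (vE _ tP).
  by apply: vE; have := groupM (G := Group gP) sP tP.
pose w : Zd := \row_i (u ord0 i %/ q%:Z)%Z.
pose p' x := p (w + x).
have pp' : (fun x => p' (- w + x)) = p by apply/funext => x; rewrite /p' addrA subrr add0r.
have deck_tr (f : Zd -> G) y s t : deck f s t ->
    deck (fun x => f (y + x)) s (t + y *m amx s - y).
  move=> [ss st]; split=> // z; rewrite -[RHS]st mulmxDl; congr f.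
  move: (z *m _) (y *m _) => a b; by apply/rowP => i; rewrite !mxE; ring.
have per' l : periods p' l <-> periods p l.
  split=> H x; last by rewrite /p' addrA H.
  by have := H (x - w); rewrite /p' addrA [w + _]addrC subrK.
have PE : point_group p' = P.
  apply/setP => s; rewrite [LHS]inE; apply/asboolP/PP => -[t st]; last first.
    by exists (t + w *m amx s - w); apply: deck_tr.
  by exists (t + (- w) *m amx s - - w); rewrite -pp'; apply: deck_tr.
exists p', (u - q%:Z *: w), (fun s => v s + w *m amx s - w); rewrite PE; split=> //.
- exact: cover_shift.
- move=> i; rewrite nth_nseq ltn_ord !mxE {1 3}(divz_eq (u 0 i) q%:Z).
  by rewrite mulrC addrC addKr modz_ge0 ?ltz_pmod // -/q; lia.
- by move=> s sP; apply: deck_tr; apply: vE.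
- move=> s sP; apply/per'; have := subgrpN sp (uE s sP).
  congr (periods p _); rewrite -/q !scalerBr !scalerDr mulmxBl -!scalemxAl.
  move: (u *m _) (q%:Z *: v s) (q%:Z *: (w *m _)) (q%:Z *: w) => a b c e.
  by apply/rowP => i; rewrite !mxE; ring.
Qed.

End Crystal.

Section Isomorphism.

Lemma isomorphic_refl G : isomorphic G G.
Proof. by exists id; split=> //; exists id. Qed.

Lemma isomorphic_sym G H : isomorphic G H -> isomorphic H G.
Proof.
move=> [f [[g fK gK] hom]]; exists g; split; first by exists f.
by move=> x y; rewrite -hom !gK.
Qed.

Lemma isomorphic_trans H G K : isomorphic G H -> isomorphic H K -> isomorphic G K.
Proof.
move=> [f [fb fh]] [g [gb gh]]; exists (g \o f); split; first exact: bij_comp.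
by move=> x y; rewrite /= gh fh.
Qed.

(* Isomorphism classes of finite graphs are represented by the fixed points of
   [fun t => canon (gr t)]. *)
Definition gtype : Type := {m : nat & lgraph m}.
HB.instance Definition _ := Countable.on gtype.

Definition gr (t : gtype) : sgraph := graph_of (tagged t).

Section MakeGraph.
Variables (n : nat) (e : rel 'I_n).

Definition mk_edges : {set {set 'I_n}} :=
  [set A : {set 'I_n} | [exists x, exists y, [&& x != y, e x y & A == [set x; y]%SET]]]%SET.

Lemma mk_edges_card : [forall A in mk_edges, #|A| == 2].
Proof.
apply/forall_inP => A; rewrite inE => /existsP[x /existsP[y /and3P[xy _ /eqP->]]].
by rewrite cards2 xy.
Qed.

Definition mk_lgraph : lgraph n := exist _ mk_edges mk_edges_card.

Lemma ladj_mk : symmetric e -> irreflexive e -> ladj mk_lgraph =2 e.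
Proof.
move=> es ei x y; rewrite /ladj inE; apply/existsP/idP => [[a /existsP[b]]|xy].
  move=> /and3P[ab eab /eqP E].
  have : (x \in [set a; b])%SET && (y \in [set a; b])%SET.
    by rewrite -E !finset.inE !eqxx orbT.
  have : (a \in [set x; y])%SET && (b \in [set x; y])%SET.
    by rewrite E !finset.inE !eqxx orbT.
  rewrite !finset.inE => /andP[/orP[]/eqP E1 /orP[]/eqP E2]; subst; rewrite ?eqxx // in ab *.
  by rewrite es.
exists x; apply/existsP; exists y; rewrite xy eqxx !andbT.
by apply: contraTneq xy => ->; rewrite ei.
Qed.

End MakeGraph.

Definition empty_type : gtype := Tagged lgraph (mk_lgraph (fun _ _ : 'I_0 => false)).

Definition canon (G : sgraph) : gtype :=
  xget empty_type [set t | isomorphic G (gr t)]%classic.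

Definition realizable (G : sgraph) := exists t, isomorphic G (gr t).

Lemma canon_iso G : realizable G -> isomorphic G (gr (canon G)).
Proof. by move=> rG; apply: (@xgetPex _ empty_type [set t | isomorphic G (gr t)]%classic). Qed.

Lemma canon_eq G H : isomorphic G H -> canon G = canon H.
Proof.
move=> GH; congr (xget _ _); apply/seteqP; split=> t /= E; apply: isomorphic_trans E => //.
exact: isomorphic_sym.
Qed.

Lemma canonK G : realizable G -> canon (gr (canon G)) = canon G.
Proof. by move=> rG; apply: canon_eq; apply: isomorphic_sym; apply: canon_iso. Qed.

Definition connected_graph (G : sgraph) := forall v w : G, exists k, dist_le k v w.

Lemma connected_iso G H : isomorphic G H -> connected_graph G -> connected_graph H.
Proof.
move=> [f [[g fK gK] hom]] cG v w; have [k [p [pp pl ps]]] := cG (g v) (g w).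
exists k, (map f p); split; last by rewrite size_map.
  rewrite -(gK v) path_map; apply: sub_path pp => x y; by rewrite /= hom.
by rewrite -(gK v) last_map pl gK.
Qed.

Section Transport.
Local Open Scope ring_scope.
Variable d : nat.
Local Notation Zd := 'rV[int]_d.

Definition charted r (G : sgraph) :=
  forall v : G, exists phi : Zd -> G, chart r phi /\ phi 0 = v.

Definition embedding (G H : sgraph) (f : G -> H) :=
  [/\ injective f, forall x y, adj H (f x) (f y) = adj G x y &
    forall x b, adj H (f x) b -> exists y, b = f y].

Lemma charted_embedding r (G H : sgraph) (f : G -> H) :
  embedding f -> charted r H -> charted r G.
Proof.
move=> [finj hom clo] cH v; have [phi [[inj pho sur] p0]] := cH (f v).
have lift x : (nrm x <= r)%N -> exists y, phi x = f y.
  elim/nrm_indS: x => [_|x e xe IH xr]; first by exists v.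
  have xr' : (nrm x <= r)%N by lia.
  have [y yE] := IH xr'; by apply: (clo y); rewrite -yE pho ?lattice_adj_dv.
have /choice[psi psiE] x : exists y, (nrm x <= r)%N -> phi x = f y.
  by have [/lift[y yE]|_] := boolP (nrm x <= r)%N; [exists y|exists v].
exists psi; split; last by apply: finj; rewrite -psiE ?nrm0.
split=> [x y xr yr E|x y xr yr|x b xr].
- by apply: inj => //; rewrite !psiE // E.
- by rewrite -hom -!psiE // pho.
- rewrite -hom -psiE ?(ltnW xr) // => /sur-/(_ xr)[e bE]; exists e; apply: finj.
  by rewrite -psiE ?nrm_inner.
Qed.

Lemma nbr_embedding (G H : sgraph) (f : G -> H) (p : Zd -> G) x :
  embedding f -> nbr p x -> nbr (f \o p) x.
Proof.
move=> [finj hom clo] [A I S]; split=> [e|e e' /finj|b]; rewrite /= ?hom //.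
  exact: I.
by move=> pb; have [y yE] := clo _ _ pb; move: pb; rewrite yE hom => /S[e ->]; exists e.
Qed.

Lemma tcover_embedding R (G H : sgraph) (f : G -> H) (p : Zd -> G) :
  embedding f -> tcover R p -> tcover R (f \o p).
Proof.
move=> fi [N T S]; have finj : injective f by case: fi.
split=> [x|x y z /finj/T E|l /finj/S] //=; first exact: nbr_embedding.
by rewrite E.
Qed.

Lemma good_at_embedding R (G H : sgraph) (f : G -> H) v :
  embedding f -> good_at d R v -> good_at d R (f v).
Proof.
move=> fi [p [p0 tp]]; exists (f \o p); rewrite /= p0; split=> //.
exact: tcover_embedding.
Qed.

Lemma good_at_connected R (G : sgraph) (v w : G) :
  connected_graph G -> good_at d R v -> good_at d R w.
Proof.
move=> conn [p [p0 tp]]; have [N _ _] := tp; have [j] := conn v w.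
rewrite -p0 => /(nbr_walk N)[y [_ ->]].
by exists (fun z => p (y + z)); rewrite addr0; split=> //; apply: tcover_shift.
Qed.

Lemma kernel_iso (G H : sgraph) (p : Zd -> G) (p' : Zd -> H) :
  (forall x, nbr p x) -> (forall x, nbr p' x) ->
  (forall a, exists x, p x = a) -> (forall a, exists x, p' x = a) ->
  (forall x y, p x = p y <-> p' x = p' y) -> isomorphic G H.
Proof.
move=> N N' /choice[pre preK] surj' ker; exists (fun a => p' (pre a)); split.
  apply: inj_surj_bij => [a b /ker|b]; first by rewrite !preK.
  by have [x <-] := surj' b; exists (p x); apply/ker; rewrite preK.
move=> a b; rewrite -{2}(preK a) -{2}(preK b).
have [A _ S] := N (pre a); have [A' _ S'] := N' (pre a).
apply/idP/idP => [/S'[e /ker ->]|/S[e /ker ->]]; [exact: A|exact: A'].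
Qed.

End Transport.

End Isomorphism.

Section BadTypes.
Local Open Scope ring_scope.
Variables (k r R : nat).
Local Notation d := k.+1.
Local Notation Zd := 'rV[int]_d.
Local Notation dir := ('I_d * bool)%type.
Hypothesis k0 : (0 < k)%N.
Hypothesis r2 : (2 <= r)%N.
Hypothesis r3 : (3 <= r)%N \/ d = 2%N.
Hypothesis dr : (d <= r.*2.+1)%N.

Definition badtype m (t : gtype) := [/\ canon (gr t) = t, connected_graph (gr t),
  (0 < tag t <= m)%N, charted d r (gr t) & forall a : gr t, ~ good_at d R a].

(* Periods, point group, origin, and translation parts of the affine deck maps. *)
Definition crystal : Type :=
  (set 'rV[int]_d * {set {perm dir}} * 'rV[int]_d * ({perm dir} -> 'rV[int]_d))%type.

Definition crystal_of (t : gtype) (D : crystal) := let: (L, P, u, v) := D in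
  exists p : Zd -> gr t, [/\ cover r p, forall a, exists x, p x = a,
    periods p = L /\ point_group p = P,
    box (nseq d #|P|) u /\ (0 < #|P|)%N &
    forall s, s \in P -> deck p s (v s) /\ L (#|P|%:Z *: v s - (u - u *m amx s))].

Lemma badtype_sq_uniq m t : badtype m t -> sq_uniq (gr t).
Proof. by case=> _ _ _ ct _; apply: (local_sq_uniq r2 ct). Qed.

Lemma crystal_exists m t : badtype m t -> exists D, crystal_of t D.
Proof.
move=> bt; have sq := badtype_sq_uniq bt; have [_ conn /andP[t0 _] ct _] := bt.
have [phi [ch _]] := ct (Ordinal t0 : gr t).
have [p [cp _ _]] := cover_exists r2 r3 ct ch.
have [p' [u [v [cp' ub P0 dk per]]]] := crystal_normal_form r2 cp.
exists (periods p', point_group p', u, v), p'; split=> //; last by move=> s sP; split; auto.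
move=> a; have [j pj] := conn (p' 0) a.
by have [y [_ ->]] := nbr_walk (fun y => cover_nbr r2 y cp') pj; exists y.
Qed.

Lemma crystal_iso t t' L P u u' v v' : sq_uniq (gr t) -> sq_uniq (gr t') ->
  crystal_of t (L, P, u, v) -> crystal_of t' (L, P, u', v') ->
  (forall s, s \in P -> L (v s - v' s)) -> isomorphic (gr t) (gr t').
Proof.
move=> sq sq' [p [cp sp [pL pP] _ D]] [p' [cp' sp' [pL' pP'] _ D']] vv'.
have ker (G : sgraph) (q : Zd -> G) w : sq_uniq G -> cover r q -> periods q = L -> point_group q = P ->
    (forall s, s \in P -> deck q s (w s)) -> forall x y,
    q x = q y <-> exists2 s, s \in P & L (y - (x *m amx s + w s)).
  move=> sG cq qL qP Dq x y; rewrite (cover_fiber r2 sG cq); split.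
    move=> [s [z [sz ->]]]; have sP : s \in P by rewrite -qP inE; apply/asboolP; exists z.
    exists s => //; rewrite -qL opprD addrACA subrr add0r; apply: deck_uniq sz _.
    exact: Dq.
  move=> [s sP]; rewrite -qL => Ls; exists s, (y - x *m amx s).
  rewrite [x *m _ + _]addrC subrK; split=> //.
  have := deck_shift Ls (Dq s sP); congr (deck q s _).
  by rewrite addrC opprD addrA subrK.
have sL : subgrp L by rewrite -pL; apply: periods_subgrp.
apply: (kernel_iso (p := p) (p' := p')) => //; try exact: cover_nbr.
  by move=> x; apply: cover_nbr cp.
  by move=> x; apply: cover_nbr cp'.
move=> x y; rewrite (ker _ p v) //; last by move=> s /D[].
rewrite (ker _ p' v') //; last by move=> s /D'[].
have comb s a (w w' : Zd) : L (w - w') -> L (a - (x *m amx s + w)) -> L (a - (x *m amx s + w')).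
  move=> Lw La; have := subgrpD sL La Lw; congr L.
  by apply/rowP => i; rewrite !mxE; ring.
split=> -[s sP Ls]; exists s => //; apply: comb Ls; first exact: vv'.
by rewrite -opprB; apply: subgrpN => //; apply: vv'.
Qed.

Lemma count_bad : exists C, forall m, count_le (badtype m) (C * growth k m)%N.
Proof.
have [C0 C0P] := @count_sublattices k R.*2.+1 k0 #|{ffun dir -> dir}|.
pose np := #|{perm dir}|.
exists (C0 * #|{set {perm dir}}| * np ^ d * (np ^ d) ^ np)%N => m.
have /choice[D DE] t : exists D, badtype m t -> crystal_of t D.
  have [bt|nb] := pselect (badtype m t); last by exists (setT, finset.set0, 0, fun=> 0).
  by have [D DP] := crystal_exists bt; exists D.
pose bnd := (C0 * growth k m * #|{set {perm dir}}| * np ^ d * (np ^ d) ^ np)%N.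
suff : count_le (badtype m) bnd.
  by apply: count_leW => //; rewrite /bnd; lia.
have cQ := count_le_pair (count_le_pair (C0P m) (count_le_fin {set {perm dir}}))
  (@count_box d (nseq d np) (size_nseq _ _)).
have prodE : (\prod_(i <- nseq d np) i = np ^ d)%N by rewrite big_nseq iter_muln_1.
rewrite prodE in cQ.
apply: (count_le_fib (g := fun t => (D t).1) _ cQ).
  move=> t bt; have := DE t bt; have [_ _ /andP[t0 tm] _ ng] := bt.
  have sq := badtype_sq_uniq bt.
  case: (D t) => -[[L P] u] v [p [cp sp [pL pP] [ub P0] _]] /=; split; last first.
    have nthE q (i : 'I_d) : nth 0%N (nseq d q) i = q by rewrite nth_nseq ltn_ord.
    move=> i; have := ub i; rewrite (nthE #|P| i) => /andP[u0 u1].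
    change (0 <= u 0 i < (nth 0%N (nseq d np) i)%:Z); rewrite nthE u0 (lt_le_trans u1) //.
    by rewrite lez_nat; apply: max_card.
  split=> //.
  have [i [idi inv]] := not_good_invariant k0 r2 dr sq cp (fun a => ng (p a)).
  exists i; rewrite -pL; split=> //; first exact: periods_subgrp.
  have [|f [fM fL]] := periods_index r2 sq cp (n := tag t) (code := @nat_of_ord (tag t)) _ val_inj.
    by move=> v0; apply: ltn_ord.
  by exists f; split=> // x; apply: leq_trans (fM x) _; rewrite leq_mul2r tm orbT.
move=> [[L P] u] _; have Dpos t : badtype m t -> (D t).1 = (L, P, u) -> (0 < #|P|)%N.
  move=> bt E; have := DE t bt; move: E; case: (D t) => -[[L1 P1] u1] v1 /= [_ -> _].
  by move=> [p [_ _ _ [_ +] _]].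
have [P0|P0] := posnP #|P|.
  exists (fun=> 0%N); split=> [t [bt E]|t t' [bt E] _ _].
    by have := Dpos t bt E; rewrite P0.
  by have := Dpos t bt E; rewrite P0.
have [h hE] : exists h, #|P| = h.+1 by exists #|P|.-1; rewrite prednK.
pose B := xget (0 : 'M[int]_d) [set B | forall x, L x <-> exists y, x = y *m B]%classic.
pose v0 s := xget (0 : 'rV[int]_d) [set z | L (h.+1%:Z *: z - (u - u *m amx s))]%classic.
pose n t s := xget (0 : 'rV[int]_d) [set n | h.+1%:Z *: ((D t).2 s - v0 s) = n *m B]%classic.
pose code t : {ffun {perm dir} -> {ffun 'I_d -> 'I_h.+1}} := [ffun s => modrow h (n t s)].
have card_code : (#|{ffun {perm dir} -> {ffun 'I_d -> 'I_h.+1}}| <= (np ^ d) ^ np)%N.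
  rewrite !card_ffun !card_ord -/np.
  have : (h.+1 ^ d <= np ^ d)%N by rewrite leq_exp2r // -hE; apply: max_card.
  by case: (np) => // np' le; rewrite leq_exp2r.
apply: (count_leW card_code (fun t => id)).
apply: (count_le_inj (g := code) (Q := fun=> True)) (count_le_fin _) => //.
move=> t t' [bt E] [bt' E'] cE.
have sq := badtype_sq_uniq bt; have sq' := badtype_sq_uniq bt'.
have [ct _ _ _ _] := bt; have [ct' _ _ _ _] := bt'.
rewrite -ct -ct'; apply: canon_eq.
have DtE s : D s = ((D s).1, (D s).2) by case: (D s).
have c1 := DE t bt; have c2 := DE t' bt'; rewrite DtE E in c1; rewrite DtE E' in c2.
apply: (crystal_iso sq sq' c1 c2) => s sP.
have [p [cp _ [pL _] _ Dp]] := c1; have [p' [cp' _ [pL' _] _ Dp']] := c2.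
have sL : subgrp L by rewrite -pL; apply: periods_subgrp.
have cL : cofinite L.
  apply: (index_le_cofinite (M := tag t * #|{ffun dir -> dir}|) sL); rewrite -pL.
  apply: (periods_index r2 sq cp (code := @nat_of_ord (tag t)) _ val_inj) => v1.
  exact: ltn_ord.
have BE x : L x <-> exists y, x = y *m B.
  apply: (@xgetPex _ (0 : 'M[int]_d) [set B | forall x, L x <-> exists y, x = y *m B]%classic).
  exact: lattice_basis.
have v0E : L (h.+1%:Z *: v0 s - (u - u *m amx s)).
  apply: (@xgetPex _ (0 : 'rV[int]_d) [set z | L (h.+1%:Z *: z - (u - u *m amx s))]%classic).
  by exists ((D t).2 s); rewrite /= -hE; case: (Dp s sP).
have nE (q : gtype) : L (#|P|%:Z *: (D q).2 s - (u - u *m amx s)) ->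
    h.+1%:Z *: ((D q).2 s - v0 s) = n q s *m B.
  move=> Lq; apply: (@xgetPex _ (0 : 'rV[int]_d)
    [set n | h.+1%:Z *: ((D q).2 s - v0 s) = n *m B]%classic).
  rewrite /=; apply/BE; have := sL.2 _ _ Lq v0E; rewrite hE; congr L.
  by move: (u - _) => b; rewrite scalerBr opprB addrA subrK.
have n1 := nE t (Dp s sP).2; have n2 := nE t' (Dp' s sP).2.
have := congr1 (fun f : {ffun _ -> _} => f s) cE; rewrite !ffunE => /modrow_eq[z zE].
apply/BE; exists z; apply: (@scalez_inj _ _ h.+1%:Z) => //.
have -> : (D t).2 s - (D t').2 s = ((D t).2 s - v0 s) - ((D t').2 s - v0 s).
  by rewrite opprB addrA subrK.
by rewrite scalerBr n1 n2 zE mulmxDl addrAC subrr add0r scalemxAl.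
Qed.

End BadTypes.

(** * Graphs as multisets of components *)

Section Decomposition.

Definition adjn (t : gtype) (a b : nat) : bool :=
  [exists x : 'I_(tag t), exists y : 'I_(tag t),
    [&& x == a :> nat, y == b :> nat & ladj (tagged t) x y]].

Lemma adjnP (t : gtype) a b : reflect
  (exists x y : 'I_(tag t), [/\ x = a :> nat, y = b :> nat & ladj (tagged t) x y]) (adjn t a b).
Proof.
apply: (iffP existsP) => [[x /existsP[y /and3P[/eqP xa /eqP yb xy]]]|[x [y [xa yb xy]]]].
  by exists x, y.
by exists x; apply/existsP; exists y; rewrite xa yb xy !eqxx.
Qed.

Lemma adjnE (t : gtype) (x y : 'I_(tag t)) : adjn t x y = ladj (tagged t) x y.
Proof. by apply/adjnP/idP => [[a [b [/val_inj-> /val_inj->]]]//|xy]; exists x, y. Qed.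

Local Notation nt := (nth empty_type).

(* [c] gives each vertex the number of its component and its place in that component. *)
Definition coords (G : sgraph) (s : seq gtype) (c : G -> nat * nat) : Prop :=
  [/\ injective c, forall x, (c x).1 < size s /\ (c x).2 < tag (nt s (c x).1),
      forall i j, i < size s -> j < tag (nt s i) -> exists x, c x = (i, j) &
      forall x y, adj G x y = ((c x).1 == (c y).1) && adjn (nt s (c x).1) (c x).2 (c y).2].

Definition decomp G s := exists c, @coords G s c.

Definition proper_type (t : gtype) :=
  [/\ canon (gr t) = t, connected_graph (gr t) & 0 < tag t].

Definition proper (s : seq gtype) := forall t, t \in s -> proper_type t.

Definition total (s : seq gtype) := sumn (map (fun t : gtype => tag t) s).

Lemma decomp_perm_iso G H s s' : decomp G s -> decomp H s' -> perm_eq s s' ->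
  isomorphic G H.
Proof.
move=> [c [inj ran sur hom]] [c' [inj' ran' sur' hom']] /(perm_iotaP empty_type)[js pjs sE].
have ujs : uniq js by rewrite (perm_uniq pjs) iota_uniq.
have szjs : size js = size s by rewrite sE size_map.
have mjs i : i < size s -> nth 0 js i < size s'.
  move=> si; have : nth 0 js i \in js by rewrite mem_nth // szjs.
  by rewrite (perm_mem pjs) mem_iota.
have nE i : i < size s -> nt s i = nt s' (nth 0 js i).
  by move=> si; rewrite {1}sE (nth_map 0) // szjs.
have /choice[g gE] x : exists y, c' y = (nth 0 js (c x).1, (c x).2).
  by have [x1 x2] := ran x; apply: sur'; rewrite ?mjs // -nE.
exists g; split.
  apply: inj_surj_bij => [x y E|y].
    have := gE x; rewrite E gE => -[/eqP]; rewrite nth_uniq ?szjs ?(ran _).1 // => /eqP E1 E2.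
    by apply: inj; rewrite [LHS]surjective_pairing [RHS]surjective_pairing E1 E2.
  have [y1 y2] := ran' y; have yjs : (c' y).1 \in js by rewrite (perm_mem pjs) mem_iota.
  have si : index (c' y).1 js < size s by rewrite -szjs index_mem.
  have [|x xE] := sur (index (c' y).1 js) (c' y).2 si; first by rewrite nE // nth_index.
  by exists x; apply: inj'; rewrite gE xE /= nth_index // -surjective_pairing.
move=> x y; rewrite hom' !gE /= hom -nE ?(ran x).1 //.
by rewrite nth_uniq // szjs (ran _).1.
Qed.

Lemma decomp_iso G H s : isomorphic G H -> decomp G s -> decomp H s.
Proof.
move=> /isomorphic_sym[g [gb ghom]] [c [inj ran sur hom]].
exists (c \o g); split=> /=.
- exact: inj_comp inj (bij_inj gb).
- by move=> x.
- move=> i j si jt; have [x <-] := sur i j si jt.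
  by have [h _ hK] := gb; exists (h x); rewrite hK.
- by move=> x y; rewrite -ghom hom.
Qed.

Lemma decomp_exists s : exists G : lgraph (total s), decomp (graph_of G) s.
Proof.
set sh := map (fun t : gtype => tag t) s; set n := total s.
have shn i : nth 0 sh i = tag (nt s i).
  have [si|si] := ltnP i (size s); first by rewrite (nth_map empty_type).
  by rewrite !nth_default ?size_map.
pose c (x : 'I_n) := (reshape_index sh x, reshape_offset sh x).
pose e : rel 'I_n := fun x y => ((c x).1 == (c y).1) && adjn (nt s (c x).1) (c x).2 (c y).2.
have es : symmetric e.
  move=> x y; rewrite /e eq_sym; case: eqP => //= ->.
  by apply/adjnP/adjnP => -[a [b [E1 E2 ab]]]; exists b, a; split=> //; rewrite ladj_sym.
have ei : irreflexive e.
  move=> x; rewrite /e eqxx /=; apply/adjnP => -[a [b [xa xb]]].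
  by have -> : a = b; [apply: val_inj; rewrite /= xa xb|rewrite ladj_irr].
exists (mk_lgraph e), c; split.
- by move=> x y [E1 E2]; apply: val_inj; rewrite /= -(reshape_indexK sh x) E1 E2 reshape_indexK.
- move=> x; rewrite /= -shn; split; last exact: reshape_offsetP.
  by have := reshape_indexP (ltn_ord x : x < sumn sh); rewrite size_map.
- move=> i j si jt; have fn : flatten_index sh i j < n.
    by apply: flatten_indexP; rewrite shn.
  by exists (Ordinal fn); rewrite /c /= flatten_indexKl ?flatten_indexKr ?shn.
- by move=> x y; rewrite /= ladj_mk.
Qed.

Section Coords.
Variables (G : sgraph) (s : seq gtype) (c : G -> nat * nat).
Hypothesis cc : coords s c.

Lemma coords_embedding i : i < size s -> exists f : gr (nt s i) -> G,
  embedding f /\ forall a, c (f a) = (i, (a : 'I__) : nat).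
Proof.
move=> si; have [inj ran sur hom] := cc.
have /choice[f fE] (a : gr (nt s i)) : exists x, c x = (i, (a : 'I__) : nat).
  exact: (sur i _ si (ltn_ord (a : 'I__))).
exists f; split=> //; split=> [a b E|a b|a y].
- by have := fE a; rewrite E fE => -[/val_inj].
- by rewrite hom !fE /= eqxx adjnE.
- rewrite hom !fE /= => /andP[/eqP iE /adjnP[x [z [_ zE _]]]].
  by exists z; apply: inj; rewrite fE zE iE -surjective_pairing.
Qed.

Lemma coords_const (F : G -> nat) : proper s -> (forall x y, adj G x y -> F x = F y) ->
  forall x y, (c x).1 = (c y).1 -> F x = F y.
Proof.
move=> ps FE x y xy; have [inj ran sur hom] := cc.
have [f [[finj fhom _] fE]] := coords_embedding (ran x).1.
have [_ conn _] := ps _ (mem_nth empty_type (ran x).1).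
have y2 : (c y).2 < tag (nt s (c x).1) by rewrite xy; case: (ran y).
have [j [p [pp pl _]]] := conn (Ordinal (ran x).2) (Ordinal y2).
have -> : x = f (Ordinal (ran x).2) by apply: inj; rewrite fE /= -surjective_pairing.
have -> : y = f (Ordinal y2) by apply: inj; rewrite fE /= xy -surjective_pairing.
rewrite -pl; elim: p (Ordinal _ : gr _) pp {pl} => //= b p IH a /andP[ab pp].
by rewrite (FE (f a) (f b)) ?fhom // IH.
Qed.

Lemma coords_total n (e : G -> 'I_n) : bijective e -> total s = n.
Proof.
move=> eb; have [G' [c' [inj' ran' sur' hom']]] := decomp_exists s.
have [inj ran sur hom] := cc.
have [g [gb _]] : isomorphic G (graph_of G').
  by apply: decomp_perm_iso (perm_refl s); [exists c|exists c'].
have [h eK hK] := eb.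
have : bijective (g \o h) by apply: bij_comp gb _; exists e.
by move/bij_eq_card; rewrite !card_ord.
Qed.

End Coords.

Lemma decomp_total n (G : lgraph n) s : decomp (graph_of G) s -> total s = n.
Proof. by move=> [c cc]; apply: (coords_total cc (e := id)); exists id. Qed.

Lemma decomp_uniq G s s' : proper s -> proper s' -> decomp G s -> decomp G s' -> perm_eq s s'.
Proof.
move=> ps ps' [c cc] [c' cc'].
have [inj ran sur hom] := cc; have [inj' ran' sur' hom'] := cc'.
have adj1 x y : adj G x y -> (c x).1 = (c y).1 by rewrite hom => /andP[/eqP].
have adj1' x y : adj G x y -> (c' x).1 = (c' y).1 by rewrite hom' => /andP[/eqP].
have to x y := coords_const cc ps adj1' (x := x) (y := y).
have fro x y := coords_const cc' ps' adj1 (x := x) (y := y).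
have pos i : i < size s -> 0 < tag (nt s i).
  by move=> si; case: (ps _ (mem_nth empty_type si)).
have pos' i : i < size s' -> 0 < tag (nt s' i).
  by move=> si; case: (ps' _ (mem_nth empty_type si)).
have /choice[tau tauE] i : exists i', i < size s -> exists x, (c x).1 = i /\ (c' x).1 = i'.
  have [si|_] := boolP (i < size s); last by exists 0.
  by have [x xE] := sur i 0 si (pos i si); exists (c' x).1 => _; exists x; rewrite xE.
apply/(perm_iotaP empty_type); exists [seq tau i | i <- iota 0 (size s)].
  apply: uniq_perm; rewrite ?iota_uniq //.
    rewrite map_inj_in_uniq ?iota_uniq // => i j; rewrite !mem_iota /= => si sj E.
    have [x [xi xt]] := tauE i si; have [y [yi yt]] := tauE j sj.
    by rewrite -xi -yi; apply: fro; rewrite xt yt.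
  move=> j; rewrite mem_iota /=; apply/mapP/idP => [[i + ->]|sj].
    by rewrite mem_iota /= => si; have [x [_ <-]] := tauE i si; case: (ran' x).
  have [x xE] := sur' j 0 sj (pos' j sj); exists (c x).1.
    by rewrite mem_iota /=; case: (ran x).
  have [y [yi yt]] := tauE _ (ran x).1; rewrite -yt.
  by have -> : (c' y).1 = (c' x).1; [exact: to|rewrite xE].
apply: (@eq_from_nth _ empty_type); first by rewrite !size_map size_iota.
move=> i si; rewrite (nth_map 0) ?size_map ?size_iota // (nth_map 0) ?size_iota //.
rewrite nth_iota // add0n.
have [x [xi xt]] := tauE i si; have ti : tau i < size s' by rewrite -xt; case: (ran' x).
have [f [fe fE]] := coords_embedding cc si; have [f' [fe' fE']] := coords_embedding cc' ti.
have [finj fhom _] := fe; have [finj' fhom' _] := fe'.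
have /choice[g gE] a : exists b, f a = f' b.
  have E : (c' (f a)).1 = tau i by rewrite -xt; apply: to; rewrite fE.
  have a2 : (c' (f a)).2 < tag (nt s' (tau i)) by rewrite -E; case: (ran' (f a)).
  by exists (Ordinal a2); apply: inj'; rewrite fE' /= [LHS]surjective_pairing E.
have gsur b : exists a, f a = f' b.
  have E : (c (f' b)).1 = i by rewrite -xi; apply: fro; rewrite fE' xt.
  have b2 : (c (f' b)).2 < tag (nt s i) by case: (ran (f' b)); rewrite E.
  by exists (Ordinal b2); apply: inj; rewrite fE /= [RHS]surjective_pairing E.
have [<- _ _] := ps _ (mem_nth empty_type si).
have [<- _ _] := ps' _ (mem_nth empty_type ti).
apply: canon_eq; exists g; split; last by move=> a b; rewrite -fhom' -!gE fhom.
apply: inj_surj_bij => [a b E|b]; first by apply: finj; rewrite !gE E.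
by have [a aE] := gsur b; exists a; apply: finj'; rewrite -gE.
Qed.

Lemma realizable_inj (G : sgraph) n (f : G -> 'I_n) : injective f -> realizable G.
Proof.
move=> finj; pose A := [set i | `[< exists x, f x = i >]]%SET.
have /choice[g gE] (i : 'I_#|A|) : exists x, f x = enum_val i.
  by have := enum_valP i; rewrite inE => /asboolP[x xE]; exists x.
have gi : injective g by move=> i j E; apply: enum_val_inj; rewrite -!gE E.
have gs x : exists i, g i = x.
  have xA : f x \in A by rewrite inE; apply/asboolP; exists x.
  by exists (enum_rank_in xA (f x)); apply: finj; rewrite gE enum_rankK_in.
pose e : rel 'I_#|A| := fun i j => adj G (g i) (g j).
have es : symmetric e by move=> i j; rewrite /e adj_sym.
have ei : irreflexive e by move=> i; rewrite /e adj_irr.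
exists (Tagged lgraph (mk_lgraph e)); apply: isomorphic_sym; exists g.
by split; [exact: inj_surj_bij|move=> i j; rewrite /gr /= ladj_mk].
Qed.

Lemma decomp_lgraph n (G : lgraph n) : exists s, proper s /\ decomp (graph_of G) s.
Proof.
have csym : connect_sym (ladj G) by apply: sym_connect_sym; apply: ladj_sym.
pose C := component G; have rC v : realizable (C v).
  by apply: (@realizable_inj _ n (fun x : C v => sval x)); apply: val_inj.
have memC (v w : 'I_n) : connect (ladj G) v w -> w \in [set u | connect (ladj G) v u]%classic.
  by move=> vw; rewrite inE.
have /choice[phi phiE] v : exists phi : 'I_n -> nat,
    [/\ {in connect (ladj G) v &, injective phi},
        forall w, connect (ladj G) v w -> phi w < tag (canon (C v)),
        forall j, j < tag (canon (C v)) -> exists2 w, connect (ladj G) v w & phi w = j &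
        {in connect (ladj G) v &, forall w u,
          ladj G w u = adjn (canon (C v)) (phi w) (phi u)}].
  have [psi [[psi' psiK psi'K] hom]] := canon_iso (rC v).
  pose phi w := if pselect (connect (ladj G) v w) is left vw
    then ((psi (exist _ w (memC v w vw)) : 'I__) : nat) else 0.
  have phiE w (vw : connect (ladj G) v w) : phi w = (psi (exist _ w (memC v w vw)) : 'I__).
    by rewrite /phi; case: pselect => // vw'; congr (nat_of_ord (psi _)); apply: val_inj.
  exists phi; split=> [w u vw vu|w vw|j jt|w u vw vu].
  - by rewrite !phiE => /val_inj/(can_inj psiK)[].
  - by rewrite phiE ltn_ord.
  - case E : (psi' (Ordinal jt : gr (canon (C v)))) => [w wm].
    have vw : connect (ladj G) v w by move: (wm); rewrite inE.
    exists w => //; rewrite phiE (_ : exist _ w _ = psi' (Ordinal jt)) ?psi'K //.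
    by rewrite E; apply: val_inj.
  - by rewrite !phiE adjnE; exact: (esym (hom (exist _ w (memC v w vw)) (exist _ u (memC v u vu)))).
pose rs := enum (roots (ladj G)); pose s := [seq canon (C v) | v <- rs].
have rin v : fingraph.root (ladj G) v \in rs by rewrite mem_enum; apply: roots_root.
have rvv v : connect (ladj G) (fingraph.root (ladj G) v) v by rewrite csym connect_root.
pose c v := (index (fingraph.root (ladj G) v) rs, phi (fingraph.root (ladj G) v) v).
have ntE v : nt s (index (fingraph.root (ladj G) v) rs) = canon (C (fingraph.root (ladj G) v)).
  by rewrite (nth_map v) ?index_mem // nth_index.
exists s; split.
  move=> _ /mapP[v _ ->]; split; first exact: canonK.
    apply: connected_iso (canon_iso (rC v)) _ => -[x xm] [y ym].
    have vx : connect (ladj G) v x by move: xm; rewrite inE.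
    have : connect (ladj G) x y.
      by move: ym; rewrite inE /= => vy; apply: connect_trans vy; rewrite csym.
    case/connectP=> p; elim: p x xm vx => [|b p IH] x xm vx /=.
      by move=> _ yx; exists 0, [::]; split=> //; apply: val_inj.
    move=> /andP[xb bp] yE; have vb := connect_trans vx (connect1 xb).
    have [j [q [qp ql qj]]] := IH b (memC v b vb) vb bp yE.
    by exists j.+1, (exist _ b (memC v b vb) :: q); rewrite /= qp andbT.
  have [psi _] := canon_iso (rC v).
  have := psi (exist _ v (memC v v (connect0 _ _))).
  by move=> -[j jt]; apply: leq_ltn_trans jt.
exists c; split.
- move=> x y [E1 E2]; have rE : fingraph.root (ladj G) x = fingraph.root (ladj G) y.
    by rewrite -(nth_index x (rin x)) E1 nth_index.
  have [inj _ _ _] := phiE (fingraph.root (ladj G) x); apply: inj; first exact: rvv.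
    by have := rvv y; rewrite -rE.
  by rewrite E2 rE.
- move=> x; rewrite /= ntE size_map index_mem; split=> //.
  by have [_ lt _ _] := phiE (fingraph.root (ladj G) x); apply: lt.
- move=> i j; rewrite size_map => irs; have [v vE] : exists v, nth v rs i = v /\ v \in rs.
    case: (rs) irs => // v0 l il; exists (nth v0 (v0 :: l) i).
    by split; [exact: set_nth_default|exact: mem_nth].
  have [vi vrs] := vE; have rv : fingraph.root (ladj G) v = v.
    by apply/eqP; move: vrs; rewrite mem_enum.
  rewrite (nth_map v) // vi => jt; have [_ _ sur _] := phiE v.
  have [w vw wE] := sur j jt; exists w; have rw : fingraph.root (ladj G) w = v.
    by rewrite -rv; apply/eqP; rewrite (root_connect csym) csym.
  by rewrite /c rw wE -{1}vi index_uniq // enum_uniq.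
- move=> x y; rewrite /= ntE; have [rE|rE] := eqVneq (fingraph.root (ladj G) x) (fingraph.root (ladj G) y).
    rewrite rE eqxx /= -rE; have [_ _ _ hom] := phiE (fingraph.root (ladj G) x).
    by apply: hom; [exact: rvv|have := rvv y; rewrite -rE].
  rewrite [index _ _ == _]negbTE /=.
    apply/negP => /connect1; rewrite -(root_connect csym) => /eqP E.
    by rewrite E eqxx in rE.
  apply: contra rE => /eqP E; apply/eqP.
  by rewrite -(nth_index x (rin x)) E nth_index.
Qed.

End Decomposition.

Section Classes.
Variables (d R : nat).

Lemma lisoP n (G H : lgraph n) : reflect (isomorphic (graph_of G) (graph_of H)) (liso G H).
Proof. exact: asboolP. Qed.

Lemma unlabelledP n (C : {set lgraph n}) :
  reflect (exists G, C = [set H | liso G H]%SET) (C \in unlabelled n).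
Proof.
apply: (iffP imsetP) => [[G _ ->]|[G ->]]; exists G => //.
  by apply/setP => H; rewrite !finset.inE.
by apply/setP => H; rewrite !finset.inE.
Qed.

Definition spec n (C : {set lgraph n}) (s : seq gtype) :=
  proper s /\ forall G, G \in C -> decomp (graph_of G) s.

Lemma spec_exists n (C : {set lgraph n}) : C \in unlabelled n -> exists s, spec C s.
Proof.
case/unlabelledP => G ->; have [s [ps ds]] := decomp_lgraph G; exists s; split=> // H.
by rewrite inE => /lisoP GH; apply: decomp_iso GH ds.
Qed.

Lemma spec_total n (C : {set lgraph n}) s : C \in unlabelled n -> spec C s -> total s = n.
Proof.
case/unlabelledP => G -> [_ /(_ G)]; rewrite inE => ds.
by apply: (decomp_total (ds _)); apply/lisoP; apply: isomorphic_refl.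
Qed.

Lemma spec_uniq n (C : {set lgraph n}) s s' : C \in unlabelled n -> spec C s -> spec C s' ->
  perm_eq s s'.
Proof.
case/unlabelledP => G -> [ps /(_ G) ds] [ps' /(_ G) ds'].
have GG : G \in [set H | liso G H]%SET by rewrite inE; apply/lisoP; apply: isomorphic_refl.
exact: decomp_uniq ps ps' (ds GG) (ds' GG).
Qed.

Lemma spec_perm n (C C' : {set lgraph n}) s s' : C \in unlabelled n -> C' \in unlabelled n ->
  spec C s -> spec C' s' -> perm_eq s s' -> C = C'.
Proof.
move=> /unlabelledP[G ->] /unlabelledP[G' ->] [_ /(_ G) ds] [_ /(_ G') ds'] ss'.
have GG (H : lgraph n) : H \in [set K | liso H K]%SET.
  by rewrite inE; apply/lisoP; apply: isomorphic_refl.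
have iso := decomp_perm_iso (ds (GG _)) (ds' (GG _)) ss'.
apply/setP => H; rewrite !inE; apply/lisoP/lisoP => E; apply: isomorphic_trans E => //.
exact: isomorphic_sym.
Qed.

Lemma spec_realize n s : proper s -> total s = n ->
  exists2 C, C \in unlabelled n & @spec n C s.
Proof.
move=> ps <-; have [G ds] := decomp_exists s; exists [set H | liso G H]%SET.
  by apply/unlabelledP; exists G.
by split=> // H; rewrite inE => /lisoP GH; apply: decomp_iso GH ds.
Qed.

Definition good_type (t : gtype) := exists a : gr t, good_at d R a.

Definition good_classes n : {set {set lgraph n}} :=
  [set C in unlabelled n | `[< exists2 s, spec C s & forall t, t \in s -> good_type t >]]%SET.

Lemma good_classesP n (C : {set lgraph n}) : reflect
  (C \in unlabelled n /\ forall s, spec C s -> forall t, t \in s -> good_type t)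
  (C \in good_classes n).
Proof.
rewrite inE; apply: (iffP andP) => [[Cu /asboolP[s ss gs]]|[Cu H]].
  by split=> // s' ss' t; rewrite -(perm_mem (spec_uniq Cu ss ss')); apply: gs.
by split=> //; apply/asboolP; have [s ss] := spec_exists Cu; exists s => //; apply: H.
Qed.

Lemma good_vertex_type n (G : lgraph n) s (c : graph_of G -> nat * nat) (v : graph_of G) :
  coords s c -> proper s ->
  good_type (nth empty_type s (c v).1) -> good_at d R v.
Proof.
move=> cc ps [a ga]; have [inj ran sur hom] := cc; have [v1 v2] := ran v.
have [f [fe fE]] := coords_embedding cc v1.
have [_ conn _] := ps _ (mem_nth empty_type v1).
have gb : good_at d R (Ordinal v2 : gr (nth empty_type s (c v).1)).
  exact: good_at_connected conn ga.
rewrite (_ : v = f (Ordinal v2)); first exact: (good_at_embedding fe gb).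
by apply: inj; rewrite fE /= -surjective_pairing.
Qed.

Lemma total_cat s s' : total (s ++ s') = total s + total s'.
Proof. by rewrite /total map_cat sumn_cat. Qed.

Lemma total_perm s s' : perm_eq s s' -> total s = total s'.
Proof. by move=> ss'; apply: perm_sumn; apply: perm_map. Qed.

Lemma total_sub u s : uniq u -> {subset u <= s} -> total u <= total s.
Proof.
elim: u s => [|t u IH] s //= /andP[tu uu] us; have ts : t \in s by apply: us; apply: mem_head.
rewrite (total_perm (perm_to_rem ts)) /= leq_add2l; apply: IH => // x xu.
have xt : x != t by apply: contraNneq tu => <-.
by have := us x; rewrite inE xu orbT (perm_mem (perm_to_rem ts)) inE (negbTE xt) => /(_ isT).
Qed.

Lemma count_le_card (T : finType) (A : {set T}) b : count_le (fun x => x \in A) b -> #|A| <= b.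
Proof.
move=> [f [fb finj]]; rewrite cardE; apply: (pigeonhole_seq (f := f)).
- exact: enum_uniq.
- by move=> x; rewrite mem_enum; apply: fb.
- by move=> x y; rewrite !mem_enum; apply: finj.
Qed.

Lemma count_le_set (T : finType) (A : {set T}) : count_le (fun x => x \in A) #|A|.
Proof.
have [->|[x0 x0A]] := set_0Vmem A.
  by exists (fun=> 0); split=> x; rewrite finset.inE.
exists (fun x => nat_of_ord (enum_rank_in x0A x)); split=> [x _|x y xA yA]; first exact: ltn_ord.
by move/val_inj; apply: enum_rank_in_inj.
Qed.

Lemma bin_double N S l : N.*2 <= S -> 2 ^ l * 'C(N, l) <= 'C(S, l).
Proof.
move=> NS; rewrite -(leq_pmul2r (fact_gt0 l)) -mulnA !bin_ffact.
elim: l N S NS => [|l IH] N S NS; first by rewrite !ffactn0.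
have [->|N0] := posnP N; first by rewrite ffact0n muln0.
rewrite !ffactnS expnS; have := IH N.-1 S.-1 (_ : N.-1.*2 <= S.-1).
move=> /(_ ltac:(lia)) le.
have : 2 * N * (2 ^ l * N.-1 ^_ l) <= S * S.-1 ^_ l by apply: leq_mul => //; lia.
lia.
Qed.

(* Add to a graph with [n - k] vertices [l] distinct members of [y] and one filler. A graph on
   [n] vertices has at most [N := n %/ sz] components of size at least [sz], so it arises in at
   most ['C(N, l)] ways, whereas there are ['C(size y, l) >= 2 ^ l * 'C(N, l)] choices. *)
Lemma good_classes_shift n k l sz j0 (y : seq gtype) (F : nat -> gtype) :
  0 < sz -> k <= n -> l * sz.*2 + j0 <= k -> (n %/ sz).*2 <= size y ->
  uniq y -> proper y ->
  (forall t, t \in y -> good_type t /\ sz <= tag t < sz.*2) ->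
  (forall j, j0 <= j -> [/\ proper_type (F j), good_type (F j) & tag (F j) = j]) ->
  2 ^ l * #|good_classes (n - k)| <= #|good_classes n|.
Proof.
move=> sz0 kn lk Ny uy py gy FP; set S := size y; set N := n %/ sz.
pose sY (Y : {set 'I_S}) := [seq nth empty_type y i | i : 'I_S <- enum Y].
have sYy Y t : t \in sY Y -> t \in y.
  by move=> /mapP[i _ ->]; apply: mem_nth.
have usY Y : uniq (sY Y).
  rewrite map_inj_in_uniq ?enum_uniq // => i j _ _ /eqP.
  by rewrite nth_uniq // => /eqP/val_inj.
have tsY Y : total (sY Y) <= #|Y| * sz.*2.
  rewrite /total cardE /sY; elim: (enum Y) => //= i e IH.
  rewrite mulSn leq_add // ltnW //.
  by have [_ /andP[]] := gy _ (mem_nth empty_type (ltn_ord i)).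
have tsY' (Y : {set 'I_S}) : #|Y| * sz <= total (sY Y).
  rewrite /total cardE /sY; elim: (enum Y) => //= i e IH.
  rewrite mulSn leq_add //.
  by have [_ /andP[]] := gy _ (mem_nth empty_type (ltn_ord i)).
pose P := finset.setX (good_classes (n - k)) [set Y : {set 'I_S} | #|Y| == l]%SET.
have inP x Y : ((x, Y) \in P) = (x \in good_classes (n - k)) && (#|Y| == l).
  by rewrite /P finset.in_setX /= [in X in _ && X]inE.
pose ext (s : seq gtype) Y := s ++ (F (k - total (sY Y)) :: sY Y).
have /choice[sp spP] (x : {set lgraph (n - k)}) : exists s, x \in unlabelled (n - k) -> spec x s.
  have [/spec_exists[s ss]|_] := boolP (x \in unlabelled (n - k)); first by exists s.
  by exists [::].
have extP u : u \in P -> exists2 C, C \in good_classes n & spec C (ext (sp u.1) u.2).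
  case: u => x Y; rewrite inP /= => /andP[/good_classesP[xu xg] /eqP Yl]; have xs := spP x xu.
  have tY := tsY Y; rewrite Yl in tY.
  have jle : j0 <= k - total (sY Y) by lia.
  have [pF gF tF] := FP _ jle.
  have [||C Cu Cs] := @spec_realize n (ext (sp x) Y).
  - move=> t; rewrite mem_cat inE => /or3P[|/eqP->//|/sYy/py//].
    by case: xs => + _; apply.
  - rewrite /ext total_cat /total /= -/(total _) -/(total _) tF (spec_total xu xs).
    lia.
  exists C => //; apply/good_classesP; split=> // s' ss' t.
  rewrite -(perm_mem (spec_uniq Cu Cs ss')) mem_cat inE => /or3P[|/eqP->//|/sYy/gy[]//].
  exact: xg.
have /choice[phi phiP] u : exists C, u \in P -> C \in good_classes n /\ spec C (ext (sp u.1) u.2).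
  have [/extP[C Cg Cs]|_] := boolP (u \in P); first by exists C.
  by exists finset.set0.
have cP : count_le (fun u => u \in P) (#|good_classes n| * 'C(N, l)).
  apply: (count_le_fib (g := phi) (Q := fun C => C \in good_classes n)).
  - by move=> u /phiP[].
  - exact: count_le_set.
  move=> C /good_classesP[Cu _]; have [sC CsC] := spec_exists Cu.
  pose Z := [set i : 'I_S | nth empty_type y i \in sC]%SET.
  have ZN : #|Z| <= N.
    rewrite /N leq_divRL // -(spec_total Cu CsC) (leq_trans (tsY' Z)) //.
    by apply: total_sub => // _ /mapP[i + ->]; rewrite mem_enum inE.
  have ZC : 'C(#|Z|, l) <= 'C(N, l) by apply: leq_bin2l.
  apply: (count_leW ZC (fun u => id)).
  rewrite -cards_draws; apply: (count_le_inj (g := snd)) (count_le_set _).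
    move=> [x Y] [xYP phE]; have [_ Cs] := phiP _ xYP; rewrite phE in Cs.
    rewrite inE /=; move: xYP; rewrite inP => /andP[_ ->].
    rewrite andbT; apply/fintype.subsetP => i iY; rewrite inE.
    rewrite -(perm_mem (spec_uniq Cu Cs CsC)) mem_cat inE; apply/or3P/Or33.
    by apply: map_f; rewrite mem_enum.
  move=> [x Y] [x' Y'] [xP phx] [xP' phx'] /= YY'; rewrite -YY' in xP' phx' *.
  have [_ Cs] := phiP _ xP; have [_ Cs'] := phiP _ xP'; rewrite phx in Cs; rewrite phx' in Cs'.
  have := spec_uniq Cu Cs Cs'; rewrite /= perm_cat2r => ss.
  move: xP xP'; rewrite !inP => /andP[/good_classesP[xu _] _].
  move=> /andP[/good_classesP[xu' _] _].
  by congr pair; apply: spec_perm (spP _ xu) (spP _ xu') ss.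
have := count_le_card cP; rewrite cardsX card_draws card_ord => le.
have lN : l <= N.
  by rewrite leq_divRL //; move: lk; rewrite -muln2; nia.
have b0 : 0 < 'C(N, l) by rewrite bin_gt0.
rewrite -(leq_pmul2r b0); apply: leq_trans le.
rewrite mulnAC mulnC leq_mul2l; apply/orP; right.
exact: bin_double.
Qed.

End Classes.

(** * Few graphs have many vertices in bad components *)

Section Multisets.

Lemma size_le_total s : (forall t : gtype, t \in s -> 0 < tag t) -> size s <= total s.
Proof.
elim: s => //= t s IH H; rewrite /total /= -/(total s) -add1n leq_add //.
  by apply: H; apply: mem_head.
by apply: IH => u us; apply: H; rewrite inE us orbT.
Qed.

Lemma count_multisets (Bad : gtype -> Prop) b1 b2 tau m : 0 < tau ->
  (forall t, Bad t -> 0 < tag t) ->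
  count_le (fun t => Bad t /\ tag t <= tau) b1 -> count_le Bad b2 ->
  exists beta : seq gtype -> nat,
    (forall s, (forall t, t \in s -> Bad t) -> total s <= m ->
       beta s < m.+1 ^ b1 * b2.+1 ^ (m %/ tau)) /\
    (forall s s', (forall t, t \in s -> Bad t) -> (forall t, t \in s' -> Bad t) ->
       total s <= m -> total s' <= m -> beta s = beta s' -> perm_eq s s').
Proof.
move=> tau0 Bpos [f1 [f1b f1i]] [f2 [f2b f2i]]; set q := m %/ tau.
pose small (i : nat) (s : seq gtype) := count (fun t => (tag t <= tau) && (f1 t == i)) s.
pose sm (s : seq gtype) : {ffun 'I_b1 -> 'I_m.+1} := [ffun i : 'I_b1 => inord (small i s)].
pose lg (s : seq gtype) := [seq f2 t | t <- s & tau < tag t].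
pose pad s := sort leq (lg s) ++ nseq (q - size (lg s)) b2.
have lgq s : total s <= m -> size (lg s) <= q.
  move=> sm_; rewrite /q leq_divRL //; apply: leq_trans sm_.
  rewrite size_map size_filter; elim: s => //= t s IH; rewrite /total /= -/(total s).
  by rewrite mulnDl leq_add //; case: ltnP => // /ltnW; rewrite mul1n.
have c1 := count_le_fin {ffun 'I_b1 -> 'I_m.+1}.
have c2 : count_le (fun x => x < b2.+1) b2.+1 by exists id.
have [gam [gamb gami]] := count_le_pair c1 (count_le_seq q c2).
have padP s : (forall t, t \in s -> Bad t) -> total s <= m ->
    True /\ (size (pad s) = q /\ forall x, x \in pad s -> x < b2.+1).
  move=> sB sm_; split=> //; split.
    by rewrite size_cat size_sort size_nseq subnKC // lgq.
  move=> x; rewrite mem_cat mem_sort => /orP[/mapP[t]|/nseqP[->]//].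
  by rewrite mem_filter => /andP[_ /sB/f2b] + ->; apply: leqW.
exists (fun s => gam (sm s, pad s)); split=> [s sB sm_|s s' sB sB' sm_ sm_'].
  have := gamb (sm s, pad s) (padP s sB sm_).
  by rewrite card_ffun !card_ord.
move/gami => /(_ (padP s sB sm_) (padP s' sB' sm_'))[smE padE].
have unpad u : (forall t, t \in u -> Bad t) -> [seq x <- pad u | x < b2] = sort leq (lg u).
  move=> uB; rewrite filter_cat (_ : [seq x <- nseq (q - size (lg u)) b2 | x < b2] = [::]) ?cats0.
    apply/all_filterP/allP => x; rewrite mem_sort => /mapP[t].
    by rewrite mem_filter => /andP[_ /uB/f2b] + ->.
  by elim: (q - _) => //= j ->; rewrite ltnn.
have lgE : perm_eq (lg s) (lg s').
  by rewrite -(perm_sort leq) -unpad // padE unpad // perm_sort.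
apply/allP => t; rewrite mem_cat => tss /=.
have tB : Bad t by case/orP: tss => [/sB|/sB'].
case: (leqP (tag t) tau) => tt.
  have E u : (forall t, t \in u -> Bad t) -> count_mem t u = small (f1 t) u.
    move=> uB; apply: eq_in_count => x xu /=; apply/eqP/andP => [->//|[xt /eqP fx]].
    by apply: f1i => //; split=> //; apply: uB.
  rewrite !E //; have t1 : f1 t < b1 by apply: f1b.
  have := congr1 (fun f : {ffun _ -> _} => val (f (Ordinal t1))) smE; rewrite !ffunE /=.
  have le u : (forall t, t \in u -> Bad t) -> total u <= m -> small (f1 t) u < m.+1.
    move=> uB um; rewrite ltnS (leq_trans (count_size _ _)) // (leq_trans _ um) //.
    by apply: size_le_total => x /uB/Bpos.
  by rewrite !inordK ?le // => ->.
have E u : (forall t, t \in u -> Bad t) -> count_mem t u = count_mem (f2 t) (lg u).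
  move=> uB; rewrite count_map count_filter; apply: eq_in_count => x xu /=.
  apply/eqP/andP => [->|[/eqP fx _]]; first by rewrite eqxx.
  by apply: f2i => //; apply: uB.
by rewrite !E //; move/seq.permP: lgE => ->.
Qed.

End Multisets.

Section Upper.
Variables (k r R : nat).
Local Notation d := k.+1.

Definition is_good (t : gtype) : bool := `[< good_type d R t >].

Definition bad_part (s : seq gtype) := [seq t <- s | ~~ is_good t].

Definition bad_classes n m : {set {set lgraph n}} :=
  [set C in unlabelled n | `[< exists2 s, spec C s &
     (forall t, t \in s -> charted d r (gr t)) /\ total (bad_part s) = m >]]%SET.

(* A multiset of bad types of total size [m] is given by the multiplicities of the at most [b1]
   types of size at most [tau] and a list of at most [m %/ tau] larger ones. *)
Lemma bad_classes_bound n m tau b1 b2 : 0 < tau -> m <= n ->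
  count_le (badtype k r R tau) b1 -> count_le (badtype k r R n) b2 ->
  #|bad_classes n m| <= #|good_classes d R (n - m)| * (m.+1 ^ b1 * b2.+1 ^ (m %/ tau)).
Proof.
move=> tau0 mn c1 c2.
have [||beta [betab betai]] := @count_multisets (badtype k r R n) b1 b2 tau m tau0 _ _ c2.
- by move=> t [_ _ /andP[]].
- by apply: count_leW c1 => // t [[? ? /andP[t0 _] ? ?] tt]; split=> //; rewrite t0.
have /choice[sp spP] (C : {set lgraph n}) : exists s, C \in bad_classes n m ->
    [/\ C \in unlabelled n, spec C s, forall t, t \in bad_part s -> badtype k r R n t &
        total (bad_part s) = m].
  have [|_] := boolP (C \in bad_classes n m); last by exists [::].
  rewrite inE => /andP[Cu /asboolP[s ss [sch sm]]]; exists s => _; split=> // t.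
  rewrite mem_filter => /andP[/asboolPn ng ts]; have [ps _] := ss.
  have [ct conn t0] := ps t ts; split=> //; [rewrite t0 /=|exact: sch|].
    rewrite -(spec_total Cu ss); have := @total_sub [:: t] s isT _.
    by rewrite /total /= addn0; apply=> x; rewrite inE => /eqP->.
  by move=> a ga; apply: ng; exists a.
have gp C : C \in bad_classes n m -> exists2 D, D \in good_classes d R (n - m) &
    spec D [seq t <- sp C | is_good t].
  move=> CB; have [Cu ss sb sm] := spP C CB; have [ps _] := ss.
  have tot : total [seq t <- sp C | is_good t] = n - m.
    have := spec_total Cu ss; rewrite -(total_perm (permEl (perm_filterC is_good (sp C)))).
    by rewrite total_cat -/(bad_part _) sm => <-; rewrite addnK.
  have pg : proper [seq t <- sp C | is_good t].
    by move=> t; rewrite mem_filter => /andP[_ /ps].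
  have [D Du Ds] := spec_realize pg tot; exists D => //.
  apply/good_classesP; split=> // s' ss' t; rewrite -(perm_mem (spec_uniq Du Ds ss')).
  by rewrite mem_filter => /andP[/asboolP].
have /choice[g gP] C : exists D, C \in bad_classes n m ->
    D \in good_classes d R (n - m) /\ spec D [seq t <- sp C | is_good t].
  have [/gp[D Dg Ds]|_] := boolP (C \in bad_classes n m); first by exists D.
  by exists finset.set0.
apply: count_le_card; apply: (count_le_fib (g := g) _ (count_le_set _)).
  by move=> C /gP[].
move=> D /good_classesP[Du _]; exists (fun C => beta (bad_part (sp C))).
split=> [C [CB _]|C C' [CB gC] [CB' gC'] bE].
  by have [_ _ sb sm] := spP C CB; apply: betab => //; rewrite sm.
have [Cu ss sb sm] := spP C CB; have [Cu' ss' sb' sm'] := spP C' CB'.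
have [_ D1] := gP C CB; have [_ D2] := gP C' CB'; rewrite gC in D1; rewrite gC' in D2.
have e1 := spec_uniq Du D1 D2.
have e2 : perm_eq (bad_part (sp C)) (bad_part (sp C')).
  by apply: betai bE => //; rewrite ?sm ?sm'.
apply: (spec_perm Cu Cu' ss ss').
rewrite -(permPl (permEl (perm_filterC is_good (sp C)))).
rewrite -(permPr (permEl (perm_filterC is_good (sp C')))).
exact: perm_cat.
Qed.

End Upper.

(** * Circulant graphs *)

Section Superincreasing.

Lemma weighted_sum_lt (W M n : nat) (a c : nat -> nat) : 0 < W -> 0 < M ->
  \sum_(j < n) a j <= W -> (forall j, j < n -> W * c j < M) -> \sum_(j < n) a j * c j < M.
Proof.
move=> W0 M0 aW cM; rewrite -(ltn_pmul2l W0) big_distrr /=.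
apply: (@leq_ltn_trans (\sum_(j < n) a j * M.-1)); last first.
  rewrite -big_distrl /=; apply: leq_ltn_trans (leq_mul aW (leqnn _)) _.
  by rewrite ltn_pmul2l //; lia.
by apply: leq_sum => j _; rewrite mulnCA leq_mul2l; have := cM j (ltn_ord j); lia.
Qed.

Local Open Scope ring_scope.

Lemma superincreasing (W n : nat) (y : nat -> int) (c : nat -> nat) : (0 < W)%N -> (0 < c 0)%N ->
  (forall i j, (i < j < n)%N -> (W * c i < c j)%N) ->
  (\sum_(j < n) absz (y j) <= W)%N -> \sum_(j < n) y j * (c j)%:Z = 0 ->
  forall j, (j < n)%N -> y j = 0.
Proof.
move=> W0 c0; elim: n => [|n IH] cc yW sum0 j //.
have cn : (0 < c n)%N.
  by case: n cc {IH yW sum0} => [|n] cc //; apply: (leq_ltn_trans _ (cc 0%N n.+1 _)); rewrite ?ltnSn.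
rewrite big_ord_recr /= in sum0.
have lt : (absz (\sum_(j < n) y j * (c j)%:Z)%R < c n)%N.
  apply: leq_ltn_trans (@weighted_sum_lt W (c n) n (fun j => absz (y j)) c W0 cn _ _).
  - elim/big_ind2: _ => // [a b a' b' h h'|i _]; [lia|by rewrite abszM].
  - by apply: leq_trans yW; rewrite big_ord_recr leq_addr.
  - by move=> i iN; apply: cc; rewrite iN /=.
have yn : y n = 0.
  apply/eqP; apply: contraTT lt => yn; rewrite -leqNgt.
  have -> : \sum_(j < n) y j * (c j)%:Z = - (y n * (c n)%:Z) by apply/eqP; rewrite -addr_eq0 sum0.
  by rewrite abszN abszM leq_pmull // absz_gt0.
rewrite ltnS leq_eqVlt => /orP[/eqP->//|]; apply: IH.
- by move=> i i' /andP[ii' i'n]; apply: cc; rewrite ii' ltnW.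
- by apply: leq_trans yW; rewrite big_ord_recr leq_addr.
- by move: sum0; rewrite yn mul0r addr0.
Qed.

End Superincreasing.

Section Circulant.
Local Open Scope ring_scope.
Variables (k R : nat).
Local Notation d := k.+1.
Local Notation Zd := 'rV[int]_d.
Local Notation dir := ('I_d * bool)%type.
Hypothesis k0 : (0 < k)%N.
Hypothesis R2 : (2 <= R)%N.
Let W := R.*2.+1.
Let B := W.+2.

Section Params.
Variables (w m' : nat) (x : {ffun 'I_k -> 'I_w}).
Let m := m'.+1.
Hypothesis w0 : (0 < w)%N.
Hypothesis wm : (B ^ d * w <= m)%N.

Definition digit (i : nat) : nat := if insub i is Some i' then x i' else 0%N.

Lemma digit_lt i : (digit i < w)%N.
Proof. by rewrite /digit; case: insubP => // i' _ _; apply: ltn_ord. Qed.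

(* The steps grow by a factor more than [2R+1], so no nonzero vector of norm at most [2R+1] is
   sent to a multiple of [m] by [hc]; the digits [x] are free. *)
Definition cstep (j : nat) : nat :=
  if j is i.+1 then (B ^ i.+1 * w + digit i)%N else 1%N.

Lemma cstep_gap i j : (i < j < d)%N -> (W * cstep i < cstep j)%N.
Proof.
case: j => // j /andP[ij _]; have le : (B ^ i.+1 * w <= cstep j.+1)%N.
  by apply: leq_trans (leq_addr _ _); rewrite leq_mul2r leq_exp2l //; apply/orP; right.
apply: leq_trans le; case: i {ij} => [|i].
  by rewrite /= expn1 /B; nia.
rewrite [cstep _]/=.
have xw := digit_lt i.
have BW : (W < B ^ i.+1)%N by rewrite (leq_trans (_ : W < B ^ 1)%N) // leq_exp2l.
rewrite [(B ^ i.+2)%N]expnS; move: xw BW; move: (B ^ i.+1)%N (digit i) => b t.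
by rewrite /B; nia.
Qed.

Lemma cstep_lt j : (j < d)%N -> (W * cstep j < m)%N.
Proof.
move=> jd; apply: leq_trans wm; case: j jd => [|j] jd.
  by rewrite /= muln1 expnS; have := expn_gt0 B k; rewrite /B; nia.
rewrite [cstep _]/=.
have xw := digit_lt j.
have BW : (W < B ^ j.+1)%N by rewrite (leq_trans (_ : W < B ^ 1)%N) // leq_exp2l.
have le : (B * B ^ j.+1 <= B ^ d)%N by rewrite -expnS leq_exp2l.
apply: (@leq_trans (B * B ^ j.+1 * w)); last by rewrite leq_mul2r le orbT.
move: xw BW {le}; move: (B ^ j.+1)%N (digit j) => b t.
by rewrite /B; nia.
Qed.

Definition hc (y : Zd) : int := \sum_(j < d) y 0 j * (cstep j)%:Z.

Lemma hcD y z : hc (y + z) = hc y + hc z.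
Proof. by rewrite /hc -big_split; apply: eq_bigr => j _; rewrite mxE mulrDl. Qed.

Lemma hcN y : hc (- y) = - hc y.
Proof. by rewrite /hc -sumrN; apply: eq_bigr => j _; rewrite mxE mulNr. Qed.

Lemma hc_short y : (nrm y <= W)%N -> (m%:Z %| hc y)%Z -> y = 0.
Proof.
move=> yW my; pose yn (j : nat) := if insub j is Some j' then y 0 (j' : 'I_d) else 0.
have ynE (j : 'I_d) : yn j = y 0 j by rewrite /yn valK.
have W0 : (0 < W)%N by [].
have sumW : (\sum_(j < d) absz (yn j) <= W)%N.
  by apply: leq_trans yW; rewrite leq_eqVlt; apply/orP; left; apply/eqP;
     apply: eq_bigr => j _; rewrite ynE.
have hcE : hc y = \sum_(j < d) yn j * (cstep j)%:Z.
  by apply: eq_bigr => j _; rewrite ynE.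
have lt : (absz (hc y) < m)%N.
  apply: leq_ltn_trans (@weighted_sum_lt W m d (fun j => absz (yn j)) cstep W0 _ sumW _) => //.
    rewrite hcE; elim/big_ind2: _ => // [a b a' b' h h'|i _]; [lia|by rewrite abszM].
  exact: cstep_lt.
have hc0 : hc y = 0.
  apply/eqP; rewrite -absz_eq0; move: my; rewrite dvdzE /= => my.
  by apply: contraTT lt; rewrite -lt0n -leqNgt => h0; apply: dvdn_leq.
have := @superincreasing W d yn cstep W0 isT cstep_gap sumW; rewrite -hcE => /(_ hc0) H.
by apply/rowP => j; rewrite mxE -ynE; apply: H.
Qed.

Definition circ_rel : rel 'I_m := fun a b =>
  [exists f : dir, (m%:Z %| (b : nat)%:Z - (a : nat)%:Z - hc (dv f))%Z].

Lemma circ_sym : symmetric circ_rel.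
Proof.
have H a b : circ_rel a b -> circ_rel b a.
  move=> /existsP[f ab]; apply/existsP; exists (opp f).
  rewrite dv_opp hcN (_ : _ - - _ = - ((b : nat)%:Z - (a : nat)%:Z - hc (dv f))); last by ring.
  by rewrite dvdzE abszN -dvdzE.
by move=> a b; apply/idP/idP; apply: H.
Qed.

Lemma circ_irr : irreflexive circ_rel.
Proof.
move=> a; apply/negbTE/negP => /existsP[f]; rewrite subrr sub0r -hcN => /hc_short.
rewrite nrmN nrm_dv => /(_ isT)/(congr1 (@nrm d)).
by rewrite nrmN nrm_dv nrm0.
Qed.

Definition circulant : sgraph := SGraph circ_sym circ_irr.

Definition cproj (y : Zd) : circulant := inord (absz (hc y %% m%:Z)%Z) : 'I_m.

Lemma cprojE y : ((cproj y : 'I_m) : nat)%:Z = (hc y %% m%:Z)%Z.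
Proof.
have h1 := modz_ge0 (hc y) (erefl : m%:Z != 0); have h2 := ltz_pmod (hc y) (erefl : 0 < m%:Z).
by rewrite inordK; lia.
Qed.

Lemma cproj_eq y z : cproj y = cproj z <-> (m%:Z %| hc (y - z))%Z.
Proof.
rewrite hcD hcN -eqz_mod_dvd; split=> [E|/eqP E]; first by rewrite -!cprojE E.
by apply: val_inj; apply/eqP; rewrite -eqz_nat /= !cprojE E.
Qed.

Lemma cproj_adj y (b : circulant) : adj circulant (cproj y) b <-> exists f, b = cproj (y + dv f).
Proof.
have H f : (m%:Z %| ((b : 'I_m) : nat)%:Z - ((cproj y : 'I_m) : nat)%:Z - hc (dv f))%Z <->
    b = cproj (y + dv f).
  have bm : (((b : 'I_m) : nat)%:Z %% m%:Z)%Z = ((b : 'I_m) : nat)%:Z.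
    by apply: modz_small; have := ltn_ord (b : 'I_m); lia.
  rewrite cprojE -addrA -opprD -eqz_mod_dvd modzDml -hcD bm -cprojE eqz_nat.
  by split=> [/eqP/val_inj|->].
split=> [/existsP[f /H ->]|[f /H E]]; [by exists f|by apply/existsP; exists f].
Qed.

Lemma cproj_tcover : tcover R cproj.
Proof.
split=> [y|y z u /cproj_eq E|l /cproj_eq].
- split=> [e|e f /cproj_eq E|b /cproj_adj//]; first by apply/cproj_adj; exists e.
  apply/dv_inj/eqP; rewrite -subr_eq0; apply/eqP/hc_short.
    by rewrite (leq_trans (nrmD _ _)) // nrmN !nrm_dv /W; lia.
  by move: E; rewrite opprD addrACA subrr add0r.
- by apply/cproj_eq; rewrite opprD addrACA subrr addr0.
- by rewrite subr0 => ml lW; apply: hc_short.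
Qed.

Lemma hc_unit (a : nat) : hc (a%:Z *: delta_mx 0 ord0) = a%:Z.
Proof.
rewrite /hc (bigD1 ord0) //= big1 => [|j j0]; first by rewrite !mxE !eqxx !mulr1 addr0.
by rewrite !mxE (negbTE j0) mulr0 mul0r.
Qed.

Lemma cproj_surj (b : circulant) : exists y, cproj y = b.
Proof.
exists (((b : 'I_m) : nat)%:Z *: delta_mx 0 ord0); apply: val_inj; apply/eqP.
rewrite -eqz_nat /= cprojE hc_unit; apply/eqP/modz_small.
by have := ltn_ord (b : 'I_m); lia.
Qed.

Lemma circulant_connected : connected_graph circulant.
Proof.
move=> a b; have [y <-] := cproj_surj a; have [z <-] := cproj_surj b.
exists (nrm (z - y)); have [N _ _] := cproj_tcover.
have := @dist_le_walk d circulant (fun u => cproj (y + u)) (nrm (z - y)) _ (z - y) (leqnn _).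
rewrite /= addr0 [y + (z - y)]addrC subrK; apply=> u e _; rewrite addrA.
by have [A _ _] := N (y + u).
Qed.

Lemma circulant_realizable : realizable circulant.
Proof. by apply: (@realizable_inj circulant m (fun v => v)) => ? ?. Qed.

Definition circ_type : gtype := canon circulant.

Lemma tag_circ : tag circ_type = m.
Proof.
have [f [fb _]] := canon_iso circulant_realizable.
by have := bij_eq_card fb; rewrite !card_ord.
Qed.

Lemma circ_proper : proper_type circ_type.
Proof.
split; last by rewrite tag_circ.
  exact: canonK circulant_realizable.
exact: connected_iso (canon_iso circulant_realizable) circulant_connected.
Qed.

Lemma iso_embedding (G H : sgraph) (f : G -> H) : is_iso f -> embedding f.
Proof.
move=> [[g fK gK] hom]; split=> // [|y b _]; first exact: can_inj fK.
by exists (g b); rewrite gK.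
Qed.

Lemma circ_model (a : gr circ_type) : exists q : Zd -> gr circ_type,
  [/\ q 0 = a, tcover R q & forall y z, q y = q z <-> (m%:Z %| hc (y - z))%Z].
Proof.
have [f fi] := canon_iso circulant_realizable; have fe := iso_embedding fi.
have [[g fK gK] _] := fi; have [y0 y0E] := cproj_surj (g a).
have [N _ _] := cproj_tcover.
have ker y z : f (cproj (y0 + y)) = f (cproj (y0 + z)) <-> (m%:Z %| hc (y - z))%Z.
  have E : y0 + y - (y0 + z) = y - z by rewrite opprD addrACA subrr add0r.
  split=> [/(can_inj fK)/cproj_eq|yz]; first by rewrite E.
  by congr f; apply/cproj_eq; rewrite E.
exists (fun y => f (cproj (y0 + y))); split=> //; first by rewrite addr0 y0E gK.
exact: tcover_embedding fe (tcover_shift _ cproj_tcover).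
Qed.

Lemma circ_good : good_type d R circ_type.
Proof.
have [f fi] := canon_iso circulant_realizable.
exists (f (cproj 0)); apply: good_at_embedding (iso_embedding fi) _.
by exists cproj; split=> //; apply: cproj_tcover.
Qed.

End Params.

Lemma circ_count w m' t (w0 : (0 < w)%N) (wm : (B ^ d * w <= m'.+1)%N) :
  count_le (fun x : {ffun 'I_k -> 'I_w} => circ_type x w0 wm = t) #|{ffun dir -> dir}|.
Proof.
have [[x0 tE]|nx] := pselect (exists x : {ffun 'I_k -> 'I_w}, circ_type x w0 wm = t);
  last by exists (fun=> 0%N); split=> [x xt|x y xt]; case: nx; exists x.
have a0 : gr t by rewrite -tE /gr /= tag_circ; exact: ord0.
have model x (a : gr t) : circ_type x w0 wm = t -> exists q : Zd -> gr t,
    [/\ q 0 = a, tcover R q & forall y z, q y = q z <-> (m'.+1%:Z %| hc x (y - z))%Z].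
  by move=> xt; move: a; rewrite -xt => a; apply: circ_model.
have sq : sq_uniq (gr t).
  apply: (@chart_sq_uniq d) => v; have [q [q0 tq _]] := model x0 v tE.
  by exists q; split=> //; apply: tcover_chart tq _ _.
have /choice[q qE] x : exists q : Zd -> gr t, circ_type x w0 wm = t ->
    [/\ q 0 = a0, tcover R q & forall y z, q y = q z <-> (m'.+1%:Z %| hc x (y - z))%Z].
  have [/(model x a0)[q qP]|nt] := pselect (circ_type x w0 wm = t); first by exists q.
  by exists (fun=> a0) => /nt.
have [q00 [N0 _ _] _] := qE x0 tE.
have /choice[pi piE] x : exists f : {ffun dir -> dir}, circ_type x w0 wm = t ->
    forall e, q x (dv e) = q x0 (dv (f e)).
  have [xt|nt] := pselect (circ_type x w0 wm = t); last by exists [ffun e => e] => /nt.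
  have [qx0 [Nx _ _] _] := qE x xt; have [A _ _] := Nx 0; have [_ _ S] := N0 0.
  have /choice[f fE] e : exists e', q x (dv e) = q x0 (dv e').
    have := S (q x (0 + dv e)); rewrite q00 -qx0 => /(_ (A e))[e'].
    by rewrite !add0r => ->; exists e'.
  by exists (finfun f) => _ e; rewrite ffunE.
apply: (count_le_inj (g := pi)) (count_le_fin _) => // x x' xt xt' pE.
have [qx0 [Nx _ _] kx] := qE x xt; have [qx0' [Nx' _ _] kx'] := qE x' xt'.
have qq y : q x y = q x' y.
  have ag : agree (q x) 0 (q x') 0.
    by split=> [|e]; rewrite ?qx0 ?qx0' // !add0r (piE x xt) (piE x' xt') pE.
  by have [+ _] := nbr_agree sq Nx Nx' ag y; rewrite !add0r.
apply/ffunP => j; pose j' : 'I_d := lift ord0 j.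
pose z : Zd := delta_mx 0 j' - (cstep x j')%:Z *: delta_mx 0 ord0.
have hcz (u : {ffun 'I_k -> 'I_w}) : hc u z = (cstep u j')%:Z - (cstep x j')%:Z.
  rewrite hcD hcN hc_unit; congr (_ - _); rewrite /hc (bigD1 j') //= big1 => [|i ij].
    by rewrite mxE !eqxx mul1r addr0.
  by rewrite mxE (negbTE ij) mul0r.
have : q x z = q x 0 by apply/kx; rewrite subr0 hcz subrr dvdz0.
rewrite !qq => /kx'; rewrite subr0 hcz => dv.
have lt (u : {ffun 'I_k -> 'I_w}) : (cstep u j' < m'.+1)%N.
  by have := cstep_lt u w0 wm (ltn_ord j'); rewrite /W; nia.
have cE : cstep x' j' = cstep x j'.
  have {}dv : (m'.+1 %| absz ((cstep x' j')%:Z - (cstep x j')%:Z)%R)%N := dv.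
  move: (lt x) (lt x') dv; move: (cstep x j') (cstep x' j') => a b l1 l2.
  by have [-> //|ab] := eqVneq b a => /dvdn_leq; lia.
move: cE; rewrite /j' /= => /addnI; rewrite add0n /digit !valK => /val_inj//.
Qed.

Definition circ_const := #|{ffun dir -> dir}|.

Lemma circ_family sz : (B ^ d <= sz)%N -> exists y : seq gtype,
  [/\ uniq y, proper y,
      forall t, t \in y -> good_type d R t /\ (sz <= tag t < sz.*2)%N &
      (sz * (sz %/ B ^ d) ^ k <= size y * circ_const)%N].
Proof.
move=> Bsz; set w := (sz %/ B ^ d)%N.
have B0 : (0 < B ^ d)%N by rewrite expn_gt0.
have w0 : (0 < w)%N by rewrite divn_gt0.
have wsz : (B ^ d * w <= sz)%N by rewrite mulnC leq_trunc_div.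
have sz0 : (0 < sz)%N by apply: leq_trans B0 Bsz.
have wm i : (B ^ d * w <= (sz + i).-1.+1)%N by rewrite prednK; lia.
pose T (u : 'I_sz * {ffun 'I_k -> 'I_w}) := circ_type u.2 w0 (wm u.1).
have tagT u : tag (T u) = (sz + u.1)%N by rewrite tag_circ // prednK; lia.
exists (undup [seq T u | u : 'I_sz * {ffun 'I_k -> 'I_w}]); split.
- exact: undup_uniq.
- by move=> t; rewrite mem_undup => /mapP[u _ ->]; apply: circ_proper.
- move=> t; rewrite mem_undup => /mapP[u _ ->]; split; first exact: circ_good.
  by rewrite tagT leq_addr -addnn ltn_add2l ltn_ord.
set y := undup _.
have cy : count_le (fun t => t \in y) (size y).
  exists (index^~ y); split=> [t|t t' ty t'y]; first by rewrite index_mem.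
  by move=> E; rewrite -(nth_index empty_type ty) E nth_index.
have : count_le (fun u => u \in [set: 'I_sz * {ffun 'I_k -> 'I_w}]%SET) (size y * circ_const).
  apply: (count_le_fib (g := T) _ cy) => [u _|t ty].
    by rewrite mem_undup map_f // mem_enum.
  have [[u0 u0t]|nt] := pselect (exists u, T u = t); last first.
    by exists (fun=> 0%N); split=> [u [_ ut]|u u' [_ ut]]; case: nt; exists u.
  apply: (count_le_inj (g := snd)) (circ_count t w0 (wm u0.1)).
    move=> [i x] [_ ut]; have iE : i = u0.1.
      apply: val_inj; apply: (@addnI sz); rewrite -(tagT (i, x)) -tagT ut u0t //.
    by rewrite -iE.
  move=> [i x] [i' x'] [_ ut] [_ ut'] /= ->; congr pair.
  by apply: val_inj; apply: (@addnI sz); rewrite -(tagT (i, x)) -(tagT (i', x')) ut ut'.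
by move/count_le_card; rewrite cardsT card_prod card_ffun !card_ord.
Qed.

Lemma circ_filler : exists F : nat -> gtype, forall j, (B ^ d <= j)%N ->
  [/\ proper_type (F j), good_type d R (F j) & tag (F j) = j].
Proof.
suff /choice[F FP] j : exists t, (B ^ d <= j)%N ->
    [/\ proper_type t, good_type d R t & tag t = j] by exists F.
have [Bj|_] := boolP (B ^ d <= j)%N; last by exists empty_type.
have j0 : (0 < j)%N by apply: leq_trans Bj; rewrite expn_gt0.
have wm : (B ^ d * 1 <= j.-1.+1)%N by rewrite muln1 prednK.
exists (circ_type [ffun _ : 'I_k => ord0] (erefl : 0 < 1)%N wm) => _; split.
- exact: circ_proper.
- exact: circ_good.
- by rewrite tag_circ prednK.
Qed.

End Circulant.

(** * Asymptotics *)

Section Growth.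

Lemma poly_le_exp c e : exists v0, forall v, v0 <= v -> c * v ^ e <= 2 ^ v.
Proof.
exists (e.+1 * (c * e.+1 ^ e)) => v ve; pose w := v %/ e.+1.
have wv : w * e.+1 <= v by apply: leq_trunc_div.
have vw : v <= e.+1 * w.+1.
  by rewrite mulnC mulSn [v](divn_eq _ e.+1) -/w addnC leq_add2r ltnW ?ltn_pmod.
have cw : c * e.+1 ^ e <= 2 ^ w.
  by rewrite ltnW // (leq_ltn_trans _ (ltn_expl w (erefl : 1 < 2))) // leq_divRL // mulnC.
apply: (@leq_trans (2 ^ (w * e.+1))); last by rewrite leq_exp2l.
rewrite mulnS expnD expnM; apply: (@leq_trans (c * (e.+1 * w.+1) ^ e)).
  by rewrite leq_mul2l; case: (e) vw => [|e'] vw; rewrite ?expn0 ?orbT // leq_exp2r // vw orbT.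
rewrite expnMn mulnA leq_mul //.
by case: (e) => // e'; rewrite leq_exp2r // ltn_expl.
Qed.

Lemma polylog_le c e : exists u0, forall u, u0 <= u -> c * (trunc_log 2 u).+1 ^ e <= u.
Proof.
have [v0 v0P] := poly_le_exp (c * 2) e; exists (2 ^ v0) => u u0.
have up : 0 < u by apply: leq_trans u0; rewrite expn_gt0.
have [] := andP (trunc_log_bounds (erefl : 1 < 2) up).
move: (trunc_log_max (erefl : 1 < 2) u0) => lv le _.
have := v0P (trunc_log 2 u).+1 (leqW lv); rewrite expnS mulnAC [2 * _]mulnC leq_mul2r /=.
by move=> h; apply: leq_trans le.
Qed.

Lemma root_exists q n : 0 < q -> exists u, u ^ q <= n < u.+1 ^ q.
Proof.
move=> q0; have exP : exists u, n < u.+1 ^ q.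
  by exists n; apply: leq_trans (ltnSn n) _; rewrite -{1}(expn1 n.+1) leq_pexp2l.
case: (ex_minnP exP) => u un umin; exists u; rewrite un andbT.
case: u umin {un} => [|u] umin; first by rewrite exp0n.
by rewrite leqNgt; apply/negP => /umin; rewrite ltnn.
Qed.

Lemma leq_double_divn a b : 0 < b <= a -> a <= 2 * b * (a %/ b).
Proof.
move=> /andP[b0 ba]; have q0 : 0 < a %/ b by rewrite divn_gt0.
rewrite {1}(divn_eq a b) -mulnA mul2n -addnn [b * _]mulnC leq_add2l.
by apply: leq_trans (ltnW (ltn_pmod a b0)) _; apply: leq_pmull.
Qed.

Variables (k D Bd C j0 : nat).
Let q0 := k.*2 + 5.
Let Q := k.+2 * q0.

Lemma parameters_exist : 0 < k -> 0 < Bd ->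
  exists u0, forall n u, u0 <= u -> u ^ Q <= n < u.+1 ^ Q ->
  exists sz tau, [/\ Bd <= sz, 0 < tau,
    2 * D * (n %/ sz) <= sz * (sz %/ Bd) ^ k &
    forall m, u ^ Q.-1 <= m <= n ->
      j0 <= m /\ n ^ 2 * (m.+1 ^ (C * growth k tau) * (C * growth k n).+1 ^ (m %/ tau))
        <= 2 ^ ((m - j0) %/ sz.*2)].
Proof.
move=> k0 Bd0; pose c1 := 2 * D * 2 ^ Q * (2 * Bd) ^ k; pose c2 := C + 3 * k + 1.
pose c3 := 16 + 8 * c2 + 8 * C.
have [u1 u1P] := polylog_le (c3 * Q ^ (k.*2.+1)) k.*2.+1.
exists (u1 + c1 + Bd + 4 * j0 + 2) => n u u0 /andP[un nu].
have ubig : 1 < u by lia.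
have up : 0 < u by lia.
have qpos : 0 < Q by rewrite /Q /q0 muln_gt0 addn_gt0 orbT.
pose sz := u ^ q0.+1; pose tau := u ^ q0.+2; exists sz, tau.
have szB : Bd <= sz.
  by apply: (@leq_trans (u ^ 1)); [rewrite expn1; lia|rewrite leq_exp2l].
pose l := (trunc_log 2 n).+1.
have n0 : 0 < n by apply: leq_trans un; rewrite expn_gt0 up.
have nl : n < 2 ^ l by apply: trunc_log_ltn.
have lu : l <= Q * (trunc_log 2 u).+1.
  rewrite -(ltn_exp2l _ _ (erefl : 1 < 2)) (leq_ltn_trans (trunc_logP _ n0)) //.
  apply: leq_trans nu _; rewrite mulnC expnM leq_exp2r //.
  exact: trunc_log_ltn.
have polyl : c3 * l ^ k.*2.+1 <= u.
  apply: leq_trans (u1P u _); last by lia.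
  by rewrite -mulnA -expnMn leq_mul2l leq_exp2r // lu orbT.
have l1 : l <= l ^ k.*2.+1 by rewrite -{1}(expn1 l) leq_pexp2l.
have QE : Q.-1 = k * q0.+2 + q0.+1 + 3 by rewrite /Q /q0; nia.
have QE1 : Q = k * q0 + q0.-1 + q0.+1 by rewrite /Q /q0; nia.
have q00 : 0 < q0 by rewrite /q0 addn_gt0 orbT.
have mono a b : a <= b -> u ^ a <= u ^ b by move=> ab; rewrite leq_exp2l.
split=> //.
- by rewrite expn_gt0 up.
- have B0 : 0 < (2 * Bd) ^ k by rewrite expn_gt0 muln_gt0 Bd0.
  rewrite -(leq_pmul2r B0).
  have nsz : n %/ sz <= 2 ^ Q * u ^ (k * q0 + q0.-1).
    rewrite -ltnS ltn_divLR ?expn_gt0 ?up //; apply: leq_trans nu _.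
    apply: leq_trans (_ : (2 * u) ^ Q <= _); first by rewrite leq_exp2r //; lia.
    rewrite expnMn {2}QE1 expnD mulnA leq_mul2r; apply/orP; right.
    exact: leqnSn.
  apply: (@leq_trans (c1 * u ^ (k * q0 + q0.-1))).
    rewrite /c1; move: nsz; move: (2 ^ Q) (u ^ _) ((2 * Bd) ^ k) => b x c nsz.
    rewrite -[2 * D * b * c * x]mulnA [c * x]mulnC mulnA leq_mul2r -[2 * D * b * x]mulnA.
    by rewrite leq_mul2l nsz !orbT.
  apply: (@leq_trans (u ^ (k * q0 + q0.-1).+1)).
    by rewrite expnS leq_mul2r; apply/orP; right; lia.
  apply: (@leq_trans (sz * sz ^ k)).
    by rewrite -expnS -expnM; apply: mono; rewrite mulnS mulSn [q0 * k]mulnC; lia.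
  rewrite -mulnA leq_mul2l; apply/orP; right; rewrite -expnMn leq_exp2r //.
  by rewrite mulnC leq_double_divn // Bd0.
move=> m /andP[um mn].
have uQ : u <= u ^ Q.-1 by rewrite -{1}(expn1 u); apply: mono; rewrite QE; lia.
have j0m : 4 * j0 <= m by lia.
have j0le : j0 <= m by apply: leq_trans j0m; apply: leq_pmull.
split=> //.
have tn : tau <= n by apply: leq_trans un; apply: mono; rewrite QE1; lia.
have lk : 0 < l ^ k.*2.+1 by rewrite expn_gt0.
set g := C * (tau ^ k * l ^ k.*2); set M := m %/ tau.
have gt : C * growth k tau <= g.
  rewrite /growth leq_mul2l leq_mul2l addnn; apply/orP; right; apply/orP; right.
  by rewrite leq_exp2r ?double_gt0 // ltnS leq_trunc_log.
have gn : (C * growth k n).+1 <= 2 ^ (c2 * l).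
  have h1 : C <= 2 ^ (C * l) by rewrite ltnW // (leq_ltn_trans _ (ltn_expl _ _)) // leq_pmulr.
  have h2 : n ^ k <= 2 ^ (k * l) by rewrite mulnC expnM leq_exp2r // ltnW.
  have h3 : l ^ (k + k) <= 2 ^ (2 * k * l).
    by rewrite mul2n -addnn mulnC expnM leq_exp2r ?addn_gt0 ?k0 // ltnW // ltn_expl.
  have h4 : (2 ^ ((C + 3 * k) * l)).+1 <= 2 ^ (c2 * l).
    have -> : c2 * l = (C + 3 * k) * l + l by rewrite /c2 [LHS]mulnDl mul1n.
    rewrite expnD; apply: (@leq_trans (2 ^ ((C + 3 * k) * l) * 2)).
      by rewrite muln2 -addnn -addn1 leq_add2l expn_gt0.
    by rewrite leq_mul2l (_ : 2 <= 2 ^ l) ?orbT // -[X in X <= _](expn1 2) leq_exp2l.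
  apply: leq_trans h4; rewrite ltnS /growth -/l.
  rewrite (_ : (C + 3 * k) * l = C * l + (k * l + 2 * k * l)); last by ring.
  by rewrite (expnD 2 (C * l)) (expnD 2 (k * l)); apply: leq_mul h1 (leq_mul h2 h3).
have n2 : n ^ 2 <= 2 ^ (2 * l) by rewrite mulnC expnM leq_exp2r // ltnW.
have m1 : m.+1 <= 2 ^ l by apply: leq_ltn_trans nl.
have e1 : m.+1 ^ (C * growth k tau) <= 2 ^ (l * g).
  apply: (@leq_trans (m.+1 ^ g)); first by rewrite leq_pexp2l.
  by rewrite expnM; case: (g) => // g'; rewrite leq_exp2r.
have e2 : (C * growth k n).+1 ^ M <= 2 ^ (c2 * l * M).
  by rewrite expnM; case: (M) => // M'; rewrite leq_exp2r.
apply: (@leq_trans (2 ^ (2 * l + (l * g + c2 * l * M)))).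
  by rewrite (expnD 2 (2 * l)) (expnD 2 (l * g)); apply: leq_mul n2 (leq_mul e1 e2).
rewrite leq_exp2l // leq_divRL ?double_gt0 ?expn_gt0 ?up //.
have tE : tau = u * sz by rewrite /tau expnS.
have pa : 16 * l <= u.
  by apply: leq_trans polyl; apply: leq_mul l1; rewrite /c3 -addnA leq_addr.
have pb : 8 * C * l ^ k.*2.+1 <= u by apply: leq_trans polyl; rewrite leq_mul2r leq_addl orbT.
have pc : 8 * c2 * l <= u.
  by apply: leq_trans polyl; apply: leq_mul l1; rewrite (leq_trans (leq_addl 16 _)) // leq_addr.
have qa : 16 * l * sz <= m.
  apply: (@leq_trans (u * sz)); first by rewrite leq_mul2r pa orbT.
  apply: leq_trans um; rewrite -expnS; apply: mono.
  by rewrite QE -addnA (leq_trans (leq_pmull _ k0)) // leq_addr.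
have qb : 8 * C * l ^ k.*2.+1 * (tau ^ k * sz) <= m.
  apply: (@leq_trans (u * (tau ^ k * sz))); first by rewrite leq_mul2r pb orbT.
  apply: leq_trans um; rewrite /tau /sz -expnM -expnD -expnS; apply: mono.
  by rewrite QE [q0.+2 * _]mulnC -[X in X < _]addn0 ltn_add2l.
have qc : 8 * c2 * l * (M * sz) <= m.
  apply: (@leq_trans (u * (M * sz))); first by rewrite leq_mul2r pc orbT.
  by rewrite mulnCA -tE leq_trunc_div.
have gE : l * g = C * l ^ k.*2.+1 * tau ^ k by rewrite /g expnS; ring.
suff : (2 * l + (l * g + c2 * l * M)) * sz.*2 + j0 <= m by rewrite leq_subRL // addnC.
rewrite -(leq_pmul2l (erefl : 0 < 4)) gE -(muln2 sz).
have ringE a b c e f : 4 * ((2 * l + (C * a * b + c * l * f)) * (e * 2) + j0) =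
    16 * l * e + 8 * C * a * (b * e) + 8 * c * l * (f * e) + 4 * j0 by ring.
rewrite ringE; have -> : 4 * m = m + m + m + m by rewrite !mulSn mul0n addn0 !addnA.
by rewrite !leq_add.
Qed.

End Growth.

Lemma leq_card_bigcup (I T : finType) (P : pred I) (F : I -> {set T}) :
  #|\bigcup_(i | P i) F i| <= \sum_(i | P i) #|F i|.
Proof.
elim/big_rec2: _ => [|i n A _ le]; first by rewrite cards0.
by apply: leq_trans (leq_card_setU _ _) _; rewrite leq_add2l.
Qed.

Section Final.
Variables (k r R : nat).
Local Notation d := k.+1.
Hypothesis k0 : 0 < k.
Hypothesis r2 : 2 <= r.
Hypothesis r3 : 3 <= r \/ d = 2.
Hypothesis dr : d <= r.*2.+1.
Hypothesis rR : r <= R.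

Lemma bad_vertices_le n (G : lgraph n) s : proper s -> decomp (graph_of G) s ->
  #|bad_vertices d R G| <= total (bad_part k R s).
Proof.
move=> ps [c cc]; have [inj ran sur hom] := cc; rewrite cardE -(size_map c).
pose I := [seq i <- iota 0 (size s) | ~~ is_good k R (nth empty_type s i)].
pose L := [seq (i, j) | i <- I, j <- iota 0 (tag (nth empty_type s i))].
have -> : total (bad_part k R s) = size L.
  rewrite size_allpairs_dep /total /bad_part -{1}(mkseq_nth empty_type s) filter_map -map_comp.
  by congr sumn; apply: eq_map => i; rewrite /= size_iota.
apply: uniq_leq_size; first by rewrite map_inj_uniq ?enum_uniq.
move=> _ /mapP[v + ->]; rewrite mem_enum finset.in_set /= => /asboolPn ng.
have [v1 v2] := ran v; rewrite [c v]surjective_pairing; apply: allpairs_f_dep.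
  rewrite mem_filter mem_iota v1 /= andbT; apply/negP => /asboolP gt; apply: ng.
  exact: good_component (good_vertex_type cc ps gt).
by rewrite mem_iota.
Qed.

Lemma in_bad_classes n (C : {set lgraph n}) G : C \in unlabelled n -> G \in C ->
  charted d r (graph_of G) ->
  exists2 m, #|bad_vertices d R G| <= m <= n & C \in bad_classes k r R n m.
Proof.
move=> Cu GC chG; have [s ss] := spec_exists Cu; have [ps ds] := ss.
exists (total (bad_part k R s)).
  rewrite (bad_vertices_le ps (ds G GC)) /= -(spec_total Cu ss).
  by rewrite -(total_perm (permEl (perm_filterC (is_good k R) s))) total_cat leq_addl.
rewrite inE Cu; apply/asboolP; exists s => //; split=> // t ts.
have [c cc] := ds G GC; have it : index t s < size s by rewrite index_mem.
have [f [fe _]] := coords_embedding cc it; rewrite nth_index // in f fe *.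
exact: charted_embedding fe chG.
Qed.

Lemma good_classes_sub n (C : {set lgraph n}) : C \in good_classes d R n ->
  C \in unlabelled_with (fun G : lgraph n => locally_lattice d r (graph_of G)).
Proof.
move=> /good_classesP[Cu gs]; rewrite inE Cu; apply/forall_inP => G GC; apply/asboolP.
have [s ss] := spec_exists Cu; have [ps ds] := ss; have [c cc] := ds G GC.
apply: (tcover_locally rR) => v; apply: (good_vertex_type cc ps).
by apply: gs ss _ _; apply: mem_nth; have [_ ran _ _] := cc; case: (ran v).
Qed.

Let q0 := k.*2 + 5.
Let Q := k.+2 * q0.

Lemma bad_classes_rare : exists n0, forall n, n0 <= n ->
  0 < #|good_classes d R n| /\
  forall u m, u ^ Q <= n < u.+1 ^ Q -> u ^ Q.-1 <= m <= n ->
    n ^ 2 * #|bad_classes k r R n m| <= #|good_classes d R n|.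
Proof.
have R2 : 2 <= R by apply: leq_trans rR.
have [C CP] := count_bad R k0 r2 r3 dr.
pose Bd := (R.*2.+3 ^ d)%N; have Bd0 : 0 < Bd by rewrite expn_gt0.
have [F FP] := circ_filler k0 R2.
have [u0 u0P] := @parameters_exist k (circ_const k) Bd C Bd k0 Bd0.
exists (Bd + u0 ^ Q) => n nle; split.
  have [pF gF tF] := FP n (leq_trans (leq_addr _ _) nle).
  have [||D Du Ds] := @spec_realize n [:: F n].
  - by move=> t; rewrite inE => /eqP->.
  - by rewrite /total /= addn0.
  rewrite card_gt0; apply/set0Pn; exists D; apply/good_classesP; split=> // s ss t.
  by rewrite -(perm_mem (spec_uniq Du Ds ss)) inE => /eqP->.
move=> u m un um; have uu0 : u0 <= u.
  have [_ nu] := andP un.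
  have : u0 ^ Q < u.+1 ^ Q by apply: leq_ltn_trans nu; apply: leq_trans nle; apply: leq_addl.
  by rewrite ltn_exp2r // /Q /q0 muln_gt0 addn_gt0 orbT.
have [sz [tau [Bsz tau0 Dn mP]]] := u0P n u uu0 un.
have [jm le] := mP m um; have [_ mn] := andP um.
have [y [uy py gy sy]] := circ_family k0 R2 Bsz.
set l := (m - Bd) %/ sz.*2 in le.
have D0 : 0 < circ_const k.
  by apply/card_gt0P; exists [ffun e => e].
have Ny : (n %/ sz).*2 <= size y.
  rewrite -(leq_pmul2r D0) (leq_trans _ sy) // (leq_trans _ Dn) //.
  by rewrite -mul2n mulnAC.
have sz0 : 0 < sz by apply: leq_trans Bd0 Bsz.
have lm : l * sz.*2 + Bd <= m.
  by rewrite addnC -leq_subRL // leq_trunc_div.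
have sh := good_classes_shift sz0 mn lm Ny uy py gy FP.
apply: leq_trans sh; have := bad_classes_bound tau0 mn (CP tau) (CP n).
move=> bound; apply: (leq_trans (leq_mul (leqnn (n ^ 2)) bound)).
by rewrite mulnCA mulnC leq_mul2r le orbT.
Qed.

Lemma unlabelled_with_rare : exists n0, forall n, n0 <= n ->
  let Qn (G : lgraph n) := locally_lattice d r (graph_of G) in
  0 < #|unlabelled_with Qn| /\
  forall (P : lgraph n -> Prop) u, u ^ Q <= n < u.+1 ^ Q ->
    (forall G, ~ P G -> u ^ Q.-1 <= #|bad_vertices d R G|) ->
    n ^ 2 * (#|unlabelled_with Qn| - #|unlabelled_with (fun G => Qn G /\ P G)|)
      <= n.+1 * #|unlabelled_with Qn|.
Proof.
have [n0 H] := bad_classes_rare; exists n0 => n nn Qn.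
have [gpos rare] := H n nn.
have gsub : good_classes d R n \subset unlabelled_with Qn.
  by apply/fintype.subsetP => C; apply: good_classes_sub.
split=> [|P u un PP]; first exact: leq_trans gpos (subset_leq_card gsub).
pose A := unlabelled_with Qn; pose A' := unlabelled_with (fun G => Qn G /\ P G).
have A'A : A' \subset A.
  apply/fintype.subsetP => C; rewrite !inE => /andP[-> /forall_inP H'] /=.
  by apply/forall_inP => G /H' /asboolP[QG _]; apply/asboolP.
have sub : (A :\: A')%SET \subset
    \bigcup_(m < n.+1 | u ^ Q.-1 <= m) bad_classes k r R n m.
  apply/fintype.subsetP => C; rewrite !inE => /andP[nA' /andP[Cu /forall_inP HQ]].
  move: nA'; rewrite Cu /= => /forall_inPn[G GC /asboolPn nQP].
  have QG : Qn G by apply/asboolP; apply: HQ.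
  have [m /andP[bm mn] Cm] := in_bad_classes Cu GC (fun v => locally_chart v QG).
  have mlt : m < n.+1 by [].
  apply/bigcupP; exists (Ordinal mlt) => //=; apply: leq_trans bm; apply: PP => PG.
  by apply: nQP.
rewrite -/A -/A'; have -> : #|A| - #|A'| = #|(A :\: A')%SET|.
  by rewrite finset.cardsD (finset.setIidPr A'A).
apply: leq_trans (leq_mul (leqnn _) (subset_leq_card sub)) _.
apply: leq_trans (leq_mul (leqnn _) (leq_card_bigcup _ _)) _.
rewrite big_distrr /=; apply: (@leq_trans (\sum_(m < n.+1) #|A|)).
  rewrite big_mkcond; apply: leq_sum => m _; case: ifP => // um.
  apply: leq_trans (rare u m un _) (subset_leq_card gsub).
  by rewrite um -ltnS ltn_ord.
by rewrite sum_nat_const card_ord.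
Qed.

End Final.

Import numFieldNormedType.Exports.
Local Open Scope classical_set_scope.
Local Open Scope ring_scope.

Lemma rstar_bounds d r : (2 <= d)%N -> (rstar d <= r)%N ->
  [/\ (2 <= r)%N, (3 <= r)%N \/ d = 2%N & (d <= r.*2.+1)%N].
Proof.
rewrite /rstar => d2; case: eqP => [->|d'].
  by move=> r2; split=> //; [right | lia].
case: (leqP d 7) => d7 rr; first by split; [|left|]; lia.
have dr : (d <= r.*2.+1)%N by have := leq_uphalf_double d.-1 r; rewrite rr; lia.
by split=> //; [|left]; lia.
Qed.

Lemma powR_root_le (K : realType) (u n Q : nat) : (0 < Q)%N -> (u ^ Q <= n)%N ->
  (u ^ Q.-1)%:R <= n%:R `^ (1 - Q%:R^-1) :> K.
Proof.
move=> Q0 un.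
have e0 : 0 <= 1 - Q%:R^-1 :> K.
  by rewrite subr_ge0 invf_le1 ?ltr0n // ler1n.
have -> : (u ^ Q.-1)%:R = (u ^ Q)%:R `^ (1 - Q%:R^-1) :> K.
  rewrite !natrX -!powR_mulrn // -powRrM mulrBr mulr1 mulfV ?pnatr_eq0 -?lt0n //.
  by congr (_ `^ _); rewrite -subn1 natrB.
by apply: ge0_ler_powR; rewrite ?nnegrE ?ler_nat.
Qed.

Lemma ratio_bounds (K : realType) (n N N' : nat) : (0 < n)%N -> (0 < N)%N -> (N' <= N)%N ->
  (n ^ 2 * (N - N') <= n.+1 * N)%N ->
  1 - 4 * (harmonic n : K) <= N'%:R / N%:R <= (1 : K).
Proof.
move=> n0 N0 le H; rewrite ler_pdivrMr ?ltr0n // mul1r ler_nat le andbT.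
rewrite ler_pdivlMr ?ltr0n // mulrBl mul1r lerBlDr -lerBlDl -natrB //.
rewrite /harmonic /= -mulrA mulrCA ler_pdivlMl ?ltr0n // -!natrM ler_nat.
rewrite -(leq_pmul2l (ltn0Sn n)) mulnCA.
apply: leq_trans (_ : 4 * (n ^ 2 * (N - N')) <= _)%N; last by rewrite leq_mul2l H orbT.
rewrite !mulnA leq_mul2r; apply/orP; right; nia.
Qed.

Theorem theorem44 (K : realType) (d : nat) (hd : (2 <= d)%N) (R : nat) :
  exists kappa : K, 0 < kappa /\
    forall r : nat, (rstar d <= r)%N -> (r <= R)%N ->
      prob_Gn K d r (fun G : lgraph n =>
          #|bad_vertices d R G|%:R <= n%:R `^ (1 - kappa))
        @[n --> \oo] --> (1 : K).
Proof.
case: d hd => [//|k] hd; have k0 : (0 < k)%N by [].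
pose Q := (k.+2 * (k.*2 + 5))%N; have Q0 : (0 < Q)%N by rewrite muln_gt0 addn_gt0 orbT.
exists (Q%:R^-1); split=> [|r rr rR]; first by rewrite invr_gt0 ltr0n.
have [r2 r3 dr] := rstar_bounds hd rr.
have [n0 rare] := unlabelled_with_rare k0 r2 r3 dr rR.
have h0 : 1 - 4 * (harmonic n : K) @[n --> \oo] --> (1 : K).
  rewrite -[X in _ --> X]subr0 -[X in _ - X](mulr0 4).
  by apply: cvgB; [exact: cvg_cst | apply: cvgMr; exact: cvg_harmonic].
apply: (squeeze_cvgr _ h0 (cvg_cst (1 : K))).
exists (n0.+1) => // n /= nn; have [N0 small] := rare n (ltnW nn).
have [u un] := root_exists n Q0.
apply: ratio_bounds => //; first exact: leq_trans nn.
  apply/subset_leq_card/fintype.subsetP => C; rewrite !inE => /andP[-> /forall_inP H] /=.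
  by apply/forall_inP => G /H /asboolP[QG _]; apply/asboolP.
apply: (small _ u un) => G /negP; rewrite -ltNge => lt.
have [le _] := andP un; rewrite -(ler_nat K); apply: le_trans (ltW lt).
exact: powR_root_le.
Qed.
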